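(* There is a locally cubical Gray category, denoted $\mathrm{DblCat}_G$, having (suitably small, preunitary weak) double categories as $0$-cells, strict functors of double categories as $1$-cells, arrow-dimension oplax transformations as vertical $2$-cells, proarrow-dimension oplax transformations as horizontal $2$-cells, and cubical modifications as $3$-cells.
   Context: All compositions are written in diagrammatic (left-to-right) order: $x\cdot y$ and $x\odot y$ mean first $x$, then $y$. **Double categories.** A (weak) double category $\mathbb D$ consists of categories $\mathbb D_0,\mathbb D_1$ and functors $L,R:\mathbb D_1\to\mathbb D_0$, $U:\mathbb D_0\to\mathbb D_1$, $\odot:\mathbb D_1\times_{\mathbb D_0}\mathbb D_1\to\mathbb D_1$ (pullback of $R$ and $L$) with $L(U_A)=A=R(U_A)$, $L(M\odot N)=L(M)$, $R(M\odot N)=R(N)$ (also on morphisms), and natural isomorphisms $\lambda_M:U_{LM}\odot M\to M$, $\rho_M:M\odot U_{RM}\to M$, $\kappa_{M,N,P}:(M\odot N)\odot P\to M\odot(N\odot P)$, whose images under $L$ and $R$ are identities, satisfying Mac Lane's pentagon and triangle equations. Objects and morphisms of $\mathbb D_0$ are the objects and arrows $f:A\to B$ of $\mathbb D$; objects of $\mathbb D_1$ are proarrows $M:A⇸B$ (meaning $L(M)=A$, $R(M)=B$); morphisms of $\mathbb D_1$ are squares. A square $\varphi$ with left arrow $f=L(\varphi)$, right arrow $g=R(\varphi)$, top proarrow (domain) $M$ and bottom proarrow (codomain) $N$ is written $\varphi:(f,g;M,N)$. Composition in $\mathbb D_0$ and $\mathbb D_1$ is written $\cdot$, with identities $\mathrm{id}$.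 An arrow disk $\varphi: f⇸g$ is a square $(f,g;U,U)$; a proarrow disk $\varphi:M\to N$ is a square $(\mathrm{id},\mathrm{id};M,N)$. All double categories are assumed preunitary: $U_A\odot U_A=U_A$ and $\lambda_{U_A}=\mathrm{id}_{U_A}=\rho_{U_A}$ for every object $A$. **Convention $\cong$.** For squares $\varphi:(f,g;M\odot U,N\odot U)$ and $\psi:(f,g;U\odot M,U\odot N)$, write $\varphi\cong\psi$ for $\rho_M^{-1}\cdot\varphi\cdot\rho_N=\lambda_M^{-1}\cdot\psi\cdot\lambda_N$ (and likewise with the two sides exchanged). **Strict functor** $F:\mathbb C\to\mathbb D$: functors $F_0:\mathbb C_0\to\mathbb D_0$, $F_1:\mathbb C_1\to\mathbb D_1$ strictly preserving $L,R,U,\odot,\lambda,\rho,\kappa$. Composition $(F\circledast G)_i=F_i\cdot G_i$ (first $F$, then $G$). **Arrow-dimension oplax transformation** $\alpha:F\to G$ (for $F,G:\mathbb C\to\mathbb D$): arrows $\alpha A:FA\to GA$ for objects $A$; squares $\alpha M:(\alpha A,\alpha B;FM,GM)$ for proarrows $M:A⇸B$; arrow disks $\alpha f:Ff\cdot\alpha A'⇸\alpha A\cdot Gf$ for arrows $f:A\to A'$; such that $\alpha(U_A)=U_{\alpha A}$ and $\alpha(M\odot N)=\alpha M\odot\alpha N$; $\alpha(\mathrm{id}_A)=U_{\alpha A}$ and $\alpha(f\cdot f')=(U_{Ff}\cdot\alpha f')\odot(\alpha f\cdot U_{Gf'})$; and for each square $\varphi:(f,g;M,N)$, $(F\varphi\cdot\alpha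 N)\odot\alpha g\cong\alpha f\odot(\alpha M\cdot G\varphi)$. **Proarrow-dimension oplax transformation** $\gamma:F⇸G$: proarrows $\gamma A:FA⇸GA$; squares $\gamma f:(Ff,Gf;\gamma A,\gamma A')$ for arrows $f:A\to A'$; proarrow disks $\gamma M:FM\odot\gamma B\to\gamma A\odot GM$ for proarrows $M:A⇸B$; such that $\gamma(\mathrm{id}_A)=\mathrm{id}_{\gamma A}$, $\gamma(f\cdot g)=\gamma f\cdot\gamma g$; $\gamma(U_A)=\lambda_{\gamma A}\cdot\rho_{\gamma A}^{-1}$ and, for $M:A⇸B$, $N:B⇸C$, $\gamma(M\odot N)=\kappa\cdot(\mathrm{id}_{FM}\odot\gamma N)\cdot\kappa^{-1}_{FM,\gamma B,GN}\cdot(\gamma M\odot\mathrm{id}_{GN})\cdot\kappa$; and for each square $\varphi:(f,g;M,N)$, $(F\varphi\odot\gamma g)\cdot\gamma N=\gamma M\cdot(\gamma f\odot G\varphi)$. **Cubical modification** $\mu:(\alpha,\beta;\gamma,\delta)$, for $\alpha:F\to F'$, $\beta:G\to G'$, $\gamma:F⇸G$, $\delta:F'⇸G'$: squares $\mu A:(\alpha A,\beta A;\gamma A,\delta A)$ for objects $A$ of $\mathbb C$, such that for each arrow $f:A\to A'$, $\alpha f\odot(\mu A\cdot\delta f)\cong(\gamma f\cdot\mu A')\odot\beta f$, and for each proarrow $M:A⇸B$, $\gamma M\cdot(\mu A\odot\beta M)=(\alpha M\odot\mu B)\cdot\delta M$. **Hom double categories.** For fixed $\mathbb C,\mathbb D$,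 strict functors, arrow- and proarrow-dimension oplax transformations, and modifications form the objects, arrows, proarrows and squares of a double category. Modifications, and object components of transformations, compose componentwise. For $\alpha:F\to G$, $\beta:G\to H$: $(\alpha\cdot\beta)M=\alpha M\cdot\beta M$, $(\alpha\cdot\beta)f=(\alpha f\cdot U_{\beta A'})\odot(U_{\alpha A}\cdot\beta f)$, $(\mathrm{id}_F)M=\mathrm{id}_{FM}$, $(\mathrm{id}_F)f=U_{Ff}$. For $\gamma:F⇸G$, $\delta:G⇸H$: $(\gamma\odot\delta)f=\gamma f\odot\delta f$, $(\gamma\odot\delta)M=\kappa^{-1}\cdot(\gamma M\odot\mathrm{id}_{\delta B})\cdot\kappa\cdot(\mathrm{id}_{\gamma A}\odot\delta M)\cdot\kappa^{-1}$, $(U_F)f=U_{Ff}$, $(U_F)M=\rho_{FM}\cdot\lambda_{FM}^{-1}$. The coherators $\lambda,\rho,\kappa$ are componentwise. **Locally cubical Gray category** $\mathcal C$ (with preunitary weak homs, and oplax in both dimensions). The data are: (i) a collection of $0$-cells, and for each pair of $0$-cells $A,B$ a preunitary double category $\mathcal C(A,B)$, whose objects, arrows, proarrows and squares are called $1$-cells, vertical $2$-cells, horizontal $2$-cells and $3$-cells (with $0$-cell boundary $A\to B$); (ii) identity $1$-cells $\mathrm{Id}_A:A\to A$ and composites $f\circledast g:A\to C$ for $f:A\to B$, $g:B\to C$; and for $1$-cells $a:A'\to A$, $b:B\to B'$ and any cell $x$ (vertical $2$-cell, horizontal $2$-cell or $3$-cell) of $\mathcal C(A,B)$, whiskered cells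 $a\circledast x$ and $x\circledast b$ of the same kind, whose boundaries are the whiskerings of the boundaries of $x$; (iii) interchanger $3$-cells: writing $\alpha:f\to f'$ vertical and $\gamma:f⇸f'$ horizontal in $\mathcal C(A,B)$, and $\beta:g\to g'$ vertical and $\delta:g⇸g'$ horizontal in $\mathcal C(B,C)$, $\chi(\alpha,\delta):(\alpha\circledast g,\ \alpha\circledast g';\ f\circledast\delta,\ f'\circledast\delta)$; $\chi(\gamma,\beta):(f\circledast\beta,\ f'\circledast\beta;\ \gamma\circledast g,\ \gamma\circledast g')$; $\chi(\alpha,\beta):(\alpha\circledast g)\cdot(f'\circledast\beta)⇸(f\circledast\beta)\cdot(\alpha\circledast g')$ (arrow disk); $\chi(\gamma,\delta):(\gamma\circledast g)\odot(f'\circledast\delta)\to(f\circledast\delta)\odot(\gamma\circledast g')$ (proarrow disk). The whiskering laws are: $\mathrm{Id}_A\circledast x=x=x\circledast\mathrm{Id}_B$; $(a'\circledast a)\circledast x=a'\circledast(a\circledast x)$; $x\circledast(b\circledast b')=(x\circledast b)\circledast b'$; $(a\circledast x)\circledast b=a\circledast(x\circledast b)$ (for all cells $x$, including $1$-cells); and $a\circledast-$ and $-\circledast b$ strictly preserve all local double category structure: $\cdot$, $\mathrm{id}$, $\odot$, $U$, $\lambda,\rho,\kappa$. The interchanger laws are as follows. (1) Whiskering, for $2$-cells $x,y$ each vertical or horizontal and suitable $1$-cells $a,b,c$: $\chi(a\circledast x,y)=a\circledast\chi(x,y)$, $\chi(x,y\circledast c)=\chi(x,y)\circledast c$, $\chi(x\circledast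 b,y)=\chi(x,b\circledast y)$. (2) Vertical–horizontal, for $\alpha:f\to f'$, $\alpha':f'\to f''$, $\delta:g⇸g'$, $\delta':g'⇸g''$: $\chi(\mathrm{id}_f,\delta)=\mathrm{id}_{f\circledast\delta}$, $\chi(\alpha\cdot\alpha',\delta)=\chi(\alpha,\delta)\cdot\chi(\alpha',\delta)$, $\chi(\alpha,U_g)=U_{\alpha\circledast g}$, $\chi(\alpha,\delta\odot\delta')=\chi(\alpha,\delta)\odot\chi(\alpha,\delta')$. (3) Horizontal–vertical, for $\gamma:f⇸f'$, $\gamma':f'⇸f''$, $\beta:g\to g'$, $\beta':g'\to g''$: $\chi(U_f,\beta)=U_{f\circledast\beta}$, $\chi(\gamma\odot\gamma',\beta)=\chi(\gamma,\beta)\odot\chi(\gamma',\beta)$, $\chi(\gamma,\mathrm{id}_g)=\mathrm{id}_{\gamma\circledast g}$, $\chi(\gamma,\beta\cdot\beta')=\chi(\gamma,\beta)\cdot\chi(\gamma,\beta')$. (4) Vertical–vertical: $\chi(\mathrm{id}_f,\beta)=U_{f\circledast\beta}$, $\chi(\alpha,\mathrm{id}_g)=U_{\alpha\circledast g}$, $\chi(\alpha\cdot\alpha',\beta)=(U_{\alpha\circledast g}\cdot\chi(\alpha',\beta))\odot(\chi(\alpha,\beta)\cdot U_{\alpha'\circledast g'})$, $\chi(\alpha,\beta\cdot\beta')=(\chi(\alpha,\beta)\cdot U_{f'\circledast\beta'})\odot(U_{f\circledast\beta}\cdot\chi(\alpha,\beta'))$. (5) Horizontal–horizontal: $\chi(U_f,\delta)=\lambda\cdot\rho^{-1}$,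 $\chi(\gamma,U_g)=\rho\cdot\lambda^{-1}$, $\chi(\gamma\odot\gamma',\delta)=\kappa\cdot(\mathrm{id}_{\gamma\circledast g}\odot\chi(\gamma',\delta))\cdot\kappa^{-1}\cdot(\chi(\gamma,\delta)\odot\mathrm{id}_{\gamma'\circledast g'})\cdot\kappa$, $\chi(\gamma,\delta\odot\delta')=\kappa^{-1}\cdot(\chi(\gamma,\delta)\odot\mathrm{id}_{f'\circledast\delta'})\cdot\kappa\cdot(\mathrm{id}_{f\circledast\delta}\odot\chi(\gamma,\delta'))\cdot\kappa^{-1}$, with evident indices. (6) Naturality in the first index, for $\varphi:(\alpha,\alpha';\gamma,\gamma')$ in $\mathcal C(A,B)$ and $\delta:g⇸g'$, $\beta:g\to g'$ in $\mathcal C(B,C)$: $((\varphi\circledast g)\odot\chi(\alpha',\delta))\cdot\chi(\gamma',\delta)=\chi(\gamma,\delta)\cdot(\chi(\alpha,\delta)\odot(\varphi\circledast g'))$ and $((\varphi\circledast g)\cdot\chi(\gamma',\beta))\odot\chi(\alpha',\beta)\cong\chi(\alpha,\beta)\odot(\chi(\gamma,\beta)\cdot(\varphi\circledast g'))$. (7) Naturality in the last index, for $\psi:(\beta,\beta';\delta,\delta')$ in $\mathcal C(B,C)$ and $\gamma:f⇸f'$, $\alpha:f\to f'$ in $\mathcal C(A,B)$: $\chi(\gamma,\delta)\cdot((f\circledast\psi)\odot\chi(\gamma,\beta'))=(\chi(\gamma,\beta)\odot(f'\circledast\psi))\cdot\chi(\gamma,\delta')$ and $\chi(\alpha,\beta)\odot((f\circledast\psi)\cdot\chi(\alpha,\delta'))\cong(\chi(\alpha,\delta)\cdot(f'\circledast\psi))\odot\chi(\alpha,\beta')$.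 *)

(* Defs.v *)
From mathcomp Require Import ssreflect ssrfun ssrbool.
From mathcomp Require Import boolp.

Set Implicit Arguments.
Unset Strict Implicit.
Unset Printing Implicit Defensive.

Declare Scope dbl_scope.
Local Open Scope dbl_scope.

(* Categories are presented with a single type of morphisms, so that all the
   strict equations between cells below (for instance L (M ⊙ N) = L M, or
   F (M ⊙ N) = F M ⊙ F N) are plain equalities, without transports.
   Composition is defined on composable pairs only, and all compositions are
   diagrammatic. *)
Record cat (O M : Type) : Type := Cat {
  cdom : M -> O;
  ccod : M -> O;
  cid : O -> M;
  ccomp : forall f g : M, ccod f = cdom g -> M;
  cdom_id : forall A, cdom (cid A) = A;
  ccod_id : forall A, ccod (cid A) = A;
  cdom_comp : forall f g h, cdom (@ccomp f g h) = cdom f;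
  ccod_comp : forall f g h, ccod (@ccomp f g h) = ccod g;
  ccomp_idl : forall f h, @ccomp (cid (cdom f)) f h = f;
  ccomp_idr : forall f h, @ccomp f (cid (ccod f)) h = f;
  ccompA : forall f g k h1 h2 h3 h4,
    @ccomp (@ccomp f g h1) k h2 = @ccomp f (@ccomp g k h3) h4
}.

Record functor (O M O' M' : Type) (C : cat O M) (D : cat O' M') : Type :=
  Functor {
    fob : O -> O';
    fmor : M -> M';
    fdom : forall f, cdom D (fmor f) = fob (cdom C f);
    fcod : forall f, ccod D (fmor f) = fob (ccod C f);
    fid : forall A, fmor (cid C A) = cid D (fob A);
    fcomp : forall f g h h',
      fmor (@ccomp _ _ C f g h) = @ccomp _ _ D (fmor f) (fmor g) h'
  }.

Definition functor_id (O M : Type) (C : cat O M) : functor C C.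
Proof.
by exists (fun A => A) (fun f => f) => // f g h h'; rewrite (Prop_irrelevance h h').
Defined.

Definition functor_comp (O1 M1 O2 M2 O3 M3 : Type) (C1 : cat O1 M1)
  (C2 : cat O2 M2) (C3 : cat O3 M3) (F : functor C1 C2) (G : functor C2 C3) :
  functor C1 C3.
Proof.
exists (fun A => fob G (fob F A)) (fun f => fmor G (fmor F f)).
- by move=> f; rewrite !fdom.
- by move=> f; rewrite !fcod.
- by move=> A; rewrite !fid.
- move=> f g h h'.
  have h1 : ccod C2 (fmor F f) = cdom C2 (fmor F g) by rewrite fcod fdom h.
  by rewrite (fcomp h h1) (fcomp h1 h').
Defined.

(* The structure of a double category with objects O, arrows V, proarrows P
   and squares S; its laws are in dbl_laws below. The inverses of the
   coherators are part of the structure. *)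
Record dbl_str (O V P S : Type) : Type := DblStr {
  D0 : cat O V;
  D1 : cat P S;
  DL : functor D1 D0;
  DR : functor D1 D0;
  DU : functor D0 D1;
  Dhcp : forall M N : P, fob DR M = fob DL N -> P;
  Dhcs : forall x y : S, fmor DR x = fmor DL y -> S;
  Dlam : P -> S;
  DlamV : P -> S;
  Drho : P -> S;
  DrhoV : P -> S;
  Dkap : forall M N Q : P,
    fob DR M = fob DL N -> fob DR N = fob DL Q -> S;
  DkapV : forall M N Q : P,
    fob DR M = fob DL N -> fob DR N = fob DL Q -> S
}.

Record dbl_data : Type := DblData {
  ob : Type;
  arr : Type;
  pro : Type;
  sq : Type;
  str : dbl_str ob arr pro sq
}.

Section Operations.
Variable D : dbl_data.

Definition src (f : arr D) : ob D := cdom (D0 (str D)) f.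
Definition tgt (f : arr D) : ob D := ccod (D0 (str D)) f.
Definition ida (A : ob D) : arr D := cid (D0 (str D)) A.
Definition top (x : sq D) : pro D := cdom (D1 (str D)) x.
Definition bot (x : sq D) : pro D := ccod (D1 (str D)) x.
Definition ids (M : pro D) : sq D := cid (D1 (str D)) M.
Definition lob (M : pro D) : ob D := fob (DL (str D)) M.
Definition rob (M : pro D) : ob D := fob (DR (str D)) M.
Definition larr (x : sq D) : arr D := fmor (DL (str D)) x.
Definition rarr (x : sq D) : arr D := fmor (DR (str D)) x.
Definition Uo (A : ob D) : pro D := fob (DU (str D)) A.
Definition Ua (f : arr D) : sq D := fmor (DU (str D)) f.
Definition lam (M : pro D) : sq D := Dlam (str D) M.
Definition lamV (M : pro D) : sq D := DlamV (str D) M.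
Definition rho (M : pro D) : sq D := Drho (str D) M.
Definition rhoV (M : pro D) : sq D := DrhoV (str D) M.

(* Total versions of the partial operations, which keep the equations free of
   composability proofs. Their values on non-composable arguments are
   irrelevant: every law below only uses them on composable ones. *)
Definition acomp (f g : arr D) : arr D :=
  if pselect (tgt f = src g) is left h then @ccomp _ _ (D0 (str D)) f g h
  else f.
Definition vcomp (x y : sq D) : sq D :=
  if pselect (bot x = top y) is left h then @ccomp _ _ (D1 (str D)) x y h
  else x.
Definition hcomp (M N : pro D) : pro D :=
  if pselect (rob M = lob N) is left h then @Dhcp _ _ _ _ (str D) M N h
  else M.
Definition hcomps (x y : sq D) : sq D :=
  if pselect (rarr x = larr y) is left h then @Dhcs _ _ _ _ (str D) x y h
  else x.
Definition kap (M N P : pro D) : sq D :=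
  if pselect (rob M = lob N) is left h then
    if pselect (rob N = lob P) is left h' then
      @Dkap _ _ _ _ (str D) M N P h h'
    else ids M
  else ids M.
Definition kapV (M N P : pro D) : sq D :=
  if pselect (rob M = lob N) is left h then
    if pselect (rob N = lob P) is left h' then
      @DkapV _ _ _ _ (str D) M N P h h'
    else ids M
  else ids M.

Definition is_arr (f : arr D) (A B : ob D) : Prop := src f = A /\ tgt f = B.
Definition is_pro (M : pro D) (A B : ob D) : Prop := lob M = A /\ rob M = B.
(* x : (f, g; M, N) *)
Definition is_sq (x : sq D) (f g : arr D) (M N : pro D) : Prop :=
  [/\ larr x = f, rarr x = g, top x = M & bot x = N].

End Operations.

Notation "f ·0 g" := (acomp f g) (at level 40, left associativity) : dbl_scope.
Notation "x · y" := (vcomp x y) (at level 40, left associativity) : dbl_scope.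
Notation "M ⊙0 N" := (hcomp M N) (at level 40, left associativity) : dbl_scope.
Notation "x ⊙ y" := (hcomps x y) (at level 40, left associativity) : dbl_scope.

Definition is_arrow_disk (D : dbl_data) (x : sq D) (f g : arr D) : Prop :=
  is_sq x f g (Uo (src f)) (Uo (tgt f)).

Definition is_proarrow_disk (D : dbl_data) (x : sq D) (M N : pro D) : Prop :=
  is_sq x (ida (lob M)) (ida (rob M)) M N.

(* cong M N x y is the convention x ≅ y for x : (f, g; M ⊙ U, N ⊙ U) and
   y : (f, g; U ⊙ M, U ⊙ N). Since M is not determined by M ⊙ U, the
   proarrows are explicit arguments. *)
Definition cong (D : dbl_data) (M N : pro D) (x y : sq D) : Prop :=
  rhoV M · x · rho N = lamV M · y · lam N.

Record dbl_laws (D : dbl_data) : Prop := DblLaws {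
  lob_Uo : forall A : ob D, lob (Uo A) = A;
  rob_Uo : forall A : ob D, rob (Uo A) = A;
  larr_Ua : forall f : arr D, larr (Ua f) = f;
  rarr_Ua : forall f : arr D, rarr (Ua f) = f;
  lob_hcomp : forall M N : pro D, rob M = lob N -> lob (M ⊙0 N) = lob M;
  rob_hcomp : forall M N : pro D, rob M = lob N -> rob (M ⊙0 N) = rob N;
  larr_hcomps : forall x y : sq D, rarr x = larr y -> larr (x ⊙ y) = larr x;
  rarr_hcomps : forall x y : sq D, rarr x = larr y -> rarr (x ⊙ y) = rarr y;
  (* functoriality of ⊙ on the pullback of R and L *)
  top_hcomps : forall x y : sq D, rarr x = larr y ->
    top (x ⊙ y) = top x ⊙0 top y;
  bot_hcomps : forall x y : sq D, rarr x = larr y ->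
    bot (x ⊙ y) = bot x ⊙0 bot y;
  hcomps_ids : forall M N : pro D, rob M = lob N ->
    ids M ⊙ ids N = ids (M ⊙0 N);
  interchange : forall x x' y y' : sq D,
    rarr x = larr y -> rarr x' = larr y' -> bot x = top x' -> bot y = top y' ->
    (x · x') ⊙ (y · y') = (x ⊙ y) · (x' ⊙ y');
  lam_sq : forall M : pro D, is_proarrow_disk (lam M) (Uo (lob M) ⊙0 M) M;
  lamV_sq : forall M : pro D, is_proarrow_disk (lamV M) M (Uo (lob M) ⊙0 M);
  lamK : forall M : pro D, lam M · lamV M = ids (Uo (lob M) ⊙0 M);
  lamVK : forall M : pro D, lamV M · lam M = ids M;
  lam_nat : forall x : sq D,
    (Ua (larr x) ⊙ x) · lam (bot x) = lam (top x) · x;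
  rho_sq : forall M : pro D, is_proarrow_disk (rho M) (M ⊙0 Uo (rob M)) M;
  rhoV_sq : forall M : pro D, is_proarrow_disk (rhoV M) M (M ⊙0 Uo (rob M));
  rhoK : forall M : pro D, rho M · rhoV M = ids (M ⊙0 Uo (rob M));
  rhoVK : forall M : pro D, rhoV M · rho M = ids M;
  rho_nat : forall x : sq D,
    (x ⊙ Ua (rarr x)) · rho (bot x) = rho (top x) · x;
  kap_sq : forall M N P : pro D, rob M = lob N -> rob N = lob P ->
    is_proarrow_disk (kap M N P) ((M ⊙0 N) ⊙0 P) (M ⊙0 (N ⊙0 P));
  kapV_sq : forall M N P : pro D, rob M = lob N -> rob N = lob P ->
    is_proarrow_disk (kapV M N P) (M ⊙0 (N ⊙0 P)) ((M ⊙0 N) ⊙0 P);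
  kapK : forall M N P : pro D, rob M = lob N -> rob N = lob P ->
    kap M N P · kapV M N P = ids ((M ⊙0 N) ⊙0 P);
  kapVK : forall M N P : pro D, rob M = lob N -> rob N = lob P ->
    kapV M N P · kap M N P = ids (M ⊙0 (N ⊙0 P));
  kap_nat : forall x y z : sq D, rarr x = larr y -> rarr y = larr z ->
    ((x ⊙ y) ⊙ z) · kap (bot x) (bot y) (bot z) =
    kap (top x) (top y) (top z) · (x ⊙ (y ⊙ z));
  pentagon : forall M N P Q : pro D,
    rob M = lob N -> rob N = lob P -> rob P = lob Q ->
    kap (M ⊙0 N) P Q · kap M N (P ⊙0 Q) =
    (kap M N P ⊙ ids Q) · kap M (N ⊙0 P) Q · (ids M ⊙ kap N P Q);
  triangle : forall M N : pro D, rob M = lob N ->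
    kap M (Uo (rob M)) N · (ids M ⊙ lam N) = rho M ⊙ ids N;
  preunit_hcomp : forall A : ob D, Uo A ⊙0 Uo A = Uo A;
  preunit_lam : forall A : ob D, lam (Uo A) = ids (Uo A);
  preunit_rho : forall A : ob D, rho (Uo A) = ids (Uo A)
}.

(* (Weak) preunitary double categories. *)
Record dblcat : Type := DblCat {
  dbl_of :> dbl_data;
  dblcatP : dbl_laws dbl_of
}.

(* Strict functors. *)
Record sfun (C D : dblcat) : Type := SFun {
  sf0 : functor (D0 (str C)) (D0 (str D));
  sf1 : functor (D1 (str C)) (D1 (str D));
  sf_lob : forall M : pro C, lob (fob sf1 M : pro D) = fob sf0 (lob M);
  sf_rob : forall M : pro C, rob (fob sf1 M : pro D) = fob sf0 (rob M);
  sf_larr : forall x : sq C, larr (fmor sf1 x : sq D) = fmor sf0 (larr x);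
  sf_rarr : forall x : sq C, rarr (fmor sf1 x : sq D) = fmor sf0 (rarr x);
  sf_Uo : forall A : ob C, fob sf1 (Uo A) = Uo (fob sf0 A : ob D);
  sf_Ua : forall f : arr C, fmor sf1 (Ua f) = Ua (fmor sf0 f : arr D);
  sf_hcomp : forall M N : pro C, rob M = lob N ->
    fob sf1 (M ⊙0 N) = (fob sf1 M : pro D) ⊙0 (fob sf1 N : pro D);
  sf_hcomps : forall x y : sq C, rarr x = larr y ->
    fmor sf1 (x ⊙ y) = (fmor sf1 x : sq D) ⊙ (fmor sf1 y : sq D);
  sf_lam : forall M : pro C, fmor sf1 (lam M) = lam (fob sf1 M : pro D);
  sf_rho : forall M : pro C, fmor sf1 (rho M) = rho (fob sf1 M : pro D);
  sf_kap : forall M N P : pro C, rob M = lob N -> rob N = lob P ->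
    fmor sf1 (kap M N P) =
    kap (fob sf1 M : pro D) (fob sf1 N : pro D) (fob sf1 P : pro D)
}.

Definition sfo (C D : dblcat) (F : sfun C D) (A : ob C) : ob D := fob (sf0 F) A.
Definition sfa (C D : dblcat) (F : sfun C D) (f : arr C) : arr D :=
  fmor (sf0 F) f.
Definition sfp (C D : dblcat) (F : sfun C D) (M : pro C) : pro D :=
  fob (sf1 F) M.
Definition sfs (C D : dblcat) (F : sfun C D) (x : sq C) : sq D :=
  fmor (sf1 F) x.

Definition sfun_id (C : dblcat) : sfun C C.
Proof.
by exists (functor_id (D0 (str C))) (functor_id (D1 (str C))).
Defined.

Definition sfun_comp (C D E : dblcat) (F : sfun C D) (G : sfun D E) : sfun C E.
Proof.
exists (functor_comp (sf0 F) (sf0 G)) (functor_comp (sf1 F) (sf1 G)) => /=.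
- by move=> M; rewrite !sf_lob.
- by move=> M; rewrite !sf_rob.
- by move=> x; rewrite !sf_larr.
- by move=> x; rewrite !sf_rarr.
- by move=> A; rewrite !sf_Uo.
- by move=> f; rewrite !sf_Ua.
- by move=> M N h; rewrite !sf_hcomp // sf_lob sf_rob h.
- by move=> x y h; rewrite !sf_hcomps // sf_larr sf_rarr h.
- by move=> M; rewrite !sf_lam.
- by move=> M; rewrite !sf_rho.
- by move=> M N P h h'; rewrite !sf_kap // ?sf_lob ?sf_rob ?h ?h'.
Defined.

(* Arrow-dimension oplax transformations. *)
Record vtrans (C D : dblcat) : Type := VTrans {
  vsrc : sfun C D;
  vtgt : sfun C D;
  vob : ob C -> arr D;
  vpro : pro C -> sq D;
  varr : arr C -> sq D;
  vob_arr : forall A, is_arr (vob A) (sfo vsrc A) (sfo vtgt A);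
  vpro_sq : forall M,
    is_sq (vpro M) (vob (lob M)) (vob (rob M)) (sfp vsrc M) (sfp vtgt M);
  varr_sq : forall f,
    is_arrow_disk (varr f) (sfa vsrc f ·0 vob (tgt f))
                           (vob (src f) ·0 sfa vtgt f);
  vpro_U : forall A, vpro (Uo A) = Ua (vob A);
  vpro_hcomp : forall M N, rob M = lob N -> vpro (M ⊙0 N) = vpro M ⊙ vpro N;
  varr_id : forall A, varr (ida A) = Ua (vob A);
  varr_comp : forall f f', tgt f = src f' ->
    varr (f ·0 f') =
    (Ua (sfa vsrc f) · varr f') ⊙ (varr f · Ua (sfa vtgt f'));
  v_nat : forall x : sq C,
    cong (sfp vsrc (top x)) (sfp vtgt (bot x))
      ((sfs vsrc x · vpro (bot x)) ⊙ varr (rarr x))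
      (varr (larr x) ⊙ (vpro (top x) · sfs vtgt x))
}.

(* Proarrow-dimension oplax transformations. *)
Record htrans (C D : dblcat) : Type := HTrans {
  hsrc : sfun C D;
  htgt : sfun C D;
  hob : ob C -> pro D;
  harr : arr C -> sq D;
  hpro : pro C -> sq D;
  hob_pro : forall A, is_pro (hob A) (sfo hsrc A) (sfo htgt A);
  harr_sq : forall f,
    is_sq (harr f) (sfa hsrc f) (sfa htgt f) (hob (src f)) (hob (tgt f));
  hpro_sq : forall M,
    is_proarrow_disk (hpro M) (sfp hsrc M ⊙0 hob (rob M))
                              (hob (lob M) ⊙0 sfp htgt M);
  harr_id : forall A, harr (ida A) = ids (hob A);
  harr_comp : forall f g, tgt f = src g -> harr (f ·0 g) = harr f · harr g;
  hpro_U : forall A, hpro (Uo A) = lam (hob A) · rhoV (hob A);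
  hpro_hcomp : forall M N, rob M = lob N ->
    hpro (M ⊙0 N) =
      kap (sfp hsrc M) (sfp hsrc N) (hob (rob N))
      · (ids (sfp hsrc M) ⊙ hpro N)
      · kapV (sfp hsrc M) (hob (rob M)) (sfp htgt N)
      · (hpro M ⊙ ids (sfp htgt N))
      · kap (hob (lob M)) (sfp htgt M) (sfp htgt N);
  h_nat : forall x : sq C,
    (sfs hsrc x ⊙ harr (rarr x)) · hpro (bot x) =
    hpro (top x) · (harr (larr x) ⊙ sfs htgt x)
}.

(* Cubical modifications (ml, mr; mt, mb). *)
Record modif (C D : dblcat) : Type := Modif {
  ml : vtrans C D;
  mr : vtrans C D;
  mt : htrans C D;
  mb : htrans C D;
  m_tl : vsrc ml = hsrc mt;
  m_tr : vsrc mr = htgt mt;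
  m_bl : vtgt ml = hsrc mb;
  m_br : vtgt mr = htgt mb;
  mob : ob C -> sq D;
  mob_sq : forall A,
    is_sq (mob A) (vob ml A) (vob mr A) (hob mt A) (hob mb A);
  m_arr : forall f : arr C,
    cong (hob mt (src f)) (hob mb (tgt f))
      ((harr mt f · mob (tgt f)) ⊙ varr mr f)
      (varr ml f ⊙ (mob (src f) · harr mb f));
  m_pro : forall M : pro C,
    hpro mt M · (mob (lob M) ⊙ vpro mr M) =
    (vpro ml M ⊙ mob (rob M)) · hpro mb M
}.

(* S is the hom double category structure on strict functors, transformations
   and modifications from C to D. Transformations and modifications are
   determined by their boundaries and components, so these equations
   determine S (the inverse coherators, which are not mentioned, being
   determined by dbl_laws). *)
Record is_hom_str (C D : dblcat)
  (S : dbl_str (sfun C D) (vtrans C D) (htrans C D) (modif C D)) : Prop :=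
IsHomStr {
  hom_vsrc : forall a, cdom (D0 S) a = vsrc a;
  hom_vtgt : forall a, ccod (D0 S) a = vtgt a;
  hom_hsrc : forall c, fob (DL S) c = hsrc c;
  hom_htgt : forall c, fob (DR S) c = htgt c;
  hom_mt : forall m, cdom (D1 S) m = mt m;
  hom_mb : forall m, ccod (D1 S) m = mb m;
  hom_ml : forall m, fmor (DL S) m = ml m;
  hom_mr : forall m, fmor (DR S) m = mr m;

  hom_vid_ob : forall F A, vob (cid (D0 S) F) A = ida (sfo F A);
  hom_vid_pro : forall F M, vpro (cid (D0 S) F) M = ids (sfp F M);
  hom_vid_arr : forall F f, varr (cid (D0 S) F) f = Ua (sfa F f);
  hom_vcomp_ob : forall a b h A,
    vob (@ccomp _ _ (D0 S) a b h) A = vob a A ·0 vob b A;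
  hom_vcomp_pro : forall a b h M,
    vpro (@ccomp _ _ (D0 S) a b h) M = vpro a M · vpro b M;
  hom_vcomp_arr : forall a b h f,
    varr (@ccomp _ _ (D0 S) a b h) f =
    (varr a f · Ua (vob b (tgt f))) ⊙ (Ua (vob a (src f)) · varr b f);

  hom_hid_ob : forall F A, hob (fob (DU S) F) A = Uo (sfo F A);
  hom_hid_arr : forall F f, harr (fob (DU S) F) f = Ua (sfa F f);
  hom_hid_pro : forall F M,
    hpro (fob (DU S) F) M = rho (sfp F M) · lamV (sfp F M);
  hom_hcomp_ob : forall c d h A,
    hob (@Dhcp _ _ _ _ S c d h) A = hob c A ⊙0 hob d A;
  hom_hcomp_arr : forall c d h f,
    harr (@Dhcp _ _ _ _ S c d h) f = harr c f ⊙ harr d f;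
  hom_hcomp_pro : forall c d h M,
    hpro (@Dhcp _ _ _ _ S c d h) M =
      kapV (sfp (hsrc c) M) (hob c (rob M)) (hob d (rob M))
      · (hpro c M ⊙ ids (hob d (rob M)))
      · kap (hob c (lob M)) (sfp (htgt c) M) (hob d (rob M))
      · (ids (hob c (lob M)) ⊙ hpro d M)
      · kapV (hob c (lob M)) (hob d (lob M)) (sfp (htgt d) M);

  hom_mid : forall c A, mob (cid (D1 S) c) A = ids (hob c A);
  hom_mcomp : forall m n h A,
    mob (@ccomp _ _ (D1 S) m n h) A = mob m A · mob n A;
  hom_mU : forall a A, mob (fmor (DU S) a) A = Ua (vob a A);
  hom_mhcomp : forall m n h A,
    mob (@Dhcs _ _ _ _ S m n h) A = mob m A ⊙ mob n A;
  hom_lam : forall c A, mob (Dlam S c) A = lam (hob c A);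
  hom_rho : forall c A, mob (Drho S c) A = rho (hob c A);
  hom_kap : forall c d e h h' A,
    mob (@Dkap _ _ _ _ S c d e h h') A = kap (hob c A) (hob d A) (hob e A)
}.

(* The structure of a locally cubical Gray category with given 0-cells and hom
   double categories; its laws are in gray_laws below. Whiskering by a 1-cell
   acts on all cells of a hom double category and strictly preserves all of
   its structure, that is, it is a strict functor. *)
Record gray_str (cell0 : Type) (hom : cell0 -> cell0 -> dblcat) : Type :=
GrayStr {
  Id1 : forall A, ob (hom A A);
  comp1 : forall A B C, ob (hom A B) -> ob (hom B C) -> ob (hom A C);
  lwhisk : forall A' A B, ob (hom A' A) -> sfun (hom A B) (hom A' B);
  rwhisk : forall A B B', ob (hom B B') -> sfun (hom A B) (hom A B');
  chi_vh : forall A B C, arr (hom A B) -> pro (hom B C) -> sq (hom A C);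
  chi_hv : forall A B C, pro (hom A B) -> arr (hom B C) -> sq (hom A C);
  chi_vv : forall A B C, arr (hom A B) -> arr (hom B C) -> sq (hom A C);
  chi_hh : forall A B C, pro (hom A B) -> pro (hom B C) -> sq (hom A C)
}.

Section GrayLaws.
Variables (cell0 : Type) (hom : cell0 -> cell0 -> dblcat) (G : gray_str hom).

(* The letters v, h and s stand for vertical 2-cells, horizontal 2-cells and
   3-cells. *)
Local Notation "f ⊛ g" := (comp1 G f g) (at level 30).
Local Notation "a ◁v x" := (sfa (lwhisk G _ a) x) (at level 30).
Local Notation "a ◁h x" := (sfp (lwhisk G _ a) x) (at level 30).
Local Notation "a ◁s x" := (sfs (lwhisk G _ a) x) (at level 30).
Local Notation "x ▷v b" := (sfa (rwhisk G _ b) x) (at level 30).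
Local Notation "x ▷h b" := (sfp (rwhisk G _ b) x) (at level 30).
Local Notation "x ▷s b" := (sfs (rwhisk G _ b) x) (at level 30).
Local Notation χvh := (chi_vh G).
Local Notation χhv := (chi_hv G).
Local Notation χvv := (chi_vv G).
Local Notation χhh := (chi_hh G).

Record gray_laws : Prop := GrayLaws {
  lwhisk_ob : forall A' A B (a : ob (hom A' A)) (f : ob (hom A B)),
    sfo (lwhisk G B a) f = a ⊛ f;
  rwhisk_ob : forall A B B' (b : ob (hom B B')) (f : ob (hom A B)),
    sfo (rwhisk G A b) f = f ⊛ b;
  chi_vh_sq : forall A B C (α : arr (hom A B)) (δ : pro (hom B C)),
    is_sq (χvh α δ) (α ▷v lob δ) (α ▷v rob δ) (src α ◁h δ) (tgt α ◁h δ);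
  chi_hv_sq : forall A B C (γ : pro (hom A B)) (β : arr (hom B C)),
    is_sq (χhv γ β) (lob γ ◁v β) (rob γ ◁v β) (γ ▷h src β) (γ ▷h tgt β);
  chi_vv_sq : forall A B C (α : arr (hom A B)) (β : arr (hom B C)),
    is_arrow_disk (χvv α β) ((α ▷v src β) ·0 (tgt α ◁v β))
                            ((src α ◁v β) ·0 (α ▷v tgt β));
  chi_hh_sq : forall A B C (γ : pro (hom A B)) (δ : pro (hom B C)),
    is_proarrow_disk (χhh γ δ) ((γ ▷h lob δ) ⊙0 (rob γ ◁h δ))
                               ((lob γ ◁h δ) ⊙0 (γ ▷h rob δ));

  whisk_idl : forall A B, lwhisk G B (Id1 G A) = sfun_id (hom A B);
  whisk_idr : forall A B, rwhisk G A (Id1 G B) = sfun_id (hom A B);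
  whisk_compl : forall A2 A1 A B (a' : ob (hom A2 A1)) (a : ob (hom A1 A)),
    lwhisk G B (a' ⊛ a) = sfun_comp (lwhisk G B a) (lwhisk G B a');
  whisk_compr : forall A B B1 B2 (b : ob (hom B B1)) (b' : ob (hom B1 B2)),
    rwhisk G A (b ⊛ b') = sfun_comp (rwhisk G A b) (rwhisk G A b');
  whisk_lr : forall A' A B B' (a : ob (hom A' A)) (b : ob (hom B B')),
    sfun_comp (lwhisk G B a) (rwhisk G A' b) =
    sfun_comp (rwhisk G A b) (lwhisk G B' a);

  chi_vh_l : forall A' A B C (a : ob (hom A' A)) (x : arr (hom A B))
    (y : pro (hom B C)), χvh (a ◁v x) y = a ◁s χvh x y;
  chi_hv_l : forall A' A B C (a : ob (hom A' A)) (x : pro (hom A B))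
    (y : arr (hom B C)), χhv (a ◁h x) y = a ◁s χhv x y;
  chi_vv_l : forall A' A B C (a : ob (hom A' A)) (x : arr (hom A B))
    (y : arr (hom B C)), χvv (a ◁v x) y = a ◁s χvv x y;
  chi_hh_l : forall A' A B C (a : ob (hom A' A)) (x : pro (hom A B))
    (y : pro (hom B C)), χhh (a ◁h x) y = a ◁s χhh x y;
  chi_vh_r : forall A B C C' (x : arr (hom A B)) (y : pro (hom B C))
    (c : ob (hom C C')), χvh x (y ▷h c) = χvh x y ▷s c;
  chi_hv_r : forall A B C C' (x : pro (hom A B)) (y : arr (hom B C))
    (c : ob (hom C C')), χhv x (y ▷v c) = χhv x y ▷s c;
  chi_vv_r : forall A B C C' (x : arr (hom A B)) (y : arr (hom B C))
    (c : ob (hom C C')), χvv x (y ▷v c) = χvv x y ▷s c;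
  chi_hh_r : forall A B C C' (x : pro (hom A B)) (y : pro (hom B C))
    (c : ob (hom C C')), χhh x (y ▷h c) = χhh x y ▷s c;
  chi_vh_m : forall A B B' C (x : arr (hom A B)) (b : ob (hom B B'))
    (y : pro (hom B' C)), χvh (x ▷v b) y = χvh x (b ◁h y);
  chi_hv_m : forall A B B' C (x : pro (hom A B)) (b : ob (hom B B'))
    (y : arr (hom B' C)), χhv (x ▷h b) y = χhv x (b ◁v y);
  chi_vv_m : forall A B B' C (x : arr (hom A B)) (b : ob (hom B B'))
    (y : arr (hom B' C)), χvv (x ▷v b) y = χvv x (b ◁v y);
  chi_hh_m : forall A B B' C (x : pro (hom A B)) (b : ob (hom B B'))
    (y : pro (hom B' C)), χhh (x ▷h b) y = χhh x (b ◁h y);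

  chi_vh_id : forall A B C (f : ob (hom A B)) (δ : pro (hom B C)),
    χvh (ida f) δ = ids (f ◁h δ);
  chi_vh_comp : forall A B C (α α' : arr (hom A B)) (δ : pro (hom B C)),
    tgt α = src α' -> χvh (α ·0 α') δ = χvh α δ · χvh α' δ;
  chi_vh_U : forall A B C (α : arr (hom A B)) (g : ob (hom B C)),
    χvh α (Uo g) = Ua (α ▷v g);
  chi_vh_hcomp : forall A B C (α : arr (hom A B)) (δ δ' : pro (hom B C)),
    rob δ = lob δ' -> χvh α (δ ⊙0 δ') = χvh α δ ⊙ χvh α δ';

  chi_hv_U : forall A B C (f : ob (hom A B)) (β : arr (hom B C)),
    χhv (Uo f) β = Ua (f ◁v β);
  chi_hv_hcomp : forall A B C (γ γ' : pro (hom A B)) (β : arr (hom B C)),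
    rob γ = lob γ' -> χhv (γ ⊙0 γ') β = χhv γ β ⊙ χhv γ' β;
  chi_hv_id : forall A B C (γ : pro (hom A B)) (g : ob (hom B C)),
    χhv γ (ida g) = ids (γ ▷h g);
  chi_hv_comp : forall A B C (γ : pro (hom A B)) (β β' : arr (hom B C)),
    tgt β = src β' -> χhv γ (β ·0 β') = χhv γ β · χhv γ β';

  chi_vv_idl : forall A B C (f : ob (hom A B)) (β : arr (hom B C)),
    χvv (ida f) β = Ua (f ◁v β);
  chi_vv_idr : forall A B C (α : arr (hom A B)) (g : ob (hom B C)),
    χvv α (ida g) = Ua (α ▷v g);
  chi_vv_compl : forall A B C (α α' : arr (hom A B)) (β : arr (hom B C)),
    tgt α = src α' ->
    χvv (α ·0 α') β =
    (Ua (α ▷v src β) · χvv α' β) ⊙ (χvv α β · Ua (α' ▷v tgt β));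
  chi_vv_compr : forall A B C (α : arr (hom A B)) (β β' : arr (hom B C)),
    tgt β = src β' ->
    χvv α (β ·0 β') =
    (χvv α β · Ua (tgt α ◁v β')) ⊙ (Ua (src α ◁v β) · χvv α β');

  chi_hh_Ul : forall A B C (f : ob (hom A B)) (δ : pro (hom B C)),
    χhh (Uo f) δ = lam (f ◁h δ) · rhoV (f ◁h δ);
  chi_hh_Ur : forall A B C (γ : pro (hom A B)) (g : ob (hom B C)),
    χhh γ (Uo g) = rho (γ ▷h g) · lamV (γ ▷h g);
  chi_hh_hcompl : forall A B C (γ γ' : pro (hom A B)) (δ : pro (hom B C)),
    rob γ = lob γ' ->
    χhh (γ ⊙0 γ') δ =
      kap (γ ▷h lob δ) (γ' ▷h lob δ) (rob γ' ◁h δ)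
      · (ids (γ ▷h lob δ) ⊙ χhh γ' δ)
      · kapV (γ ▷h lob δ) (rob γ ◁h δ) (γ' ▷h rob δ)
      · (χhh γ δ ⊙ ids (γ' ▷h rob δ))
      · kap (lob γ ◁h δ) (γ ▷h rob δ) (γ' ▷h rob δ);
  chi_hh_hcompr : forall A B C (γ : pro (hom A B)) (δ δ' : pro (hom B C)),
    rob δ = lob δ' ->
    χhh γ (δ ⊙0 δ') =
      kapV (γ ▷h lob δ) (rob γ ◁h δ) (rob γ ◁h δ')
      · (χhh γ δ ⊙ ids (rob γ ◁h δ'))
      · kap (lob γ ◁h δ) (γ ▷h rob δ) (rob γ ◁h δ')
      · (ids (lob γ ◁h δ) ⊙ χhh γ δ')
      · kapV (lob γ ◁h δ) (lob γ ◁h δ') (γ ▷h rob δ');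

  chi_natl_h : forall A B C (φ : sq (hom A B)) (δ : pro (hom B C)),
    ((φ ▷s lob δ) ⊙ χvh (rarr φ) δ) · χhh (bot φ) δ =
    χhh (top φ) δ · (χvh (larr φ) δ ⊙ (φ ▷s rob δ));
  chi_natl_v : forall A B C (φ : sq (hom A B)) (β : arr (hom B C)),
    cong (top φ ▷h src β) (bot φ ▷h tgt β)
      (((φ ▷s src β) · χhv (bot φ) β) ⊙ χvv (rarr φ) β)
      (χvv (larr φ) β ⊙ (χhv (top φ) β · (φ ▷s tgt β)));

  chi_natr_h : forall A B C (γ : pro (hom A B)) (ψ : sq (hom B C)),
    χhh γ (top ψ) · ((lob γ ◁s ψ) ⊙ χhv γ (rarr ψ)) =
    (χhv γ (larr ψ) ⊙ (rob γ ◁s ψ)) · χhh γ (bot ψ);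
  chi_natr_v : forall A B C (α : arr (hom A B)) (ψ : sq (hom B C)),
    cong (src α ◁h top ψ) (tgt α ◁h bot ψ)
      ((χvh α (top ψ) · (tgt α ◁s ψ)) ⊙ χvv α (rarr ψ))
      (χvv α (larr ψ) ⊙ ((src α ◁s ψ) · χvh α (bot ψ)))
}.

End GrayLaws.

(* Main.v *)
(* In the arrow dimension, preunitarity makes arrow disks compose strictly, and
   they act strictly on squares (◃ and ▹ below). Written with these actions, the
   equations ≅ of transformations and modifications are ordinary equations that
   can be pasted with the interchange law alone.

   In the proarrow dimension coherence is unavoidable, but it only enters
   through three consequences of the pentagon and of Kelly's unit lemmas: the
   component of a composite transformation at M ⊙ N, and the compatibility of
   composite components with κ and with λ, ρ.

   Transformations and modifications being determined by their boundaries and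
   components, all laws of the hom double categories and all laws of the Gray
   structure are then checked componentwise. The component of the interchanger
   χ(x, y) at an object A is the component of y at the cell x A, so the axioms
   for χ are instances of the axioms of y, or of the definition of composites. *)

From mathcomp Require Import ssreflect ssrfun ssrbool.
From mathcomp Require Import boolp.
Require Import Defs.

Set Implicit Arguments.
Unset Strict Implicit.
Unset Printing Implicit Defensive.

Local Open Scope dbl_scope.

(** * Boundaries *)

Section Total.
Variable D : dbl_data.
Implicit Types (f g h : arr D) (M N P Q : pro D) (x y z : sq D).

(** Every law to be proved is an equation between records. Cells with equal components still have
    boundary transformations and proof fields to be compared, and composability is an equation
    between strict functors that holds sometimes by computation and sometimes only propositionally.
    Hence the systematic treatment of boundaries, and total operations that are unfolded only where
    a composability proof is at hand.

    Preunitarity shapes the arrow dimension from the start: a ⊙-composite of arrow disks has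
    boundary [U ⊙ U], and [U ⊙ U = U] makes the formulas for [varr] on composites arrow disks again.

    Interchangers exist because a transformation sends each cell of its domain to a cell of the
    middle double category, where the second transformation can be evaluated. The two modification
    axioms of χ(x, y) come from the naturality of [y] at the two kinds of square supplied by [x]:
    [varr] and [vpro] for vertical [x], [harr] and [hpro] for horizontal [x]. What remains is to
    expand [y] on the composite boundaries of these squares and to match units and bracketing with
    the form of the axioms. *)

Lemma acompE f g (e : tgt f = src g) : f ·0 g = @ccomp _ _ (D0 (str D)) f g e.
Proof. by rewrite /acomp; case: pselect => // e'; rewrite (Prop_irrelevance e' e). Qed.

Lemma vcompE x y (e : bot x = top y) : x · y = @ccomp _ _ (D1 (str D)) x y e.
Proof. by rewrite /vcomp; case: pselect => // e'; rewrite (Prop_irrelevance e' e). Qed.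

Lemma hcompE M N (e : rob M = lob N) : M ⊙0 N = @Dhcp _ _ _ _ (str D) M N e.
Proof. by rewrite /hcomp; case: pselect => // e'; rewrite (Prop_irrelevance e' e). Qed.

Lemma hcompsE x y (e : rarr x = larr y) : x ⊙ y = @Dhcs _ _ _ _ (str D) x y e.
Proof. by rewrite /hcomps; case: pselect => // e'; rewrite (Prop_irrelevance e' e). Qed.

Lemma kapE M N P (e : rob M = lob N) (e' : rob N = lob P) :
  kap M N P = @Dkap _ _ _ _ (str D) M N P e e'.
Proof.
rewrite /kap; case: pselect => // e1; case: pselect => // e2.
by rewrite (Prop_irrelevance e1 e) (Prop_irrelevance e2 e').
Qed.

Lemma kapVE M N P (e : rob M = lob N) (e' : rob N = lob P) :
  kapV M N P = @DkapV _ _ _ _ (str D) M N P e e'.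
Proof.
rewrite /kapV; case: pselect => // e1; case: pselect => // e2.
by rewrite (Prop_irrelevance e1 e) (Prop_irrelevance e2 e').
Qed.

End Total.

Section Boundaries.
Variable D : dblcat.
Implicit Types (A B : ob D) (f g h : arr D) (M N P Q : pro D) (x y z : sq D).

Lemma src_acomp f g : src (f ·0 g) = src f.
Proof. by rewrite /acomp; case: pselect => // e; exact: cdom_comp. Qed.
Lemma tgt_acomp f g : tgt f = src g -> tgt (f ·0 g) = tgt g.
Proof. by move=> e; rewrite (acompE e); exact: ccod_comp. Qed.
Lemma src_ida A : src (ida A) = A. Proof. exact: cdom_id. Qed.
Lemma tgt_ida A : tgt (ida A) = A. Proof. exact: ccod_id. Qed.
Lemma ida_acomp A f : A = src f -> ida A ·0 f = f.
Proof.
move=> ->; have e : tgt (ida (src f)) = src f by rewrite tgt_ida.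
by rewrite (acompE e); exact: ccomp_idl.
Qed.

Lemma acomp_ida A f : tgt f = A -> f ·0 ida A = f.
Proof.
move=> <-; have e : tgt f = src (ida (tgt f)) by rewrite src_ida.
by rewrite (acompE e); exact: ccomp_idr.
Qed.

Lemma acompA f g h : tgt f = src g -> tgt g = src h ->
  (f ·0 g) ·0 h = f ·0 (g ·0 h).
Proof.
move=> e1 e2.
have e3 : tgt (f ·0 g) = src h by rewrite tgt_acomp.
have e4 : tgt f = src (g ·0 h) by rewrite src_acomp.
rewrite (acompE e3) (acompE e4).
move: (e3) (e4); rewrite (acompE e1) (acompE e2) => e5 e6; exact: ccompA.
Qed.

Lemma top_vcomp x y : top (x · y) = top x.
Proof. by rewrite /vcomp; case: pselect => // e; exact: cdom_comp. Qed.
Lemma bot_vcomp x y : bot x = top y -> bot (x · y) = bot y.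
Proof. by move=> e; rewrite (vcompE e); exact: ccod_comp. Qed.
Lemma top_ids M : top (ids M) = M. Proof. exact: cdom_id. Qed.
Lemma bot_ids M : bot (ids M) = M. Proof. exact: ccod_id. Qed.
Lemma ids_vcomp M x : M = top x -> ids M · x = x.
Proof.
move=> ->; have e : bot (ids (top x)) = top x by rewrite bot_ids.
by rewrite (vcompE e); exact: ccomp_idl.
Qed.

Lemma vcomp_ids M x : bot x = M -> x · ids M = x.
Proof.
move=> <-; have e : bot x = top (ids (bot x)) by rewrite top_ids.
by rewrite (vcompE e); exact: ccomp_idr.
Qed.

Lemma vcompA x y z : bot x = top y -> bot y = top z ->
  (x · y) · z = x · (y · z).
Proof.
move=> e1 e2.
have e3 : bot (x · y) = top z by rewrite bot_vcomp.
have e4 : bot x = top (y · z) by rewrite top_vcomp.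
rewrite (vcompE e3) (vcompE e4).
move: (e3) (e4); rewrite (vcompE e1) (vcompE e2) => e5 e6; exact: ccompA.
Qed.

Lemma src_larr x : src (larr x) = lob (top x). Proof. exact: fdom. Qed.
Lemma tgt_larr x : tgt (larr x) = lob (bot x). Proof. exact: fcod. Qed.
Lemma src_rarr x : src (rarr x) = rob (top x). Proof. exact: fdom. Qed.
Lemma tgt_rarr x : tgt (rarr x) = rob (bot x). Proof. exact: fcod. Qed.
Lemma larr_vcomp x y : bot x = top y -> larr (x · y) = larr x ·0 larr y.
Proof.
move=> e; have e' : tgt (larr x) = src (larr y) by rewrite tgt_larr src_larr e.
by rewrite (vcompE e) (acompE e'); exact: fcomp.
Qed.

Lemma rarr_vcomp x y : bot x = top y -> rarr (x · y) = rarr x ·0 rarr y.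
Proof.
move=> e; have e' : tgt (rarr x) = src (rarr y) by rewrite tgt_rarr src_rarr e.
by rewrite (vcompE e) (acompE e'); exact: fcomp.
Qed.

Lemma larr_ids M : larr (ids M) = ida (lob M). Proof. exact: fid. Qed.
Lemma rarr_ids M : rarr (ids M) = ida (rob M). Proof. exact: fid. Qed.

Lemma top_Ua f : top (Ua f) = Uo (src f). Proof. exact: fdom. Qed.
Lemma bot_Ua f : bot (Ua f) = Uo (tgt f). Proof. exact: fcod. Qed.
Lemma Ua_ida A : Ua (ida A) = ids (Uo A). Proof. exact: fid. Qed.
Lemma Ua_acomp f g : tgt f = src g -> Ua (f ·0 g) = Ua f · Ua g.
Proof.
move=> e; have e' : bot (Ua f) = top (Ua g) by rewrite bot_Ua top_Ua e.
by rewrite (vcompE e') (acompE e); exact: fcomp.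
Qed.

Lemma lobUo A : lob (Uo A) = A. Proof. exact: lob_Uo (dblcatP D) A. Qed.
Lemma robUo A : rob (Uo A) = A. Proof. exact: rob_Uo (dblcatP D) A. Qed.
Lemma larrUa f : larr (Ua f) = f. Proof. exact: larr_Ua (dblcatP D) f. Qed.
Lemma rarrUa f : rarr (Ua f) = f. Proof. exact: rarr_Ua (dblcatP D) f. Qed.

Lemma lobh M N : lob (M ⊙0 N) = lob M.
Proof.
case: (pselect (rob M = lob N)) => [/(lob_hcomp (dblcatP D))//|e].
by rewrite /hcomp; case: pselect.
Qed.

Lemma robh M N : rob M = lob N -> rob (M ⊙0 N) = rob N.
Proof. exact: rob_hcomp (dblcatP D) M N. Qed.
Lemma larrh x y : larr (x ⊙ y) = larr x.
Proof.
case: (pselect (rarr x = larr y)) => [/(larr_hcomps (dblcatP D))//|e].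
by rewrite /hcomps; case: pselect.
Qed.

Lemma rarrh x y : rarr x = larr y -> rarr (x ⊙ y) = rarr y.
Proof. exact: rarr_hcomps (dblcatP D) x y. Qed.
Lemma toph x y : rarr x = larr y -> top (x ⊙ y) = top x ⊙0 top y.
Proof. exact: top_hcomps (dblcatP D) x y. Qed.
Lemma both x y : rarr x = larr y -> bot (x ⊙ y) = bot x ⊙0 bot y.
Proof. exact: bot_hcomps (dblcatP D) x y. Qed.
Lemma ids_hcomps M N : rob M = lob N -> ids M ⊙ ids N = ids (M ⊙0 N).
Proof. exact: hcomps_ids (dblcatP D) M N. Qed.
Lemma exchange x x' y y' :
  rarr x = larr y -> rarr x' = larr y' -> bot x = top x' -> bot y = top y' ->
  (x · x') ⊙ (y · y') = (x ⊙ y) · (x' ⊙ y').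
Proof. exact: (interchange (dblcatP D)). Qed.

Definition lamS M := lam_sq (dblcatP D) M.
Lemma larr_lam M : larr (lam M) = ida (lob M).
Proof. by case: (lamS M) => ->; rewrite lobh lobUo. Qed.
Lemma rarr_lam M : rarr (lam M) = ida (rob M).
Proof. by case: (lamS M) => _ ->; rewrite robh ?robUo. Qed.
Lemma top_lam M : top (lam M) = Uo (lob M) ⊙0 M. Proof. by case: (lamS M). Qed.
Lemma bot_lam M : bot (lam M) = M. Proof. by case: (lamS M). Qed.
Definition lamVS M := lamV_sq (dblcatP D) M.
Lemma larr_lamV M : larr (lamV M) = ida (lob M). Proof. by case: (lamVS M). Qed.
Lemma rarr_lamV M : rarr (lamV M) = ida (rob M). Proof. by case: (lamVS M). Qed.
Lemma bot_lamV M : bot (lamV M) = Uo (lob M) ⊙0 M. Proof. by case: (lamVS M). Qed.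
Lemma top_lamV M : top (lamV M) = M. Proof. by case: (lamVS M). Qed.
Definition rhoS M := rho_sq (dblcatP D) M.
Lemma larr_rho M : larr (rho M) = ida (lob M). Proof. by case: (rhoS M) => ->; rewrite lobh. Qed.
Lemma rarr_rho M : rarr (rho M) = ida (rob M).
Proof. by case: (rhoS M) => _ ->; rewrite robh ?robUo ?lobUo. Qed.
Lemma top_rho M : top (rho M) = M ⊙0 Uo (rob M). Proof. by case: (rhoS M). Qed.
Lemma bot_rho M : bot (rho M) = M. Proof. by case: (rhoS M). Qed.
Definition rhoVS M := rhoV_sq (dblcatP D) M.
Lemma larr_rhoV M : larr (rhoV M) = ida (lob M). Proof. by case: (rhoVS M). Qed.
Lemma rarr_rhoV M : rarr (rhoV M) = ida (rob M). Proof. by case: (rhoVS M). Qed.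
Lemma bot_rhoV M : bot (rhoV M) = M ⊙0 Uo (rob M). Proof. by case: (rhoVS M). Qed.
Lemma top_rhoV M : top (rhoV M) = M. Proof. by case: (rhoVS M). Qed.

Section Kap.
Variables (M N P : pro D) (e : rob M = lob N) (e' : rob N = lob P).
Let kapS := kap_sq (dblcatP D) e e'.
Lemma larr_kap : larr (kap M N P) = ida (lob M).
Proof. by case: kapS => ->; rewrite !lobh. Qed.
Lemma rarr_kap : rarr (kap M N P) = ida (rob P).
Proof. by case: kapS => _ -> _ _; rewrite robh //; rewrite robh. Qed.
Lemma top_kap : top (kap M N P) = (M ⊙0 N) ⊙0 P. Proof. by case: kapS. Qed.
Lemma bot_kap : bot (kap M N P) = M ⊙0 (N ⊙0 P). Proof. by case: kapS. Qed.
Let kapVS := kapV_sq (dblcatP D) e e'.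
Lemma larr_kapV : larr (kapV M N P) = ida (lob M).
Proof. by case: kapVS => ->; rewrite !lobh. Qed.
Lemma rarr_kapV : rarr (kapV M N P) = ida (rob P).
Proof. by case: kapVS => _ ->; rewrite robh ?lobh //; rewrite robh. Qed.
Lemma bot_kapV : bot (kapV M N P) = (M ⊙0 N) ⊙0 P. Proof. by case: kapVS. Qed.
Lemma top_kapV : top (kapV M N P) = M ⊙0 (N ⊙0 P). Proof. by case: kapVS. Qed.
Lemma kapK' : kap M N P · kapV M N P = ids ((M ⊙0 N) ⊙0 P).
Proof. exact: kapK (dblcatP D) _ _ _ e e'. Qed.
Lemma kapVK' : kapV M N P · kap M N P = ids (M ⊙0 (N ⊙0 P)).
Proof. exact: kapVK (dblcatP D) _ _ _ e e'. Qed.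
End Kap.

Lemma Uo_hcomp A B : A = B -> Uo A ⊙0 Uo B = Uo A.
Proof. by move=> <-; exact: preunit_hcomp (dblcatP D) A. Qed.
Lemma lamU A : lam (Uo A) = ids (Uo A). Proof. exact: preunit_lam (dblcatP D) A. Qed.
Lemma rhoU A : rho (Uo A) = ids (Uo A). Proof. exact: preunit_rho (dblcatP D) A. Qed.

End Boundaries.

Definition bdE := (src_acomp, src_ida, tgt_ida, top_vcomp, top_ids, bot_ids,
  src_larr, tgt_larr, src_rarr, tgt_rarr, larr_ids, rarr_ids, top_Ua, bot_Ua,
  lobUo, robUo, larrUa, rarrUa, lobh, larrh,
  (larr_lam, rarr_lam, top_lam, bot_lam, larr_lamV, rarr_lamV, top_lamV, bot_lamV,
  larr_rho, rarr_rho, top_rho, bot_rho, larr_rhoV, rarr_rhoV, top_rhoV, bot_rhoV)).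

(* [bd] proves an equation between boundaries by rewriting it to a normal form,
   proving the composability conditions of these rewritings recursively. The
   three auxiliary tactics are redefined whenever new cells are introduced. *)
Ltac bd_rw := rewrite ?bdE.
Ltac bd_hook := fail.
Ltac bd_close := try reflexivity; try congruence.

Ltac bd :=
  bd_rw;
  repeat (match goal with
   | H : larr ?x = _ |- context[larr ?x] => is_var x; rewrite H
   | H : rarr ?x = _ |- context[rarr ?x] => is_var x; rewrite H
   | H : top ?x = _ |- context[top ?x] => is_var x; rewrite H
   | H : bot ?x = _ |- context[bot ?x] => is_var x; rewrite H
   | |- context[tgt (?f ·0 ?g)] => rewrite (@tgt_acomp _ f g); [|solve[bd]]
   | |- context[rob (?f ⊙0 ?g)] => rewrite (@robh _ f g); [|solve[bd]]
   | |- context[rarr (?f ⊙ ?g)] => rewrite (@rarrh _ f g); [|solve[bd]]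
   | |- context[top (?f ⊙ ?g)] => rewrite (@toph _ f g); [|solve[bd]]
   | |- context[bot (?f ⊙ ?g)] => rewrite (@both _ f g); [|solve[bd]]
   | |- context[bot (?f · ?g)] => rewrite (@bot_vcomp _ f g); [|solve[bd]]
   | |- context[larr (?f · ?g)] => rewrite (@larr_vcomp _ f g); [|solve[bd]]
   | |- context[rarr (?f · ?g)] => rewrite (@rarr_vcomp _ f g); [|solve[bd]]
   | |- context[larr (kap ?M ?N ?P)] => rewrite (@larr_kap _ M N P); [|solve[bd]|solve[bd]]
   | |- context[rarr (kap ?M ?N ?P)] => rewrite (@rarr_kap _ M N P); [|solve[bd]|solve[bd]]
   | |- context[top (kap ?M ?N ?P)] => rewrite (@top_kap _ M N P); [|solve[bd]|solve[bd]]
   | |- context[bot (kap ?M ?N ?P)] => rewrite (@bot_kap _ M N P); [|solve[bd]|solve[bd]]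
   | |- context[larr (kapV ?M ?N ?P)] => rewrite (@larr_kapV _ M N P); [|solve[bd]|solve[bd]]
   | |- context[rarr (kapV ?M ?N ?P)] => rewrite (@rarr_kapV _ M N P); [|solve[bd]|solve[bd]]
   | |- context[top (kapV ?M ?N ?P)] => rewrite (@top_kapV _ M N P); [|solve[bd]|solve[bd]]
   | |- context[bot (kapV ?M ?N ?P)] => rewrite (@bot_kapV _ M N P); [|solve[bd]|solve[bd]]
   | |- context[(?f ·0 ?g) ·0 ?h] => rewrite (@acompA _ f g h); [|solve[bd]|solve[bd]]
   | |- context[@acomp (dbl_of ?D) (ida ?A) ?f] => rewrite (@ida_acomp D A f); [|solve[bd]]
   | |- context[@acomp (dbl_of ?D) ?f (ida ?A)] => rewrite (@acomp_ida D A f); [|solve[bd]]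
   | |- context[@hcomp (dbl_of ?D) (Uo ?A) (Uo ?B)] => rewrite (@Uo_hcomp D A B); [|solve[bd]]
   | _ => bd_hook
   end; bd_rw);
  bd_close.

(* Associate vertical composites to the right ([ra]) or left ([la]), and remove
   identity squares ([rids]). *)
Ltac ra := repeat (rewrite vcompA; [|solve[bd]|solve[bd]]).
Ltac la := repeat (rewrite -vcompA; [|solve[bd]|solve[bd]]).
Ltac rids := repeat (first [rewrite ids_vcomp; [|solve[bd]] | rewrite vcomp_ids; [|solve[bd]]
   | rewrite ids_hcomps; [|solve[bd]]]).

(** * Unitors, associators and Kelly's unit lemmas *)

Section Coherence.
Variable D : dblcat.
Implicit Types (A B : ob D) (f g h : arr D) (M N P Q : pro D) (x y z : sq D).

Lemma vpre a b c (k : sq D) : a · b = c -> bot a = top b -> bot b = top k ->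
  a · (b · k) = c · k.
Proof. by move=> <- e1 e2; rewrite vcompA. Qed.

Lemma vcancel_l a b x y : b · a = ids (top x) -> bot b = top a -> bot a = top x ->
  top x = top y -> a · x = a · y -> x = y.
Proof.
move=> e e1 e2 e3 E; rewrite -(ids_vcomp (erefl (top x))) -e vcompA // E.
by rewrite -vcompA -?e3 // e e3 ids_vcomp.
Qed.

Lemma vcancel_r a b x y : a · b = ids (bot x) -> bot a = top b -> bot x = top a ->
  bot x = bot y -> x · a = y · a -> x = y.
Proof.
move=> e e1 e2 e3 E; rewrite -(vcomp_ids (erefl (bot x))) -e -vcompA // E.
by rewrite vcompA -?e3 // e e3 vcomp_ids.
Qed.

Lemma lamK' M : lam M · lamV M = ids (Uo (lob M) ⊙0 M).
Proof. exact: lamK (dblcatP D) M. Qed.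
Lemma lamVK' M : lamV M · lam M = ids M.
Proof. exact: lamVK (dblcatP D) M. Qed.
Lemma rhoK' M : rho M · rhoV M = ids (M ⊙0 Uo (rob M)).
Proof. exact: rhoK (dblcatP D) M. Qed.
Lemma rhoVK' M : rhoV M · rho M = ids M.
Proof. exact: rhoVK (dblcatP D) M. Qed.
Lemma lamN x : (Ua (larr x) ⊙ x) · lam (bot x) = lam (top x) · x.
Proof. exact: lam_nat (dblcatP D) x. Qed.
Lemma rhoN x : (x ⊙ Ua (rarr x)) · rho (bot x) = rho (top x) · x.
Proof. exact: rho_nat (dblcatP D) x. Qed.
Lemma kapN x y z : rarr x = larr y -> rarr y = larr z ->
  ((x ⊙ y) ⊙ z) · kap (bot x) (bot y) (bot z) =
  kap (top x) (top y) (top z) · (x ⊙ (y ⊙ z)).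
Proof. exact: (kap_nat (dblcatP D)). Qed.
Lemma triangle_kap M N : rob M = lob N ->
    kap M (Uo (rob M)) N · (ids M ⊙ lam N) = rho M ⊙ ids N.
Proof. exact: (triangle (dblcatP D)). Qed.

(** Naturality of [lam] conjugates [ids (Uo A) ⊙ x] into [x], so tensoring with a unit loses no
    information. This is the cancellation that extracts Kelly's lemma for λ from the pentagon. *)
Lemma Uo_faithful A x y : larr x = ida A -> larr y = ida A -> top x = top y ->
  bot x = bot y -> ids (Uo A) ⊙ x = ids (Uo A) ⊙ y -> x = y.
Proof.
move=> hx hy ht hb E.
have e : lob (top x) = A by rewrite -src_larr hx src_ida.
apply: (vcancel_l (a := lam (top x)) (b := lamV (top x))); first exact: lamVK'.
- bd. - bd. - bd.
by rewrite -lamN hx Ua_ida E -Ua_ida -hy hb lamN ht.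
Qed.

Lemma faithful_Uo A x y : rarr x = ida A -> rarr y = ida A -> top x = top y ->
  bot x = bot y -> x ⊙ ids (Uo A) = y ⊙ ids (Uo A) -> x = y.
Proof.
move=> hx hy ht hb E.
have e : rob (top x) = A by rewrite -src_rarr hx src_ida.
apply: (vcancel_l (a := rho (top x)) (b := rhoV (top x))); first exact: rhoVK'.
- bd. - bd. - bd.
by rewrite -rhoN hx Ua_ida E -Ua_ida -hy hb rhoN ht.
Qed.

Lemma ids_hcomps_vcomp P x y : larr x = ida (rob P) -> larr y = ida (rob P) -> bot x = top y ->
  ids P ⊙ (x · y) = (ids P ⊙ x) · (ids P ⊙ y).
Proof. by move=> h1 h2 h3; rewrite -exchange; [rewrite ids_vcomp; bd|bd..]. Qed.

Lemma vcomp_hcomps_ids P x y : rarr x = ida (lob P) -> rarr y = ida (lob P) -> bot x = top y ->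
  (x · y) ⊙ ids P = (x ⊙ ids P) · (y ⊙ ids P).
Proof. by move=> h1 h2 h3; rewrite -exchange; [rewrite ids_vcomp; bd|bd..]. Qed.

(** Kelly's lemma for λ. By faithfulness of [U ⊙ -] the two sides may be compared after tensoring
    with [U], where the pentagon for [U, U, M, N] relates them and the triangle removes the
    unitors. *)
Lemma kap_lam_hcomp M N : rob M = lob N ->
  kap (Uo (lob M)) M N · lam (M ⊙0 N) = lam M ⊙ ids N.
Proof.
move=> e; set U := Uo (lob M).
apply: (@Uo_faithful (lob M)); [bd|bd|bd|bd|].
have e1 : rob U = lob U by bd.
have e2 : rob U = lob M by bd.
have e3 : rob U = lob (M ⊙0 N) by bd.
have T1 := triangle_kap e3; have T2 := triangle_kap e2.
have P := pentagon (dblcatP D) e1 e2 e.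
have UU : U ⊙0 U = U by rewrite /U; bd.
have rU : rob U = lob M by bd.
(* Preunitarity collapses [U ⊙0 U] in the pentagon and turns the right-hand sides of both triangles
   into identities. *)
rewrite rU -/U UU rhoU in P T1 T2.
have H : kap U U M · (ids U ⊙ lam M) = ids (U ⊙0 M) by rewrite T2; rids.
have H1 : (kap U U M ⊙ ids N) · (kap U (U ⊙0 M) N · (ids U ⊙ (lam M ⊙ ids N)))
  = kap U M N.
  have := @kapN (ids U) (lam M) (ids N); rewrite ?bdE -/U => <-; [|bd|bd].
  rewrite -vcompA; [|bd|bd].
  by rewrite -exchange; [rewrite H; rids|bd..].
(* After precomposition with this isomorphism both sides become [kap U M N]: one by [H1], the other
   by the pentagon followed by [T1]. *)
apply: (vcancel_l (a := kap U U M ⊙ ids N · kap U (U ⊙0 M) N)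
   (b := kapV U (U ⊙0 M) N · (kapV U U M ⊙ ids N))).
- ra. rewrite -(vcompA (x := kapV U U M ⊙ ids N)); [|bd|bd].
  rewrite -exchange; [|bd..]. rewrite kapVK'; [|bd..]. rids.
  by rewrite kapVK'; [|bd..]; congr ids; bd.
- bd. - bd. - bd.
ra; rewrite H1.
rewrite ids_hcomps_vcomp; [|bd..].
la; rewrite -P vcompA; [|bd..].
by rewrite T1; rids.
Qed.

Lemma kap_UU M : kap M (Uo (rob M)) (Uo (rob M)) = rho M ⊙ ids (Uo (rob M)).
Proof.
have e : rob M = lob (Uo (rob M)) by bd.
by rewrite -(triangle_kap e) lamU; rids.
Qed.

(** Kelly's lemma for ρ, from the pentagon for [M, N, U, U]: by [kap_UU] two of its edges are
    unitors, and since [U ⊙0 U = U] the edge [kap M N U] slides past [rho N] by naturality and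
    cancels. *)
Lemma kap_rho_hcomp M N : rob M = lob N ->
  kap M N (Uo (rob N)) · (ids M ⊙ rho N) = rho (M ⊙0 N).
Proof.
move=> e; set U := Uo (rob N).
apply: (@faithful_Uo (rob N)); [bd|bd|bd|bd|].
have e1 : rob N = lob U by bd.
have e2 : rob U = lob U by bd.
have P := pentagon (dblcatP D) e e1 e2.
have UU : U ⊙0 U = U by rewrite /U; bd.
have rMN : rob (M ⊙0 N) = rob N by bd.
have T1 := kap_UU (M ⊙0 N); have T2 := kap_UU N.
rewrite rMN -/U in T1; rewrite -/U in T2; rewrite UU T1 T2 in P.
apply: (vcancel_r (a := kap M N U) (b := kapV M N U)).
- by bd; rewrite kapK'; [bd|bd..].
- bd. - bd. - bd.
rewrite P vcomp_hcomps_ids; [|bd..].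
have E := @kapN (ids M) (rho N) (ids U); rewrite ?bdE -/U in E.
by ra; rewrite -E; [|bd..].
Qed.

(* Arrow disks act on squares from both sides; these actions absorb the weak
   unitality of ⊙: cong _ _ (x ⊙ d) (e ⊙ y) says exactly that x ◃ d = e ▹ y,
   and the laws relating ◃, ▹, · and ⊙ are strict. *)
Definition ract x d := rhoV (top x) · (x ⊙ d) · rho (bot x).
Definition lact d x := lamV (top x) · (d ⊙ x) · lam (bot x).

(** Only the proarrow boundaries are constrained: both side arrows then automatically run from [A]
    to [B]. The side arrows stay free, so one predicate covers all disks. *)
Definition isdisk d := exists A B, top d = Uo A /\ bot d = Uo B.

End Coherence.

Notation "x ◃ d" := (ract x d) (at level 40, left associativity) : dbl_scope.
Notation "d ▹ x" := (lact d x) (at level 40, left associativity) : dbl_scope.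

(** * The action of arrow disks *)

Section ActionBoundaries.
Variable D : dblcat.
Implicit Types (x y d e : sq D).

Lemma isdisk_Ua (f : arr D) : isdisk (Ua f).
Proof. by exists (src f), (tgt f); split; bd. Qed.
Lemma isdisk_h d e : isdisk d -> isdisk e -> rarr d = larr e -> isdisk (d ⊙ e).
Proof.
move=> [A [B [? ?]]] [A' [B' [? ?]]] e1.
have : lob (top d) = rob (top d) by bd.
have : rob (top d) = lob (top e) by rewrite -src_rarr -src_larr e1.
have : lob (bot d) = rob (bot d) by bd.
have : rob (bot d) = lob (bot e) by rewrite -tgt_rarr -tgt_larr e1.
by bd => ? ? ? ?; exists A, B; split; bd.
Qed.

Lemma isdisk_v d e : isdisk d -> isdisk e -> bot d = top e -> isdisk (d · e).
Proof. by move=> [A [B [? ?]]] [A' [B' [? ?]]] e1; exists A, B'; split; bd. Qed.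

Lemma rarr_larr_ob x y : rarr x = larr y ->
  rob (top x) = lob (top y) /\ rob (bot x) = lob (bot y).
Proof. by move=> e; rewrite -src_rarr -tgt_rarr e src_larr tgt_larr. Qed.

Section R.
Variables (x d : sq D) (H : isdisk d) (e : rarr x = larr d).
Lemma larr_ract : larr (x ◃ d) = larr x.
Proof. by case: H => A [B [? ?]]; have := rarr_larr_ob e; bd => -[? ?]; rewrite /ract; bd. Qed.
Lemma rarr_ract : rarr (x ◃ d) = rarr d.
Proof. by case: H => A [B [? ?]]; have := rarr_larr_ob e; bd => -[? ?]; rewrite /ract; bd. Qed.
Lemma top_ract : top (x ◃ d) = top x.
Proof. by case: H => A [B [? ?]]; have := rarr_larr_ob e; bd => -[? ?]; rewrite /ract; bd. Qed.
Lemma bot_ract : bot (x ◃ d) = bot x.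
Proof. by case: H => A [B [? ?]]; have := rarr_larr_ob e; bd => -[? ?]; rewrite /ract; bd. Qed.
End R.
Section L.
Variables (x d : sq D) (H : isdisk d) (e : rarr d = larr x).
Lemma larr_lact : larr (d ▹ x) = larr d.
Proof. by case: H => A [B [? ?]]; have := rarr_larr_ob e; bd => -[? ?]; rewrite /lact; bd. Qed.
Lemma rarr_lact : rarr (d ▹ x) = rarr x.
Proof. by case: H => A [B [? ?]]; have := rarr_larr_ob e; bd => -[? ?]; rewrite /lact; bd. Qed.
Lemma top_lact : top (d ▹ x) = top x.
Proof. by case: H => A [B [? ?]]; have := rarr_larr_ob e; bd => -[? ?]; rewrite /lact; bd. Qed.
Lemma bot_lact : bot (d ▹ x) = bot x.
Proof. by case: H => A [B [? ?]]; have := rarr_larr_ob e; bd => -[? ?]; rewrite /lact; bd. Qed.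
End L.
End ActionBoundaries.

Ltac dsk := solve [repeat first [assumption | apply: isdisk_Ua | apply: isdisk_h; [| |solve[bd]]
  | apply: isdisk_v; [| |solve[bd]]]].
Ltac bd_action := match goal with
   | |- context[larr (?x ◃ ?d)] => rewrite (@larr_ract _ x d); [|dsk|solve[bd]]
   | |- context[rarr (?x ◃ ?d)] => rewrite (@rarr_ract _ x d); [|dsk|solve[bd]]
   | |- context[top (?x ◃ ?d)] => rewrite (@top_ract _ x d); [|dsk|solve[bd]]
   | |- context[bot (?x ◃ ?d)] => rewrite (@bot_ract _ x d); [|dsk|solve[bd]]
   | |- context[larr (?d ▹ ?x)] => rewrite (@larr_lact _ x d); [|dsk|solve[bd]]
   | |- context[rarr (?d ▹ ?x)] => rewrite (@rarr_lact _ x d); [|dsk|solve[bd]]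
   | |- context[top (?d ▹ ?x)] => rewrite (@top_lact _ x d); [|dsk|solve[bd]]
   | |- context[bot (?d ▹ ?x)] => rewrite (@bot_lact _ x d); [|dsk|solve[bd]]
  end.
Ltac bd_hook ::= bd_action.

Lemma isdiskP (D : dblcat) (d : sq D) : isdisk d -> exists A B,
  [/\ top d = Uo A, bot d = Uo B,
    lob (top d) = A /\ rob (top d) = A & lob (bot d) = B /\ rob (bot d) = B].
Proof. by case=> [A [B [? ?]]]; exists A, B; do ?split; bd. Qed.

(* Records the coincidences of objects implied by disks and by composability. *)
Ltac obs := repeat match goal with
  | H : isdisk ?d |- _ => lazymatch goal with
     | _ : top d = Uo _ |- _ => fail
     | _ => let A := fresh "A" in let B := fresh "B" in
       have [A [B [? ? [? ?] [? ?]]]] := isdiskP H end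
  | H : rarr ?x = larr ?y |- _ => lazymatch goal with
     | _ : rob (top x) = lob (top y) |- _ => fail
     | _ => have [? ?] := rarr_larr_ob H end
  end.

Section Action.
Variable D : dblcat.
Implicit Types (A B : ob D) (f g h : arr D) (M N P Q : pro D) (x y z d e : sq D).

Lemma rhoVU A : rhoV (Uo A) = ids (Uo A).
Proof.
have := rhoVK' (Uo A); rewrite rhoU vcomp_ids //; bd. Qed.
Lemma lamVU A : lamV (Uo A) = ids (Uo A).
Proof. have := lamVK' (Uo A); rewrite lamU vcomp_ids //; bd. Qed.

Lemma ractE x d : x ◃ d = rhoV (top x) · (x ⊙ d) · rho (bot x).
Proof. by []. Qed.
Lemma lactE x d : d ▹ x = lamV (top x) · (d ⊙ x) · lam (bot x).
Proof. by []. Qed.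

Section One.
Variables (x d : sq D) (H : isdisk d).

Lemma rho_ract : rarr x = larr d -> rho (top x) · (x ◃ d) = (x ⊙ d) · rho (bot x).
Proof. by move=> e; obs; rewrite /ract; la; rewrite rhoK'; rids; bd. Qed.

Lemma lam_lact : rarr d = larr x -> lam (top x) · (d ▹ x) = (d ⊙ x) · lam (bot x).
Proof. by move=> e; obs; rewrite /lact; la; rewrite lamK'; rids; bd. Qed.

(** As the unitor is invertible, this equation characterises [x ◃ d]; most laws of the actions are
    checked through it, without handling [rhoV]. *)
Lemma ractP z : rarr x = larr d -> top z = top x -> bot z = bot x ->
  rho (top x) · z = (x ⊙ d) · rho (bot x) -> z = x ◃ d.
Proof.
move=> e e1 e2; rewrite -rho_ract //; obs.
by apply: (vcancel_l (b := rhoV (top x))); [rewrite rhoVK' e1|bd..].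
Qed.

Lemma lactP z : rarr d = larr x -> top z = top x -> bot z = bot x ->
  lam (top x) · z = (d ⊙ x) · lam (bot x) -> z = d ▹ x.
Proof.
move=> e e1 e2; rewrite -lam_lact //; obs.
by apply: (vcancel_l (b := lamV (top x))); [rewrite lamVK' e1|bd..].
Qed.

End One.

Lemma ractU x f : rarr x = f -> x ◃ Ua f = x.
Proof. by move=> <-; apply/esym/ractP; [dsk|bd|bd|bd|rewrite rhoN]. Qed.

Lemma lactU x f : larr x = f -> Ua f ▹ x = x.
Proof. by move=> <-; apply/esym/lactP; [dsk|bd|bd|bd|rewrite lamN]. Qed.

(** By preunitarity the unitors at the boundary of a disk are identities. *)
Lemma ract_disk d e : isdisk d -> isdisk e -> rarr d = larr e -> d ◃ e = d ⊙ e.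
Proof.
move=> Hd He h; obs; apply/esym/ractP => //; bd; rewrite !rhoU; rids; bd.
Qed.

Lemma lact_disk d e : isdisk d -> isdisk e -> rarr d = larr e -> d ▹ e = d ⊙ e.
Proof.
move=> Hd He h; obs; apply/esym/lactP => //; bd; rewrite !lamU; rids; bd.
Qed.

Lemma ract_vcomp x y d e : isdisk d -> isdisk e -> rarr x = larr d ->
  rarr y = larr e -> bot x = top y -> bot d = top e ->
  (x ◃ d) · (y ◃ e) = (x · y) ◃ (d · e).
Proof.
move=> Hd He h1 h2 h3 h4; obs; apply/ractP; [dsk|bd|bd|bd|].
bd; rewrite exchange // -vcompA; [|bd..].
rewrite rho_ract // vcompA; [|bd..]. rewrite h3 rho_ract //. la.
done.
Qed.

Lemma lact_vcomp x y d e : isdisk d -> isdisk e -> rarr d = larr x ->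
  rarr e = larr y -> bot x = top y -> bot d = top e ->
  (d ▹ x) · (e ▹ y) = (d · e) ▹ (x · y).
Proof.
move=> Hd He h1 h2 h3 h4; obs; apply/lactP; [dsk|bd|bd|bd|].
bd; rewrite exchange // -vcompA; [|bd..].
rewrite lam_lact // vcompA; [|bd..]. rewrite h3 lam_lact //. la.
done.
Qed.

(** The actions are balanced over ⊙. The triangle rewrites [rho ⊙ ids] on either boundary as κ
    followed by [ids ⊙ lam], and naturality of κ at [x, d, y] carries the disk from one factor to
    the other. *)
Lemma ract_lact x d y : isdisk d -> rarr x = larr d -> rarr d = larr y ->
  (x ◃ d) ⊙ y = x ⊙ (d ▹ y).
Proof.
move=> Hd e1 e2; obs.
have E1 : rob (top x) = lob (top y) by congruence.
have E2 : rob (bot x) = lob (bot y) by congruence.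
apply: (vcancel_l (a := rho (top x) ⊙ ids (top y)) (b := rhoV (top x) ⊙ ids (top y))); [|bd..|].
  rewrite -exchange; [|bd..]. by rewrite rhoVK'; rids; bd.
rewrite -exchange; [|bd..]. rewrite ids_vcomp // rho_ract //.
rewrite -[y in LHS](vcomp_ids (erefl (bot y))) exchange; [|bd..].
have T1 := triangle_kap E1; have T2 := triangle_kap E2.
move: T1 T2; have -> : rob (top x) = A by congruence.
have -> : rob (bot x) = B by congruence.
move=> <- <-; la.
have K := kapN e1 e2; have [-> ->] : Uo A = top d /\ Uo B = bot d by split; congruence.
rewrite K; ra; congr (_ · _); rewrite -!exchange; [|bd..].
by rewrite ids_vcomp // vcomp_ids // lam_lact.
Qed.

(** Kelly's lemma for ρ splits the unitor of a composite proarrow, after which naturality of κ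
    suffices. *)
Lemma ract_hcomp x y d : isdisk d -> rarr x = larr y -> rarr y = larr d ->
  (x ⊙ y) ◃ d = x ⊙ (y ◃ d).
Proof.
move=> Hd e1 e2; obs; apply/esym/ractP; [dsk|bd|bd|bd|].
bd; rewrite -!kap_rho_hcomp; [|bd..].
have K := kapN e1 e2.
have [E1 E2] : Uo (rob (top y)) = top d /\ Uo (rob (bot y)) = bot d by split; congruence.
rewrite E1 E2; la; rewrite K; ra; congr (_ · _); rewrite -!exchange; [|bd..].
by rewrite rho_ract // ids_vcomp // vcomp_ids.
Qed.

Lemma lact_hcomp x y d : isdisk d -> rarr d = larr x -> rarr x = larr y ->
  d ▹ (x ⊙ y) = (d ▹ x) ⊙ y.
Proof.
move=> Hd e1 e2; obs; apply/esym/lactP; [dsk|bd|bd|bd|].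
have K := kapN e1 e2.
have [E1 E2] : Uo (lob (top x)) = top d /\ Uo (lob (bot x)) = bot d by split; congruence.
apply: (vcancel_l (a := kap (top d) (top x) (top y)) (b := kapV (top d) (top x) (top y))).
- by rewrite kapVK'; bd.
- bd. - bd. - bd.
rewrite toph // both //; la; rewrite -K (vcompA (x := (d ⊙ x) ⊙ y)); [|bd..].
rewrite -E1 -E2 !kap_lam_hcomp; [|bd..]. rewrite -!exchange; [|bd..].
by rewrite lam_lact // ids_vcomp // vcomp_ids.
Qed.

(** Associativity comes from balancedness: in the unfolded action, [(x ◃ d) ⊙ e] is [x ⊙ (d ▹ e)],
    and on disks [▹] is ⊙. *)
Lemma ractA x d e : isdisk d -> isdisk e -> rarr x = larr d -> rarr d = larr e ->
  (x ◃ d) ◃ e = x ◃ (d ⊙ e).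
Proof.
move=> Hd He e1 e2; obs; rewrite [LHS]ractE [RHS]ractE ract_lact // lact_disk //.
by congr (_ · _ · _); bd.
Qed.

Lemma lactA x d e : isdisk d -> isdisk e -> rarr d = larr e -> rarr e = larr x ->
  d ▹ (e ▹ x) = (d ⊙ e) ▹ x.
Proof.
move=> Hd He e1 e2; obs; rewrite [LHS]lactE [RHS]lactE -ract_lact // ract_disk //.
by congr (_ · _ · _); bd.
Qed.

Lemma lact_ract x d e : isdisk d -> isdisk e -> rarr d = larr x -> rarr x = larr e ->
  (d ▹ x) ◃ e = d ▹ (x ◃ e).
Proof.
move=> Hd He e1 e2; obs.
have [E1 E2] : rob (top x) = lob (top e) /\ rob (bot x) = lob (bot e) by split; congruence.
rewrite [LHS]ractE [in RHS]ractE -lact_hcomp //; bd.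
(* The remaining unitors have identity sides, so they are fixed by the action of an identity disk
   and can be absorbed into the action of [d] by [lact_vcomp]. *)
rewrite -[rhoV (top x) in LHS](@lactU _ (ida (lob (top x)))); [|bd].
rewrite -[rho (bot x) in LHS](@lactU _ (ida (lob (bot x)))); [|bd].
rewrite !lact_vcomp; try dsk; try bd.
by rewrite !Ua_ida; rids.
Qed.
End Action.

Section Stack.
Variable D : dblcat.

Lemma disk_top (d : sq D) f : isdisk d -> larr d = f -> top d = Uo (src f).
Proof. by case=> [A [B [? ?]]] <-; bd. Qed.
Lemma disk_bot (d : sq D) f : isdisk d -> larr d = f -> bot d = Uo (tgt f).
Proof. by case=> [A [B [? ?]]] <-; bd. Qed.

(* Pasting along an arrow: both the naturality of a composite of arrow-dimension
   transformations and the first axiom of a vertical composite of modifications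
   are instances. *)
Lemma ract_stack (p a b q a' b' r d d' e e' : sq D) :
  isdisk d -> isdisk d' -> isdisk e -> isdisk e' ->
  [/\ bot p = top a, bot a' = top q, bot a = bot q & top a' = top p] ->
  [/\ bot q = top b, bot b' = top r, bot b = bot r & top b' = top q] ->
  [/\ larr d = rarr p ·0 rarr a, rarr d = rarr a' ·0 rarr q,
      larr d' = larr p ·0 larr a & rarr d' = larr a' ·0 larr q] ->
  [/\ larr e = rarr q ·0 rarr b, rarr e = rarr b' ·0 rarr r,
      larr e' = larr q ·0 larr b & rarr e' = larr b' ·0 larr r] ->
  (p · a) ◃ d = d' ▹ (a' · q) -> (q · b) ◃ e = e' ▹ (b' · r) ->
  (p · (a · b)) ◃ ((d · Ua (rarr b)) ⊙ (Ua (rarr a') · e)) =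
  ((d' · Ua (larr b)) ⊙ (Ua (larr a') · e')) ▹ ((a' · b') · r).
Proof.
move=> Hd Hd' He He' [? ? ? ?] [? ? ? ?] [? ? ? ?] [? ? ? ?] E1 E2.
have ? : bot a = top b by congruence.
have ? : bot a' = top b' by congruence.
have ? : bot d = Uo (rob (bot a)) by rewrite (@disk_bot d (rarr p ·0 rarr a)) //; bd.
have ? : bot d' = Uo (lob (bot a)) by rewrite (@disk_bot d' (larr p ·0 larr a)) //; bd.
have ? : top e = Uo (rob (bot a')) by rewrite (@disk_top e (rarr q ·0 rarr b)) //; bd.
have ? : top e' = Uo (lob (bot a')) by rewrite (@disk_top e' (larr q ·0 larr b)) //; bd.
have Rd : rarr (p · a) = larr d by bd.
have Ld : rarr d' = larr (a' · q) by bd.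

rewrite -ractA; [|dsk|dsk|bd|bd].
rewrite -vcompA; [|bd..].
rewrite -ract_vcomp; [|dsk|dsk|bd|bd|bd|bd].
rewrite E1 ractU //.
(* Letting a unit disk act on [b] brings the whole composite under one left action; [lact_ract] then
   sets that action aside while the second equation is used on [q · b]. *)
rewrite -{1}[b](@lactU _ b _ (erefl _)) lact_vcomp; [|dsk|dsk|bd|bd|bd|bd].
rewrite lact_ract; [|dsk|dsk|bd|bd].
rewrite vcompA //.
rewrite -(ract_vcomp (x:=a') (y := q · b)); [|dsk|dsk|bd|bd|bd|bd].
rewrite E2 ractU //.
rewrite -{1}[a'](@lactU _ a' _ (erefl _)) lact_vcomp; [|dsk|dsk|bd|bd|bd|bd].
rewrite lactA; [|dsk|dsk|bd|bd].
rewrite vcompA //; bd.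
Qed.
End Stack.

(** * Boundaries of functors, transformations and modifications *)

Section FunctorBoundaries.
Variables (C D : dblcat) (F : sfun C D).
Implicit Types (f : arr C) (M : pro C) (x : sq C).
Lemma src_sfa f : src (sfa F f) = sfo F (src f). Proof. exact: fdom. Qed.
Lemma tgt_sfa f : tgt (sfa F f) = sfo F (tgt f). Proof. exact: fcod. Qed.
Lemma lob_sfp M : lob (sfp F M) = sfo F (lob M). Proof. exact: sf_lob. Qed.
Lemma rob_sfp M : rob (sfp F M) = sfo F (rob M). Proof. exact: sf_rob. Qed.
Lemma larr_sfs x : larr (sfs F x) = sfa F (larr x). Proof. exact: sf_larr. Qed.
Lemma rarr_sfs x : rarr (sfs F x) = sfa F (rarr x). Proof. exact: sf_rarr. Qed.
Lemma top_sfs x : top (sfs F x) = sfp F (top x). Proof. exact: fdom. Qed.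
Lemma bot_sfs x : bot (sfs F x) = sfp F (bot x). Proof. exact: fcod. Qed.
Lemma sfa_ida A : sfa F (ida A) = ida (sfo F A). Proof. exact: fid. Qed.
Lemma sfs_ids M : sfs F (ids M) = ids (sfp F M). Proof. exact: fid. Qed.
Lemma sfp_Uo A : sfp F (Uo A) = Uo (sfo F A). Proof. exact: sf_Uo. Qed.
Lemma sfs_Ua f : sfs F (Ua f) = Ua (sfa F f). Proof. exact: sf_Ua. Qed.
Lemma sfa_acomp f g : tgt f = src g -> sfa F (f ·0 g) = sfa F f ·0 sfa F g.
Proof.
move=> e; have e' : tgt (sfa F f) = src (sfa F g) by rewrite tgt_sfa src_sfa e.
by rewrite (acompE e) (acompE e'); exact: fcomp.
Qed.

Lemma sfs_vcomp x y : bot x = top y -> sfs F (x · y) = sfs F x · sfs F y.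
Proof.
move=> e; have e' : bot (sfs F x) = top (sfs F y) by rewrite bot_sfs top_sfs e.
by rewrite (vcompE e) (vcompE e'); exact: fcomp.
Qed.

Lemma sfp_hcomp M N : rob M = lob N -> sfp F (M ⊙0 N) = sfp F M ⊙0 sfp F N.
Proof. exact: sf_hcomp. Qed.
Lemma sfs_hcomps x y : rarr x = larr y -> sfs F (x ⊙ y) = sfs F x ⊙ sfs F y.
Proof. exact: sf_hcomps. Qed.
Lemma sfs_lam M : sfs F (lam M) = lam (sfp F M). Proof. exact: sf_lam. Qed.
Lemma sfs_rho M : sfs F (rho M) = rho (sfp F M). Proof. exact: sf_rho. Qed.
Lemma sfs_kap M N P : rob M = lob N -> rob N = lob P ->
  sfs F (kap M N P) = kap (sfp F M) (sfp F N) (sfp F P).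
Proof. exact: sf_kap. Qed.
End FunctorBoundaries.

Lemma sfo_comp (C D E : dblcat) (F : sfun C D) (G : sfun D E) A :
  sfo (sfun_comp F G) A = sfo G (sfo F A). Proof. by []. Qed.
Lemma sfa_comp (C D E : dblcat) (F : sfun C D) (G : sfun D E) A :
  sfa (sfun_comp F G) A = sfa G (sfa F A). Proof. by []. Qed.
Lemma sfp_comp (C D E : dblcat) (F : sfun C D) (G : sfun D E) A :
  sfp (sfun_comp F G) A = sfp G (sfp F A). Proof. by []. Qed.
Lemma sfs_comp (C D E : dblcat) (F : sfun C D) (G : sfun D E) A :
  sfs (sfun_comp F G) A = sfs G (sfs F A). Proof. by []. Qed.

Section TransBoundaries.
Variables (C D : dblcat).
Implicit Types (a : vtrans C D) (c : htrans C D) (m : modif C D).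
Implicit Types (f : arr C) (M : pro C) (x : sq C) (A : ob C).
Lemma src_vob a A : src (vob a A) = sfo (vsrc a) A. Proof. by case: (vob_arr a A). Qed.
Lemma tgt_vob a A : tgt (vob a A) = sfo (vtgt a) A. Proof. by case: (vob_arr a A). Qed.
Lemma larr_vpro a M : larr (vpro a M) = vob a (lob M). Proof. by case: (vpro_sq a M). Qed.
Lemma rarr_vpro a M : rarr (vpro a M) = vob a (rob M). Proof. by case: (vpro_sq a M). Qed.
Lemma top_vpro a M : top (vpro a M) = sfp (vsrc a) M. Proof. by case: (vpro_sq a M). Qed.
Lemma bot_vpro a M : bot (vpro a M) = sfp (vtgt a) M. Proof. by case: (vpro_sq a M). Qed.
Lemma larr_varr a f : larr (varr a f) = sfa (vsrc a) f ·0 vob a (tgt f).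
Proof. by case: (varr_sq a f). Qed.
Lemma rarr_varr a f : rarr (varr a f) = vob a (src f) ·0 sfa (vtgt a) f.
Proof. by case: (varr_sq a f). Qed.
Lemma top_varr a f : top (varr a f) = Uo (sfo (vsrc a) (src f)).
Proof. by case: (varr_sq a f) => _ _ -> _; rewrite src_acomp src_sfa. Qed.
Lemma bot_varr a f : bot (varr a f) = Uo (sfo (vtgt a) (tgt f)).
Proof.
by case: (varr_sq a f) => _ _ _ ->; rewrite tgt_acomp ?tgt_vob // tgt_sfa src_vob.
Qed.

Lemma isdisk_varr a f : isdisk (varr a f).
Proof. by do 2 eexists; split; [exact: top_varr|exact: bot_varr]. Qed.
Lemma lob_hob c A : lob (hob c A) = sfo (hsrc c) A. Proof. by case: (hob_pro c A). Qed.
Lemma rob_hob c A : rob (hob c A) = sfo (htgt c) A. Proof. by case: (hob_pro c A). Qed.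
Lemma larr_harr c f : larr (harr c f) = sfa (hsrc c) f. Proof. by case: (harr_sq c f). Qed.
Lemma rarr_harr c f : rarr (harr c f) = sfa (htgt c) f. Proof. by case: (harr_sq c f). Qed.
Lemma top_harr c f : top (harr c f) = hob c (src f). Proof. by case: (harr_sq c f). Qed.
Lemma bot_harr c f : bot (harr c f) = hob c (tgt f). Proof. by case: (harr_sq c f). Qed.
Lemma larr_hpro c M : larr (hpro c M) = ida (sfo (hsrc c) (lob M)).
Proof. by case: (hpro_sq c M) => ->; rewrite lobh lob_sfp. Qed.
Lemma rarr_hpro c M : rarr (hpro c M) = ida (sfo (htgt c) (rob M)).
Proof. by case: (hpro_sq c M) => _ ->; rewrite robh ?rob_hob // rob_sfp lob_hob. Qed.
Lemma top_hpro c M : top (hpro c M) = sfp (hsrc c) M ⊙0 hob c (rob M).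
Proof. by case: (hpro_sq c M). Qed.
Lemma bot_hpro c M : bot (hpro c M) = hob c (lob M) ⊙0 sfp (htgt c) M.
Proof. by case: (hpro_sq c M). Qed.
Lemma larr_mob m A : larr (mob m A) = vob (ml m) A. Proof. by case: (mob_sq m A). Qed.
Lemma rarr_mob m A : rarr (mob m A) = vob (mr m) A. Proof. by case: (mob_sq m A). Qed.
Lemma top_mob m A : top (mob m A) = hob (mt m) A. Proof. by case: (mob_sq m A). Qed.
Lemma bot_mob m A : bot (mob m A) = hob (mb m) A. Proof. by case: (mob_sq m A). Qed.
End TransBoundaries.

Definition bdE2 := (bdE, src_sfa, tgt_sfa, lob_sfp, rob_sfp, larr_sfs, rarr_sfs,
  top_sfs, bot_sfs, sfa_ida, sfp_Uo, (sfo_comp, sfa_comp, sfp_comp, sfs_comp),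
  (src_vob, tgt_vob, larr_vpro, rarr_vpro, top_vpro, bot_vpro,
   larr_varr, rarr_varr, top_varr, bot_varr),
  (lob_hob, rob_hob, larr_harr, rarr_harr, top_harr, bot_harr,
   larr_hpro, rarr_hpro, top_hpro, bot_hpro),
  (larr_mob, rarr_mob, top_mob, bot_mob)).

Ltac dsk ::= solve [repeat first [assumption | apply: isdisk_Ua | apply: isdisk_varr
  | apply: isdisk_h; [| |solve[bd]] | apply: isdisk_v; [| |solve[bd]]]].
Ltac bd_rw ::= rewrite ?bdE2.
Ltac bd_hook ::= first [bd_action | match goal with
   | |- context[sfa ?F (?f ·0 ?g)] => rewrite (@sfa_acomp _ _ F f g); [|solve[bd]]
   | |- context[sfp ?F (?f ⊙0 ?g)] => rewrite (@sfp_hcomp _ _ F f g); [|solve[bd]]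
   | H : vtgt ?a = ?b |- context[vtgt ?a] =>
     lazymatch b with context[vtgt a] => fail | _ => rewrite H end
   | H : htgt ?a = ?b |- context[htgt ?a] =>
     lazymatch b with context[htgt a] => fail | _ => rewrite H end
   | H : vsrc ?a = ?b |- context[vsrc ?a] =>
     lazymatch b with context[vsrc a] => fail | _ => rewrite H end
   | H : hsrc ?a = ?b |- context[hsrc ?a] =>
     lazymatch b with context[hsrc a] => fail | _ => rewrite H end
  end].

Section FunctorAction.
Variables (C D : dblcat) (F : sfun C D).
(** Strict functors are only asked to preserve the coherators themselves; uniqueness of inverses
    extends this to [lamV], [rhoV] and [kapV]. *)
Lemma inv_unique (M N : pro D) (a b b' : sq D) : top b = M -> top b' = M ->
  bot b = N -> bot b' = N -> top a = N -> bot a = M ->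
  a · b = ids N -> b' · a = ids M -> b' = b.
Proof.
move=> ? ? ? ? ? ? e1 e2.
by rewrite -[b'](@vcomp_ids _ N) // -e1 -vcompA; [rewrite e2; rids|bd..].
Qed.

Lemma sfs_rhoV (M : pro C) : sfs F (rhoV M) = rhoV (sfp F M).
Proof.
apply: (@inv_unique _ _ (rho (sfp F M))); [bd|bd|bd|bd|bd|bd| |]; first by rewrite rhoK'; bd.
by rewrite -sfs_rho -sfs_vcomp; [rewrite rhoVK' sfs_ids; bd|bd].
Qed.

Lemma sfs_lamV (M : pro C) : sfs F (lamV M) = lamV (sfp F M).
Proof.
apply: (@inv_unique _ _ (lam (sfp F M))); [bd|bd|bd|bd|bd|bd| |]; first by rewrite lamK'; bd.
by rewrite -sfs_lam -sfs_vcomp; [rewrite lamVK' sfs_ids; bd|bd].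
Qed.

Lemma sfs_kapV (M N P : pro C) : rob M = lob N -> rob N = lob P ->
  sfs F (kapV M N P) = kapV (sfp F M) (sfp F N) (sfp F P).
Proof.
move=> e1 e2.
apply: (@inv_unique _ _ (kap (sfp F M) (sfp F N) (sfp F P))); [bd|bd|bd|bd|bd|bd| |];
  first by rewrite kapK'; bd.
by rewrite -sfs_kap -?sfs_vcomp; [rewrite kapVK' ?sfs_ids; bd|bd..].
Qed.

Lemma isdisk_sfs d : isdisk d -> isdisk (sfs F d).
Proof. by move=> [A [B [? ?]]]; exists (sfo F A), (sfo F B); split; bd. Qed.
Lemma sfs_ract x d : isdisk d -> rarr x = larr d -> sfs F (x ◃ d) = sfs F x ◃ sfs F d.
Proof.
move=> Hd e; obs; rewrite !ractE.
by rewrite sfs_vcomp ?sfs_vcomp ?sfs_hcomps ?sfs_rhoV ?sfs_rho; bd.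
Qed.

Lemma sfs_lact x d : isdisk d -> rarr d = larr x -> sfs F (d ▹ x) = sfs F d ▹ sfs F x.
Proof.
move=> Hd e; obs; rewrite !lactE.
by rewrite sfs_vcomp ?sfs_vcomp ?sfs_hcomps ?sfs_lamV ?sfs_lam; bd.
Qed.
End FunctorAction.

Lemma congE (D : dblcat) (M N : pro D) (p q d e : sq D) :
  top p = M -> bot p = N -> top q = M -> bot q = N ->
  cong M N (p ⊙ d) (e ⊙ q) = (p ◃ d = e ▹ q).
Proof. by move=> e1 e2 e3 e4; rewrite /cong ractE lactE e1 e2 e3 e4. Qed.

Lemma v_natA (C D : dblcat) (a : vtrans C D) x :
  (sfs (vsrc a) x · vpro a (bot x)) ◃ varr a (rarr x) =
  varr a (larr x) ▹ (vpro a (top x) · sfs (vtgt a) x).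
Proof. by have := v_nat a x; rewrite congE //; bd. Qed.

Lemma m_arrA (C D : dblcat) (m : modif C D) f :
  (harr (mt m) f · mob m (tgt f)) ◃ varr (mr m) f =
  varr (ml m) f ▹ (mob m (src f) · harr (mb m) f).
Proof. by have := m_arr m f; rewrite congE //; bd. Qed.

(** * Composition of arrow-dimension transformations *)

Section Disks.
Variables (D : dblcat).
Implicit Types (d e k : sq D).

Lemma disk_Ua d : isdisk d -> d ⊙ Ua (rarr d) = d.
Proof. by move=> H; rewrite -ract_disk; [rewrite ractU|dsk|dsk|bd]. Qed.
Lemma Ua_disk d : isdisk d -> Ua (larr d) ⊙ d = d.
Proof. by move=> H; rewrite -lact_disk; [rewrite lactU|dsk|dsk|bd]. Qed.
Lemma Ua_hcomps (f : arr D) : Ua f ⊙ Ua f = Ua f.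
Proof. by have := disk_Ua (isdisk_Ua f); bd. Qed.

(** No associator appears between unit proarrows: associativity of ⊙ on disks is associativity of
    their action. *)
Lemma disk_hcompsA d e k : isdisk d -> isdisk e -> isdisk k ->
  rarr d = larr e -> rarr e = larr k -> (d ⊙ e) ⊙ k = d ⊙ (e ⊙ k).
Proof.
move=> Hd He Hk e1 e2; obs.
rewrite -(@ract_disk _ d (e ⊙ k)); [|dsk|dsk|bd].
by rewrite -ractA // !ract_disk //; [dsk|bd].
Qed.

Lemma disk_exchl d e : isdisk d -> isdisk e -> bot d = top e ->
  (d · Ua (larr e)) ⊙ (Ua (rarr d) · e) = d · e.
Proof.
move=> Hd He e1; obs.
by rewrite exchange; [rewrite disk_Ua // Ua_disk|bd..].
Qed.

Lemma disk_exchr d e : isdisk d -> isdisk e -> bot d = top e ->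
  (Ua (larr d) · e) ⊙ (d · Ua (rarr e)) = d · e.
Proof.
move=> Hd He e1; obs.
by rewrite exchange; [rewrite disk_Ua // Ua_disk|bd..].
Qed.

Lemma disk_src d : isdisk d -> src (rarr d) = src (larr d).
Proof. by move=> H; obs; bd. Qed.
Lemma disk_tgt d : isdisk d -> tgt (rarr d) = tgt (larr d).
Proof. by move=> H; obs; bd. Qed.

Lemma disk_whr d e f : isdisk d -> isdisk e -> rarr d = larr e ->
  tgt (larr d) = src f -> (d ⊙ e) · Ua f = (d · Ua f) ⊙ (e · Ua f).
Proof.
move=> Hd He e1 e2; have [? ?] : bot d = Uo (src f) /\ bot e = Uo (src f).
  by rewrite (disk_bot Hd (erefl _)) (disk_bot He (erefl _)) -e1 disk_tgt // e2.
by rewrite exchange; [rewrite Ua_hcomps|bd..].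
Qed.

Lemma disk_whl d e f : isdisk d -> isdisk e -> rarr d = larr e ->
  tgt f = src (larr d) -> Ua f · (d ⊙ e) = (Ua f · d) ⊙ (Ua f · e).
Proof.
move=> Hd He e1 e2; have [? ?] : top d = Uo (tgt f) /\ top e = Uo (tgt f).
  by rewrite (disk_top Hd (erefl _)) (disk_top He (erefl _)) -e1 disk_src // e2.
by rewrite exchange; [rewrite Ua_hcomps|bd..].
Qed.

(** This is the composition law for [varr] of a composite transformation. Once whiskerings are
    distributed, both sides are ⊙-composites of the same four whiskered disks. The outer two agree;
    the middle two, from [x] and [y'], occur in opposite orders, and either order equals [x · y'] by
    [disk_exchl] and [disk_exchr]. *)
Lemma disk_pasting (x x' y y' : sq D) p p' q q' r r' a0 a1 a2 b0 b1 b2 :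
  isdisk x -> isdisk x' -> isdisk y -> isdisk y' ->
  [/\ larr x = p ·0 a1, rarr x = a0 ·0 q, larr x' = p' ·0 a2 & rarr x' = a1 ·0 q'] ->
  [/\ larr y = q ·0 b1, rarr y = b0 ·0 r, larr y' = q' ·0 b2 & rarr y' = b1 ·0 r'] ->
  [/\ tgt p = src p', tgt p = src a1, tgt p' = src a2 & tgt a0 = src q] ->
  [/\ tgt a1 = src q', tgt q = tgt a1, tgt a2 = src b2 & tgt q' = tgt a2] ->
  [/\ tgt q = src b1, tgt b0 = src r, tgt r = src r', tgt b1 = tgt r & tgt b2 = tgt r'] ->
  (((Ua p · x') ⊙ (x · Ua q')) · Ua b2) ⊙ (Ua a0 · ((Ua q · y') ⊙ (y · Ua r'))) =
  (Ua p · ((x' · Ua b2) ⊙ (Ua a1 · y'))) ⊙ (((x · Ua b1) ⊙ (Ua a0 · y)) · Ua r').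
Proof.
move=> Hx Hx' Hy Hy' [? ? ? ?] [? ? ? ?] [? ? ? ?] [? ? ? ?] [? ? ? ? ?].
have ? : top x = Uo (src p) by rewrite (@disk_top _ _ (p ·0 a1)) //; bd.
have ? : bot x = Uo (tgt q) by rewrite (@disk_bot _ _ (p ·0 a1)) //; bd.
have ? : top x' = Uo (src p') by rewrite (@disk_top _ _ (p' ·0 a2)) //; bd.
have ? : bot x' = Uo (tgt a2) by rewrite (@disk_bot _ _ (p' ·0 a2)) //; bd.
have ? : top y = Uo (src q) by rewrite (@disk_top _ _ (q ·0 b1)) //; bd.
have ? : bot y = Uo (tgt b1) by rewrite (@disk_bot _ _ (q ·0 b1)) //; bd.
have ? : top y' = Uo (src q') by rewrite (@disk_top _ _ (q' ·0 b2)) //; bd.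
have ? : bot y' = Uo (tgt b2) by rewrite (@disk_bot _ _ (q' ·0 b2)) //; bd.
rewrite disk_whr; [|dsk|dsk|bd|bd].
rewrite disk_whl; [|dsk|dsk|bd|bd].
rewrite disk_whr; [|dsk|dsk|bd|bd].
rewrite disk_whl; [|dsk|dsk|bd|bd].
rewrite !disk_hcompsA; try dsk; try bd.
rewrite -!vcompA; try bd.
congr (_ ⊙ _).
rewrite -!disk_hcompsA; try dsk; try bd.
congr (_ ⊙ _).
rewrite !vcompA; try bd. rewrite -!Ua_acomp; try bd.
have := @disk_exchl x y'; have := @disk_exchr x y'.
rewrite -[Ua a0 · _]vcompA -?[Ua p · (_ · _)]vcompA -?Ua_acomp; try bd.
bd => H1 H2; rewrite H1 ?H2 //; congruence.
Qed.
End Disks.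

Section Vertical.
Variables (C D : dblcat).

Definition vtrans_id (F : sfun C D) : vtrans C D.
Proof.
exists F F (fun A => ida (sfo F A)) (fun M => ids (sfp F M)) (fun f => Ua (sfa F f)).
- by move=> A; split; bd.
- by move=> M; split; bd.
- by move=> f; split; bd.
- by move=> A; bd; rewrite Ua_ida.
- by move=> M N h; rewrite ids_hcomps; bd.
- by move=> A; bd.
- move=> f f' h; rewrite sfa_acomp // -Ua_acomp; [|bd].
  by rewrite Ua_hcomps.
- move=> x; rewrite congE; [|bd..]. rewrite vcomp_ids; [|bd]. rewrite ids_vcomp; [|bd].
  by rewrite ractU ?lactU; bd.
Defined.

Definition vtrans_comp (a b : vtrans C D) (h : vtgt a = vsrc b) : vtrans C D.
Proof.
exists (vsrc a) (vtgt b) (fun A => vob a A ·0 vob b A) (fun M => vpro a M · vpro b M)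
  (fun f => (varr a f · Ua (vob b (tgt f))) ⊙ (Ua (vob a (src f)) · varr b f)).
- by move=> A; split; bd.
- by move=> M; split; bd.
- by move=> f; split; bd.
- by move=> A; rewrite !vpro_U Ua_acomp; bd.
- by move=> M N e; rewrite !vpro_hcomp // exchange; bd.
- move=> A; rewrite !varr_id; bd; rewrite -!Ua_acomp; [by rewrite Ua_hcomps|bd..].
- move=> f f' e; rewrite varr_comp // varr_comp //; bd; rewrite -h.
  apply: disk_pasting; try exact: isdisk_varr; try (split; bd).
- move=> x. rewrite congE; [|bd..].
  have := @ract_stack D (sfs (vsrc a) x) (vpro a (bot x)) (vpro b (bot x))
    (sfs (vtgt a) x) (vpro a (top x)) (vpro b (top x)) (sfs (vtgt b) x)
   (varr a (rarr x)) (varr a (larr x)) (varr b (rarr x)) (varr b (larr x)).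
  rewrite !v_natA h v_natA; bd => -> //; try (split; bd); exact: isdisk_varr.
Defined.

End Vertical.

(** * Composition of proarrow-dimension transformations *)

Section PJoin.
Variable D : dblcat.
Implicit Types (M N P Q : pro D) (x y z : sq D).

Lemma kapVN x y z : rarr x = larr y -> rarr y = larr z ->
  (x ⊙ (y ⊙ z)) · kapV (bot x) (bot y) (bot z) =
  kapV (top x) (top y) (top z) · ((x ⊙ y) ⊙ z).
Proof.
move=> e1 e2; have [? ?] := rarr_larr_ob e1; have [? ?] := rarr_larr_ob e2.
apply: (vcancel_l (a := kap (top x) (top y) (top z)) (b := kapV (top x) (top y) (top z)));
  [by rewrite kapVK'; bd|bd|bd|bd|].
rewrite -!vcompA; [|bd..]. rewrite -kapN // vcompA; [|bd..].
by rewrite !kapK' //; rids.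
Qed.

(* The component at M of the composite of two proarrow-dimension
   transformations with components s and t at M. *)
Definition comp_cell M U V U' W V' R s t : sq D :=
  kapV M U V · (s ⊙ ids V) · kap U' W V · (ids U' ⊙ t) · kapV U' V' R.

(** The squares are kept arbitrary so that the lemma gives both the naturality of a composite
    transformation and the second axiom of a horizontal composite of modifications. The row
    [p, u, v] is pushed through one factor of [comp_cell] at a time. *)
Lemma comp_cell_nat p u v q u' v' r s t s' t' :
  [/\ rarr p = larr u, rarr u = larr v, rarr u' = larr q, rarr q = larr v & larr p = larr u'] ->
  [/\ rarr u' = larr v' & rarr v' = larr r] ->
  is_proarrow_disk s (top p ⊙0 top u) (top u' ⊙0 top q) ->
  is_proarrow_disk s' (bot p ⊙0 bot u) (bot u' ⊙0 bot q) ->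
  is_proarrow_disk t (top q ⊙0 top v) (top v' ⊙0 top r) ->
  is_proarrow_disk t' (bot q ⊙0 bot v) (bot v' ⊙0 bot r) ->
  (p ⊙ u) · s' = s · (u' ⊙ q) -> (q ⊙ v) · t' = t · (v' ⊙ r) ->
  (p ⊙ (u ⊙ v)) · comp_cell (bot p) (bot u) (bot v) (bot u') (bot q) (bot v') (bot r) s' t' =
  comp_cell (top p) (top u) (top v) (top u') (top q) (top v') (top r) s t · ((u' ⊙ v') ⊙ r).
Proof.
move=> [e1 e2 e3 e4 e5] [e6 e7].
have [? ?] := rarr_larr_ob e1; have [? ?] := rarr_larr_ob e2; have [? ?] := rarr_larr_ob e3.
have [? ?] := rarr_larr_ob e4; have [? ?] := rarr_larr_ob e6; have [? ?] := rarr_larr_ob e7.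
move=> [H1 H2 ? ?] [H3 H4 ? ?] [H5 H6 ? ?] [H7 H8 ? ?] E1 E2.
have ? : rarr u = rarr q by congruence.
have ? : rarr s = ida (rob (top q)) by rewrite H2 !robh // -!src_rarr; congruence.
have ? : rarr s' = ida (rob (bot q)) by rewrite H4 !robh // -!tgt_rarr; congruence.
have ? : larr t = ida (lob (top q)) by rewrite H5; bd.
have ? : larr t' = ida (lob (bot q)) by rewrite H7; bd.
rewrite /comp_cell.
ra.
have F1 : ((p ⊙ u) ⊙ v) · (s' ⊙ ids (bot v)) = (s ⊙ ids (top v)) · ((u' ⊙ q) ⊙ v).
  by rewrite -!exchange; [rewrite E1; rids|bd..].
have F2 : (u' ⊙ (q ⊙ v)) · (ids (bot u') ⊙ t') = (ids (top u') ⊙ t) · (u' ⊙ (v' ⊙ r)).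
  by rewrite -!exchange; [rewrite E2; rids|bd..].
rewrite (vpre (kapVN e1 e2)); [|bd..]. rewrite (vcompA (y := (p ⊙ u) ⊙ v)); [|bd..].
rewrite (vpre F1); [|bd..]. rewrite (vcompA (y := (u' ⊙ q) ⊙ v)); [|bd..].
rewrite (vpre (kapN e3 e4)); [|bd..]. rewrite (vcompA (y := u' ⊙ (q ⊙ v))); [|bd..].
rewrite (vpre F2); [|bd..]. rewrite (vcompA (y := u' ⊙ (v' ⊙ r))); [|bd..].
by rewrite -kapVN.
Qed.
End PJoin.

Section Pent.
Variable D : dblcat.
Implicit Types (M N P Q : pro D) (x y z : sq D).

Lemma kapNE x y z : rarr x = larr y -> rarr y = larr z ->
  (x ⊙ y) ⊙ z =
  kap (top x) (top y) (top z) · ((x ⊙ (y ⊙ z)) · kapV (bot x) (bot y) (bot z)).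
Proof.
move=> e1 e2; have [? ?] := rarr_larr_ob e1; have [? ?] := rarr_larr_ob e2.
rewrite -vcompA; [|bd..]. rewrite -kapN // vcompA; [|bd..]. by rewrite kapK'; rids; bd.
Qed.

Section Four.
Variables (M N P Q : pro D).
Hypotheses (e1 : rob M = lob N) (e2 : rob N = lob P) (e3 : rob P = lob Q).

(** This form of the pentagon and the next two are the patterns of mixed associators that arise when
    cells are rebracketed inside composite components. *)
Lemma pentagonF : kapV (M ⊙0 N) P Q · ((kap M N P ⊙ ids Q) · kap M (N ⊙0 P) Q) =
  kap M N (P ⊙0 Q) · (ids M ⊙ kapV N P Q).
Proof.
apply: (vcancel_l (a := kap (M ⊙0 N) P Q) (b := kapV (M ⊙0 N) P Q));
  [by bd; rewrite kapVK'; bd|bd|bd|bd|].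
rewrite -vcompA; [|bd..]. rewrite kapK'; [|bd..]. rids.
rewrite -[RHS]vcompA; [|bd..].
rewrite (pentagon (dblcatP D)) //.
rewrite vcompA; [|bd..].
by rewrite -exchange; [rewrite kapK' //; rids|bd..]; bd.
Qed.

Lemma pentagonV : kapV M (N ⊙0 P) Q · ((kapV M N P ⊙ ids Q) · kap (M ⊙0 N) P Q) =
  (ids M ⊙ kap N P Q) · kapV M N (P ⊙0 Q).
Proof.
apply: (@inv_unique _ _ _ (kap M N (P ⊙0 Q) · (ids M ⊙ kapV N P Q)));
  [bd|bd|bd|bd|bd|bd| |].
- ra. rewrite -(vcompA (x := ids M ⊙ kapV N P Q)); [|bd..].
  rewrite -exchange; [|bd..]. by rewrite kapVK' //; rids; rewrite kapK'; bd.
- rewrite -pentagonF; ra.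
  rewrite -(vcompA (x := kap (M ⊙0 N) P Q)); [|bd..]. rewrite kapK'; [|bd..]. rids.
  rewrite -(vcompA (x := kapV M N P ⊙ ids Q)); [|bd..]. rewrite -exchange; [|bd..].
  by rewrite kapVK' //; rids; rewrite kapVK'; bd.
Qed.

Lemma pentagonVV : kapV M N (P ⊙0 Q) · (kapV (M ⊙0 N) P Q · (kap M N P ⊙ ids Q)) =
  (ids M ⊙ kapV N P Q) · kapV M (N ⊙0 P) Q.
Proof.
apply: (vcancel_r (a := kap M (N ⊙0 P) Q) (b := kapV M (N ⊙0 P) Q));
  [by bd; rewrite kapK'; bd|bd|bd|bd|].
ra; rewrite pentagonF. rewrite -vcompA; [|bd..]. rewrite !kapVK'; [|bd..].
by rids.
Qed.
End Four.
End Pent.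

(** Makes a pentagon form usable as a rewriting rule inside a longer right-associated composite,
    whose tail is [k]. *)
Lemma vpre32 (D : dblcat) (a b c d e k : sq D) : a · (b · c) = d · e ->
  bot a = top b -> bot b = top c -> bot c = top k -> bot d = top e ->
  a · (b · (c · k)) = d · (e · k).
Proof.
move=> E h1 h2 h3 h4; rewrite -(vcompA (x := b)) // -vcompA; [|bd..].
by rewrite E vcompA // -h3 -(@bot_vcomp _ d) // -E; bd.
Qed.

Lemma vcancel (D : dblcat) (a b k : sq D) M : a · b = ids M ->
  bot a = top b -> bot b = top k -> M = top k -> a · (b · k) = k.
Proof. by move=> E h1 h2 h3; rewrite -vcompA // E ids_vcomp. Qed.

Lemma vpre44 (D : dblcat) (a b c d a' b' c' d' k : sq D) :
  a · (b · (c · d)) = a' · (b' · (c' · d')) ->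
  [/\ bot a = top b, bot b = top c, bot c = top d & bot d = top k] ->
  [/\ bot a' = top b', bot b' = top c' & bot c' = top d'] ->
  a · (b · (c · (d · k))) = a' · (b' · (c' · (d' · k))).
Proof.
move=> E [h1 h2 h3 h4] [h5 h6 h7].
have F : bot (a · (b · (c · d))) = bot (a' · (b' · (c' · d'))) by rewrite E.
have {F} ? : bot d = bot d' by move: F; bd.
have : (a · (b · (c · d))) · k = (a' · (b' · (c' · d'))) · k by rewrite E.
by do !(rewrite vcompA; [|solve[bd]|solve[bd]]).
Qed.

(** [s] and [t] act on disjoint factors, so they commute by interchange; naturality of κ and of its
    inverse carries [t] through the surrounding rebracketing. *)
Lemma kap_slide (D : dblcat) (M U U' M' P P' : pro D) (s t : sq D) :
  [/\ rob M = lob U, rob U' = lob M', lob M = lob U', rob U = rob M' & rob M' = lob P] ->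
  is_proarrow_disk s (M ⊙0 U) (U' ⊙0 M') -> is_proarrow_disk t P P' ->
  kapV M U P · ((s ⊙ ids P) · (kap U' M' P · (ids U' ⊙ (ids M' ⊙ t)))) =
  (ids M ⊙ (ids U ⊙ t)) · (kapV M U P' · ((s ⊙ ids P') · kap U' M' P')).
Proof.
move=> [? ? ? ? ?] [H1 H2 ? ?] [H3 H4 ? ?].
have {H1} ? : larr s = ida (lob M) by rewrite H1; bd.
have {H2} ? : rarr s = ida (rob U) by rewrite H2; bd.
have ? : lob P' = lob P.
  by rewrite -[in LHS](_ : bot t = P') // -tgt_larr H3 tgt_ida.
have K := @kapN D (ids U') (ids M') t; rewrite ?bdE ids_hcomps in K; [|by []].
have KV := @kapVN D (ids M) (ids U) t; rewrite ?bdE ids_hcomps in KV; [|congruence].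
have E : (s ⊙ ids P) · (ids (U' ⊙0 M') ⊙ t) = (ids (M ⊙0 U) ⊙ t) · (s ⊙ ids P').
  by rewrite -!exchange; [rids|bd..].
rewrite -(_ : top t = P) // -(_ : bot t = P') // -K; [|bd..].
rewrite -?(vcompA (x := s ⊙ _)); [|bd..].
have -> : top t = P by []. have -> : bot t = P' by [].
rewrite E vcompA; [|bd..]. rewrite -!vcompA; [|bd..]. congr (_ · _ · _).
by move: KV; have -> : top t = P by []; have -> : bot t = P' by []; move=> ->; bd.
Qed.

(* The component at M ⊙ N of a proarrow-dimension transformation with component
   s at M and s2 at N. *)
Definition oplax_cell (D : dblcat) (M N U2 : pro D) s2 U1 N' s U0 M' : sq D :=
  kap M N U2 · (ids M ⊙ s2) · kapV M U1 N' · (s ⊙ ids N') · kap U0 M' N'.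

Section HcompCoherence.
Variable D : dblcat.
Implicit Types (M N P Q : pro D) (x y z : sq D).

(** The multiplicativity axiom for a composite of proarrow-dimension transformations. The left side
    applies the cells in the order [s2, s, t2, t], the right side in the order [s2, t2, s, t].
    Pentagons bring the associators into agreement, and [kap_slide] exchanges [s] with [t2]. *)
Lemma comp_cell_oplax_cell M N M' N' M'' N'' U0 U1 U2 V0 V1 V2 (s s2 t t2 : sq D) :
  [/\ rob M = lob N, rob M' = lob N' & rob M'' = lob N''] ->
  [/\ rob U0 = lob M', rob U1 = lob N', rob U2 = lob V2, rob U1 = rob M' & rob U2 = rob N'] ->
  [/\ rob V0 = lob M'', rob V1 = lob N'', rob M'' = rob V1, rob U0 = lob V0 & rob N'' = rob V2] ->
  [/\ rob M = lob U1, rob N = lob U2, lob V1 = rob M' & lob M = lob U0] ->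
  is_proarrow_disk s (M ⊙0 U1) (U0 ⊙0 M') ->
  is_proarrow_disk s2 (N ⊙0 U2) (U1 ⊙0 N') ->
  is_proarrow_disk t (M' ⊙0 V1) (V0 ⊙0 M'') ->
  is_proarrow_disk t2 (N' ⊙0 V2) (V1 ⊙0 N'') ->
  comp_cell (M ⊙0 N) U2 V2 U0 (M' ⊙0 N') V0 (M'' ⊙0 N'')
    (oplax_cell M N U2 s2 U1 N' s U0 M') (oplax_cell M' N' V2 t2 V1 N'' t V0 M'') =
  oplax_cell M N (U2 ⊙0 V2) (comp_cell N U2 V2 U1 N' V1 N'' s2 t2) (U1 ⊙0 V1) N''
     (comp_cell M U1 V1 U0 M' V0 M'' s t) (U0 ⊙0 V0) M''.
Proof.
move=> [? ? ?] [? ? ? ? ?] [? ? ? ? ?] [? ? ? ?].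
move=> [H1 H2 ? ?] [H3 H4 ? ?] [H5 H6 ? ?] [H7 H8 ? ?].
have {H1} ? : larr s = ida (lob M) by rewrite H1; bd.
have {H2} ? : rarr s = ida (rob U1) by rewrite H2; bd.
have {H3} ? : larr s2 = ida (lob N) by rewrite H3; bd.
have {H4} ? : rarr s2 = ida (rob U2) by rewrite H4; bd.
have {H5} ? : larr t = ida (lob M') by rewrite H5; bd.
have {H6} ? : rarr t = ida (rob V1) by rewrite H6; bd.
have {H7} ? : larr t2 = ida (lob N') by rewrite H7; bd.
have {H8} ? : rarr t2 = ida (rob V2) by rewrite H8; bd.
rewrite /comp_cell /oplax_cell.
do !(rewrite vcomp_hcomps_ids; [|solve[bd]|solve[bd]|solve[bd]]).
do !(rewrite ids_hcomps_vcomp; [|solve[bd]|solve[bd]|solve[bd]]).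
ra.
(* Rebracketing each doubly whiskered cell exposes its associators, which then meet their neighbours
   in the patterns of the pentagon forms. *)
have K1 : (ids M ⊙ s2) ⊙ ids V2 =
    kap M (N ⊙0 U2) V2 · ((ids M ⊙ (s2 ⊙ ids V2)) · kapV M (U1 ⊙0 N') V2).
  by rewrite kapNE; bd.
have K2 : (s ⊙ ids N') ⊙ ids V2 =
    kap (M ⊙0 U1) N' V2 · ((s ⊙ ids (N' ⊙0 V2)) · kapV (U0 ⊙0 M') N' V2).
  by rewrite kapNE; [rewrite ids_hcomps|..]; bd.
have K3 : (s ⊙ ids V1) ⊙ ids N'' =
    kap (M ⊙0 U1) V1 N'' · ((s ⊙ ids (V1 ⊙0 N'')) · kapV (U0 ⊙0 M') V1 N'').
  by rewrite kapNE; [rewrite ids_hcomps|..]; bd.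
have K4 : (ids U0 ⊙ t) ⊙ ids N'' =
    kap U0 (M' ⊙0 V1) N'' · ((ids U0 ⊙ (t ⊙ ids N'')) · kapV U0 (V0 ⊙0 M'') N'').
  by rewrite kapNE; bd.
rewrite K1 K2 K3 K4; ra.
have P1 := @pentagonF D M N U2 V2; have P2 := @pentagonV D M U1 N' V2.
have P3 := @pentagonF D U0 M' N' V2; have P4 := @pentagonV D M U1 V1 N''.
have P5 := @pentagonF D U0 M' V1 N''; have P6 := @pentagonV D U0 V0 M'' N''.
rewrite (vpre32 (P1 _ _ _)); [|bd..]; congr (_ · (_ · _)).
rewrite (vpre32 (P2 _ _ _)); [|bd..].
rewrite (vpre32 (P3 _ _ _)); [|bd..].
rewrite (vpre32 (P4 _ _ _)); [|bd..].
rewrite (vpre32 (P5 _ _ _)); [|bd..].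
rewrite P6; [|bd..]; congr (_ · (_ · _)).
have C1 : (ids U0 ⊙ kapV M' N' V2) · (ids U0 ⊙ kap M' N' V2) = ids (U0 ⊙0 (M' ⊙0 (N' ⊙0 V2))).
  by rewrite -ids_hcomps_vcomp ?kapVK' ?ids_hcomps; bd.
have C2 : (ids M ⊙ kapV U1 V1 N'') · (ids M ⊙ kap U1 V1 N'') = ids (M ⊙0 (U1 ⊙0 (V1 ⊙0 N''))).
  by rewrite -ids_hcomps_vcomp ?kapVK' ?ids_hcomps; bd.
rewrite (vcancel C1); [|bd..]. rewrite (vcancel C2); [|bd..].
have S := @kap_slide D M U1 U0 M' (N' ⊙0 V2) (V1 ⊙0 N'') s t2.
by rewrite (vpre44 (S _ _ _)) //; split; bd.
Qed.
End HcompCoherence.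

Section AssocCoherence.
Variable D : dblcat.
Implicit Types (M N P Q : pro D) (x y z : sq D).

(** The proarrow axiom making κ a modification. Both sides apply [s], [t], [r] in the same order, so
    only associators have to be matched. *)
Lemma comp_cell_assoc M0 M1 M2 M3 U0 U1 V0 V1 W0 W1 (s t r : sq D) :
  [/\ rob M0 = lob U1, rob U1 = lob V1, rob V1 = lob W1, rob U0 = lob M1 & rob M1 = rob U1] ->
  [/\ rob U0 = lob V0, rob V0 = lob M2, rob M2 = rob V1, rob V0 = lob W0 & rob W0 = lob M3] ->
  [/\ rob M3 = rob W1, lob M1 = lob V0, lob M2 = lob W0 & lob M0 = lob U0] ->
  is_proarrow_disk s (M0 ⊙0 U1) (U0 ⊙0 M1) ->
  is_proarrow_disk t (M1 ⊙0 V1) (V0 ⊙0 M2) ->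
  is_proarrow_disk r (M2 ⊙0 W1) (W0 ⊙0 M3) ->
  comp_cell M0 (U1 ⊙0 V1) W1 (U0 ⊙0 V0) M2 W0 M3 (comp_cell M0 U1 V1 U0 M1 V0 M2 s t) r
    · (kap U0 V0 W0 ⊙ ids M3) =
  (ids M0 ⊙ kap U1 V1 W1) ·
  comp_cell M0 U1 (V1 ⊙0 W1) U0 M1 (V0 ⊙0 W0) M3 s (comp_cell M1 V1 W1 V0 M2 W0 M3 t r).
Proof.
move=> [? ? ? ? ?] [? ? ? ? ?] [? ? ? ?].
move=> [H1 H2 ? ?] [H3 H4 ? ?] [H5 H6 ? ?].
have {H1} ? : larr s = ida (lob M0) by rewrite H1; bd.
have {H2} ? : rarr s = ida (rob U1) by rewrite H2; bd.
have {H3} ? : larr t = ida (lob M1) by rewrite H3; bd.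
have {H4} ? : rarr t = ida (rob V1) by rewrite H4; bd.
have {H5} ? : larr r = ida (lob M2) by rewrite H5; bd.
have {H6} ? : rarr r = ida (rob W1) by rewrite H6; bd.
rewrite /comp_cell.
do !(rewrite vcomp_hcomps_ids; [|solve[bd]|solve[bd]|solve[bd]]).
do !(rewrite ids_hcomps_vcomp; [|solve[bd]|solve[bd]|solve[bd]]).
have K1 : (s ⊙ ids V1) ⊙ ids W1 =
    kap (M0 ⊙0 U1) V1 W1 · ((s ⊙ ids (V1 ⊙0 W1)) · kapV (U0 ⊙0 M1) V1 W1).
  by rewrite kapNE; [rewrite ids_hcomps|..]; bd.
have K2 : (ids U0 ⊙ t) ⊙ ids W1 =
    kap U0 (M1 ⊙0 V1) W1 · ((ids U0 ⊙ (t ⊙ ids W1)) · kapV U0 (V0 ⊙0 M2) W1).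
  by rewrite kapNE; bd.
have K3 : ids (U0 ⊙0 V0) ⊙ r =
    kap U0 V0 (M2 ⊙0 W1) · ((ids U0 ⊙ (ids V0 ⊙ r)) · kapV U0 V0 (W0 ⊙0 M3)).
  by rewrite -ids_hcomps ?kapNE; bd.
rewrite K1 K2 K3; ra.
have P1 := @pentagonV D M0 U1 V1 W1; have P2 := @pentagonF D U0 M1 V1 W1.
have P3 := @pentagonV D U0 V0 M2 W1; have P4 := @pentagonVV D U0 V0 W0 M3.
rewrite (vpre32 (P1 _ _ _)); [|bd..].
rewrite (vpre32 (P2 _ _ _)); [|bd..].
rewrite (vpre32 (P3 _ _ _)); [|bd..].
rewrite P4; [|bd..].
have C1 : kapV U0 V0 (M2 ⊙0 W1) · kap U0 V0 (M2 ⊙0 W1) = ids (U0 ⊙0 (V0 ⊙0 (M2 ⊙0 W1))).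
  by rewrite kapVK'; bd.
rewrite (vcancel C1); [|bd..].
by [].
Qed.
End AssocCoherence.

(** * Unit laws for composite components *)

Section UnitCoherence.
Variable D : dblcat.
Implicit Types (M N P Q : pro D) (x y z s t : sq D).

Lemma lamV_kap M N : rob M = lob N ->
  (lamV M ⊙ ids N) · kap (Uo (lob M)) M N = lamV (M ⊙0 N).
Proof.
move=> e; apply: (@inv_unique _ _ _ (lam (M ⊙0 N))); [bd|bd|bd|bd|bd|bd| |].
- by rewrite lamK'; bd.
- ra; rewrite kap_lam_hcomp // -vcomp_hcomps_ids; [|bd..]. by rewrite lamVK'; rids.
Qed.

Lemma rhoV_kapV M N : rob M = lob N ->
  (ids M ⊙ rhoV N) · kapV M N (Uo (rob N)) = rhoV (M ⊙0 N).
Proof.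
move=> e; apply: (@inv_unique _ _ _ (rho (M ⊙0 N))); [bd|bd|bd|bd|bd|bd| |].
- by rewrite rhoK'; bd.
- rewrite -kap_rho_hcomp //; ra.
  rewrite (@vcancel _ (kapV M N (Uo (rob N))) _ _ (M ⊙0 (N ⊙0 Uo (rob N))));
    [|rewrite kapVK'|..]; try bd.
  by rewrite -ids_hcomps_vcomp; [rewrite rhoVK'; rids|bd..].
Qed.

Lemma kapV_rho M N : rob M = lob N ->
  kapV M (Uo (rob M)) N · (rho M ⊙ ids N) = ids M ⊙ lam N.
Proof.
by move=> e; rewrite -triangle_kap // (@vcancel _ _ _ _ (M ⊙0 (Uo (rob M) ⊙0 N))) ?kapVK'; bd.
Qed.

Lemma lamV_kapV_rho M N : rob M = lob N ->
  (ids M ⊙ lamV N) · (kapV M (Uo (rob M)) N · (rho M ⊙ ids N)) = ids (M ⊙0 N).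
Proof. by move=> e; rewrite kapV_rho // -ids_hcomps_vcomp; [rewrite lamVK'; rids|bd..]. Qed.

(** The unit axiom of a composite transformation: the inner [rhoV P] and [lam Q] cancel around κ by
    the triangle, and Kelly's lemmas assemble the outer unitors. *)
Lemma comp_cell_Uo P Q : rob P = lob Q ->
  comp_cell (Uo (lob P)) P Q P (Uo (rob P)) Q (Uo (rob Q)) (lam P · rhoV P) (lam Q · rhoV Q) =
  lam (P ⊙0 Q) · rhoV (P ⊙0 Q).
Proof.
move=> e; rewrite /comp_cell vcomp_hcomps_ids; [|bd..]. rewrite ids_hcomps_vcomp; [|bd..]. ra.
have C : (rhoV P ⊙ ids Q) · (kap P (Uo (rob P)) Q · (ids P ⊙ lam Q)) = ids (P ⊙0 Q).
  by rewrite triangle_kap // -vcomp_hcomps_ids; [rewrite rhoVK'; rids|bd..].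
rewrite rhoV_kapV // -(vcompA (x := kap P _ _)); [|bd..].
rewrite -(vcompA (x := rhoV P ⊙ _)); [|bd..]. rewrite C; rids.
rewrite -kap_lam_hcomp // -vcompA; [|bd..].
rewrite -vcompA; [|bd..]. rewrite kapVK'; [|bd..]. by rids.
Qed.

(** The multiplicativity axiom of an identity transformation; again the triangle cancels the inner
    unitors. *)
Lemma oplax_cell_Uo M N : rob M = lob N ->
  oplax_cell M N (Uo (rob N)) (rho N · lamV N) (Uo (rob M)) N (rho M · lamV M) (Uo (lob M)) M
  = rho (M ⊙0 N) · lamV (M ⊙0 N).
Proof.
move=> e; rewrite /oplax_cell vcomp_hcomps_ids; [|bd..]. rewrite ids_hcomps_vcomp; [|bd..]. ra.
rewrite lamV_kap // -(vcompA (x := kapV _ _ _)); [|bd..].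
rewrite -(vcompA (x := ids M ⊙ lamV N)); [|bd..]. rewrite lamV_kapV_rho //; rids.
by rewrite -vcompA; [rewrite kap_rho_hcomp|bd..].
Qed.

(** The proarrow axiom making λ a modification. Kelly's lemma turns the last two factors into a
    unitor, which naturality of λ moves across [s], where it cancels. *)
Lemma comp_cell_lam M P P' M' s : rob M = lob P' -> rob P = lob M' ->
  is_proarrow_disk s (M ⊙0 P') (P ⊙0 M') ->
  comp_cell M (Uo (rob M)) P' (Uo (lob M)) M P M' (rho M · lamV M) s · (lam P ⊙ ids M') =
  (ids M ⊙ lam P') · s.
Proof.
move=> e1 e2 [H1 H2 ? ?].
have {H1} ? : larr s = ida (lob M) by rewrite H1; bd.
have {H2} ? : rarr s = ida (rob P') by rewrite H2; bd.
have ? : lob M = lob P by have := tgt_larr s;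
  rewrite (_ : larr s = ida (lob M)) // (_ : bot s = P ⊙0 M') // tgt_ida lobh.
rewrite /comp_cell vcomp_hcomps_ids; [|bd..]. ra.
have -> : kapV (Uo (lob M)) P M' · (lam P ⊙ ids M') = lam (P ⊙0 M').
  have -> : lob M = lob P by [].
  by rewrite -kap_lam_hcomp // (@vcancel _ _ _ _ (Uo (lob P) ⊙0 (P ⊙0 M'))) ?kapVK'; bd.
have L := lamN s; have S : larr s = ida (lob M) by [].
have [e3 e4] : top s = M ⊙0 P' /\ bot s = P ⊙0 M' by [].
rewrite S Ua_ida e3 e4 in L. rewrite L.
rewrite -!vcompA; [|bd..]. rewrite kapV_rho // ; ra.
rewrite -(vcompA (x := lamV M ⊙ _)); [|bd..].
by rewrite lamV_kap // (@vcancel _ (lamV (M ⊙0 P')) _ _ (M ⊙0 P')) ?lamVK' //; bd.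
Qed.

Lemma comp_cell_rho M P P' M' s : rob M = lob P' -> rob P = lob M' ->
  is_proarrow_disk s (M ⊙0 P') (P ⊙0 M') ->
  comp_cell M P' (Uo (rob P')) P M' (Uo (rob P)) M' s (rho M' · lamV M') · (rho P ⊙ ids M') =
  (ids M ⊙ rho P') · s.
Proof.
move=> e1 e2 [H1 H2 ? ?].
have {H1} ? : larr s = ida (lob M) by rewrite H1; bd.
have {H2} ? : rarr s = ida (rob P') by rewrite H2; bd.
have ? : rob M' = rob P' by have := tgt_rarr s;
  rewrite (_ : rarr s = ida (rob P')) // (_ : bot s = P ⊙0 M') // tgt_ida robh.
rewrite /comp_cell ids_hcomps_vcomp; [|bd..]. ra.
rewrite lamV_kapV_rho //; rids.
have -> : rob P' = rob M' by [].
rewrite kap_rho_hcomp //.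
have L := rhoN s; have S : rarr s = ida (rob P') by [].
have [e3 e4] : top s = M ⊙0 P' /\ bot s = P ⊙0 M' by [].
rewrite S Ua_ida e3 e4 in L. have -> : rob M' = rob P' by []. rewrite L.
by rewrite -kap_rho_hcomp // -vcompA;
  [rewrite (@vcancel _ _ _ _ (M ⊙0 (P' ⊙0 Uo (rob P')))) ?kapVK'|..]; bd.
Qed.
End UnitCoherence.

Lemma lamVN (D : dblcat) (x : sq D) :
  x · lamV (bot x) = lamV (top x) · (Ua (larr x) ⊙ x).
Proof.
apply: (vcancel_r (a := lam (bot x)) (b := lamV (bot x))); [rewrite lamK'; bd|bd|bd|bd|].
by ra; rewrite lamN lamVK' (@vcancel _ _ _ _ (top x)) ?lamVK'; rids; bd.
Qed.

Section Horizontal.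
Variables (C D : dblcat).

Definition htrans_id (F : sfun C D) : htrans C D.
Proof.
exists F F (fun A => Uo (sfo F A)) (fun f => Ua (sfa F f))
  (fun M => rho (sfp F M) · lamV (sfp F M)).
- by move=> A; split; bd.
- by move=> f; split; bd.
- by move=> M; split; bd.
- by move=> A; bd; rewrite Ua_ida.
- by move=> f g h; rewrite sfa_acomp // Ua_acomp; bd.
- by move=> A; bd; rewrite rhoU lamU rhoVU lamVU.
- move=> M N e; rewrite sfp_hcomp // -oplax_cell_Uo; [|bd].
  by rewrite /oplax_cell; bd; rewrite -e.
- move=> x; rewrite -rarr_sfs -larr_sfs -bot_sfs -top_sfs.
  by rewrite -vcompA ?rhoN ?vcompA ?lamVN; bd.
Defined.

Definition htrans_comp (c d : htrans C D) (h : htgt c = hsrc d) : htrans C D.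
Proof.
exists (hsrc c) (htgt d) (fun A => hob c A ⊙0 hob d A) (fun f => harr c f ⊙ harr d f)
  (fun M => comp_cell (sfp (hsrc c) M) (hob c (rob M)) (hob d (rob M))
     (hob c (lob M)) (sfp (htgt c) M) (hob d (lob M)) (sfp (htgt d) M) (hpro c M) (hpro d M)).
- by move=> A; split; bd.
- by move=> f; split; bd.
- by move=> M; rewrite /comp_cell; split; bd.
- by move=> A; rewrite !harr_id ids_hcomps; bd.
- by move=> f g e; rewrite !harr_comp // exchange; bd.
- move=> A. rewrite !hpro_U; bd.
  rewrite -comp_cell_Uo; bd.
- move=> M N e. rewrite !hpro_hcomp // h.
  rewrite !sfp_hcomp // robh // lobh e.
  have := @comp_cell_oplax_cell D (sfp (hsrc c) M) (sfp (hsrc c) N)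
    (sfp (htgt c) M) (sfp (htgt c) N)
    (sfp (htgt d) M) (sfp (htgt d) N) (hob c (lob M)) (hob c (rob M)) (hob c (rob N))
    (hob d (lob M)) (hob d (rob M)) (hob d (rob N)) (hpro c M) (hpro c N) (hpro d M) (hpro d N).
  rewrite -e h; apply; split; bd.
- move=> x.
  have := @comp_cell_nat D (sfs (hsrc c) x) (harr c (rarr x)) (harr d (rarr x))
   (sfs (htgt c) x) (harr c (larr x)) (harr d (larr x)) (sfs (htgt d) x)
   (hpro c (top x)) (hpro d (top x)) (hpro c (bot x)) (hpro d (bot x)).
  rewrite ?bdE2 => ->; rewrite ?h_nat ?h //; try (split; bd).
  exact: h_nat.
Defined.
End Horizontal.

(** * Modifications: coherators, inverses and composites *)

Section Modifications.
Variables (C D : dblcat).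

(** Modifications with identity arrow-dimension sides. The disks in the first axiom are then unit
    squares and act trivially, so ≅ becomes a plain equation. The coherators and the interchangers
    χ(γ, δ) are all built this way. *)
Definition modif_glob (c d : htrans C D) (w : ob C -> sq D)
  (hs : hsrc c = hsrc d) (ht : htgt c = htgt d)
  (w_sq : forall A, is_sq (w A) (ida (sfo (hsrc c) A)) (ida (sfo (htgt c) A)) (hob c A) (hob d A))
  (w_arr : forall f, harr c f · w (tgt f) = w (src f) · harr d f)
  (w_pro : forall M, hpro c M · (w (lob M) ⊙ ids (sfp (htgt c) M)) =
                     (ids (sfp (hsrc c) M) ⊙ w (rob M)) · hpro d M) : modif C D.
Proof.
exists (vtrans_id (hsrc c)) (vtrans_id (htgt c)) c d w => //.
move=> f /=; move: (w_sq (tgt f)) (w_sq (src f)) (w_arr f).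
move: (w (tgt f)) (w (src f)) => x y [? ? ? ?] [? ? ? ?] e.
rewrite congE; [|bd..].
by rewrite ractU ?lactU; bd.
Defined.

Definition modif_id (c : htrans C D) : modif C D.
Proof.
apply: (@modif_glob c c (fun A => ids (hob c A)) erefl erefl).
- by move=> A; split; bd.
- by move=> f; rids.
- by move=> M; rewrite !ids_hcomps; [rids|bd..].
Defined.

Definition modif_lam (c : htrans C D) (h : htgt (htrans_id (hsrc c)) = hsrc c) : modif C D.
Proof.
apply: (@modif_glob (htrans_comp h) c (fun A => lam (hob c A)) erefl erefl).
- by move=> A; split; bd.
- by move=> f /=; have := lamN (harr c f); rewrite ?bdE2.
- move=> M /=; have := @comp_cell_lam D (sfp (hsrc c) M) (hob c (lob M)) (hob c (rob M))
    (sfp (htgt c) M) (hpro c M).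
  by rewrite ?bdE2; apply; [| |exact: hpro_sq].
Defined.

Definition modif_rho (c : htrans C D) (h : htgt c = hsrc (htrans_id (htgt c))) : modif C D.
Proof.
apply: (@modif_glob (htrans_comp h) c (fun A => rho (hob c A)) erefl erefl).
- by move=> A; split; bd.
- by move=> f /=; have := rhoN (harr c f); rewrite ?bdE2.
- move=> M /=; have := @comp_cell_rho D (sfp (hsrc c) M) (hob c (lob M)) (hob c (rob M))
    (sfp (htgt c) M) (hpro c M).
  by rewrite ?bdE2; apply; [| |exact: hpro_sq].
Defined.

Definition modif_kap (c d e : htrans C D) (h1 : htgt c = hsrc d) (h2 : htgt d = hsrc e)
  (h3 : htgt (htrans_comp h1) = hsrc e) (h4 : htgt c = hsrc (htrans_comp h2)) : modif C D.
Proof.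
apply: (@modif_glob (htrans_comp h3) (htrans_comp h4)
  (fun A => kap (hob c A) (hob d A) (hob e A)) erefl erefl).
- by move=> A /=; split; bd.
- by move=> f /=; have := @kapN _ (harr c f) (harr d f) (harr e f); rewrite ?bdE2 h1 h2; apply.
- move=> M /=; have := @comp_cell_assoc D (sfp (hsrc c) M) (sfp (htgt c) M)
    (sfp (htgt d) M) (sfp (htgt e) M)
   (hob c (lob M)) (hob c (rob M)) (hob d (lob M)) (hob d (rob M)) (hob e (lob M)) (hob e (rob M))
   (hpro c M) (hpro d M) (hpro e M).
  by rewrite h1 h2; apply; split; bd.
Defined.
End Modifications.

Lemma conjugate_inv (D : dblcat) (x y w1 w2 v1 v2 : sq D) :
  x · w1 = w2 · y -> bot x = top w1 -> bot w2 = top y ->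
  w1 · v1 = ids (bot x) -> bot w1 = top v1 ->
  v2 · w2 = ids (top y) -> bot v2 = top w2 ->
  y · v1 = v2 · x.
Proof.
move=> E h1 h2 e1 h3 e2 h4.
have ? : top x = top w2 by move: (congr1 (@top D) E); bd.
have ? : bot y = bot w1 by move: (congr1 (@bot D) E); bd.
rewrite -[y](@ids_vcomp _ _ _ (erefl (top y))) -e2; ra.
rewrite -(vcompA (x := w2)) -?E; [|bd..].
by ra; rewrite e1; rids.
Qed.

(** The first axiom of a horizontal composite of modifications: the shared disk [d] leaves [x],
    crosses the seam by balancedness and acts on [y']. *)
Lemma ract_beside (D : dblcat) (x y x' y' d d' d'' : sq D) :
  isdisk d -> isdisk d' -> isdisk d'' ->
  rarr x = larr d -> rarr d = larr y' -> larr x' = rarr d'' -> larr d' = rarr y ->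
  rarr x' = larr y' -> rarr x = larr y ->
  x ◃ d = d'' ▹ x' -> y ◃ d' = d ▹ y' -> (x ⊙ y) ◃ d' = d'' ▹ (x' ⊙ y').
Proof.
move=> Hd Hd' Hd'' h1 h2 h3 h4 h5 h6 E1 E2.
by rewrite ract_hcomp // E2 -ract_lact // E1 lact_hcomp.
Qed.

Ltac modif_boundary m := have ? := m_tl m; have ? := m_tr m; have ? := m_bl m; have ? := m_br m.

Section Modifications.
Variables (C D : dblcat).

Lemma modif_inv_src (m : modif C D) : ml m = vtrans_id (hsrc (mt m)) ->
  hsrc (mb m) = hsrc (mt m).
Proof. by move=> hl; rewrite -m_bl hl. Qed.
Lemma modif_inv_tgt (m : modif C D) : mr m = vtrans_id (htgt (mt m)) ->
  htgt (mb m) = htgt (mt m).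
Proof. by move=> hr; rewrite -m_br hr. Qed.

(** A componentwise inverse inherits both axioms from [m] by conjugation, so the inverse coherators
    require no new coherence computation. *)
Definition modif_inv (m : modif C D) (v : ob C -> sq D)
  (hl : ml m = vtrans_id (hsrc (mt m))) (hr : mr m = vtrans_id (htgt (mt m)))
  (v_sq : forall A, is_sq (v A) (ida (sfo (hsrc (mt m)) A)) (ida (sfo (htgt (mt m)) A))
    (hob (mb m) A) (hob (mt m) A))
  (mv : forall A, mob m A · v A = ids (hob (mt m) A))
  (vm : forall A, v A · mob m A = ids (hob (mb m) A)) : modif C D.
Proof.
apply: (@modif_glob C D (mb m) (mt m) v (modif_inv_src hl) (modif_inv_tgt hr)).
- by move=> A; rewrite (modif_inv_src hl) (modif_inv_tgt hr).
- have hs := modif_inv_src hl; have ht := modif_inv_tgt hr.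
  move=> f; have [? ? ? ?] := v_sq (tgt f); have [? ? ? ?] := v_sq (src f).
  have := m_arrA m f; rewrite hl hr ractU ?lactU; last first.
  + by rewrite rarr_vcomp ?rarr_mob ?hr ?bdE2 /=; bd.
  + by rewrite larr_vcomp ?larr_mob ?hl ?bdE2 /=; bd.
  by move=> e; apply: (conjugate_inv e); [bd|bd|rewrite mv; bd|bd|rewrite vm; bd|bd].
- have hs := modif_inv_src hl; have ht := modif_inv_tgt hr.
  move=> M; have := m_pro m M; rewrite hl hr /= hs ht.
  have := mob_sq m (lob M); have := mob_sq m (rob M); rewrite hl hr /=.
  move: (v_sq (lob M)) (v_sq (rob M)) (mv (lob M)) (vm (rob M)).
  move: (mob m (lob M)) (v (lob M)) (mob m (rob M)) (v (rob M)) => w1 v1 w2 v2.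
  move=> [? ? ? ?] [? ? ? ?] ewv evw [? ? ? ?] [? ? ? ?] e.
  apply: (conjugate_inv e); [bd|bd| |bd| |bd].
  + by rewrite -exchange; [rewrite ewv; rids; bd|bd..].
  + by rewrite -exchange; [rewrite evw; rids; rewrite -?hs; bd|bd..].
Defined.

Definition modif_lamV (c : htrans C D) (h : htgt (htrans_id (hsrc c)) = hsrc c) : modif C D.
Proof.
apply: (@modif_inv (modif_lam h) (fun A => lamV (hob c A)) erefl erefl).
- by move=> A; split; rewrite /=; bd.
- by move=> A; rewrite /= lamK'; bd.
- by move=> A; rewrite /= lamVK'.
Defined.

Definition modif_rhoV (c : htrans C D) (h : htgt c = hsrc (htrans_id (htgt c))) : modif C D.
Proof.
apply: (@modif_inv (modif_rho h) (fun A => rhoV (hob c A)) erefl erefl).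
- by move=> A; split; rewrite /=; bd.
- by move=> A; rewrite /= rhoK'; bd.
- by move=> A; rewrite /= rhoVK'.
Defined.

Definition modif_kapV (c d e : htrans C D) (h1 : htgt c = hsrc d) (h2 : htgt d = hsrc e)
  (h3 : htgt (htrans_comp h1) = hsrc e) (h4 : htgt c = hsrc (htrans_comp h2)) : modif C D.
Proof.
apply: (@modif_inv (modif_kap h3 h4) (fun A => kapV (hob c A) (hob d A) (hob e A)) erefl erefl).
- by move=> A; split; rewrite /=; bd.
- by move=> A; rewrite /= kapK'; bd.
- by move=> A; rewrite /= kapVK'; bd.
Defined.

Definition modif_comp (m n : modif C D) (h : mb m = mt n)
  (hl : vtgt (ml m) = vsrc (ml n)) (hr : vtgt (mr m) = vsrc (mr n)) : modif C D.
Proof.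
exists (vtrans_comp hl) (vtrans_comp hr) (mt m) (mb n) (fun A => mob m A · mob n A).
- exact: m_tl. - exact: m_tr. - exact: m_bl. - exact: m_br.
- by modif_boundary m; modif_boundary n; move=> A; split; rewrite /=; bd.
- modif_boundary m; modif_boundary n; move=> f; rewrite congE; [|rewrite /=; bd..].
  have := @ract_stack D (harr (mt m) f) (mob m (tgt f)) (mob n (tgt f))
    (harr (mb m) f) (mob m (src f)) (mob n (src f)) (harr (mb n) f)
   (varr (mr m) f) (varr (ml m) f) (varr (mr n) f) (varr (ml n) f).
   have := m_arrA n f; rewrite -h => e.
  move/(_ _ _ _ _ _ _ _ _ (m_arrA m f) e); rewrite ?bdE2 /=; apply;
    try exact: isdisk_varr; split; rewrite /=; bd.
- modif_boundary m; modif_boundary n; move=> M /=.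
  have := m_pro n M; have := m_pro m M; rewrite -h => E1 E2.
  rewrite exchange; [|bd..]. rewrite -vcompA; [|bd..]. rewrite E1 vcompA; [|bd..].
  by rewrite E2 -vcompA; [rewrite -exchange; bd|bd..].
Defined.

Definition modif_U (a : vtrans C D) : modif C D.
Proof.
exists a a (htrans_id (vsrc a)) (htrans_id (vtgt a)) (fun A => Ua (vob a A)) => //.
- by move=> A; split; rewrite /=; bd.
- move=> f /=; rewrite congE; [|bd..].
  rewrite -!Ua_acomp; [|bd..].
  by rewrite ract_disk ?lact_disk; [|dsk..|bd|dsk|dsk|bd];
    have := disk_Ua (isdisk_varr a f); have := Ua_disk (isdisk_varr a f); rewrite ?bdE2 => -> ->.
- move=> M /=.
  rewrite -larr_vpro -rarr_vpro -(top_vpro a) -(bot_vpro a).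
  rewrite (vcompA (x := rho _)) -?lamVN; [|bd..].
  by rewrite -vcompA -?rhoN ?vcompA; bd.
Defined.

Definition modif_hcomp (m n : modif C D) (h : mr m = ml n)
  (ht : htgt (mt m) = hsrc (mt n)) (hb : htgt (mb m) = hsrc (mb n)) : modif C D.
Proof.
exists (ml m) (mr n) (htrans_comp ht) (htrans_comp hb) (fun A => mob m A ⊙ mob n A).
- exact: m_tl. - exact: m_tr. - exact: m_bl. - exact: m_br.
- by modif_boundary m; modif_boundary n; move=> A; split; rewrite /=; bd; rewrite ?h; bd.
- modif_boundary m; modif_boundary n; move=> f /=. rewrite congE; [|bd; rewrite ?h; bd..].
  have e : forall A, vob (mr m) A = vob (ml n) A by rewrite h.
  rewrite -!exchange; [|bd..].
  apply: (@ract_beside D _ _ _ _ (varr (mr m) f)); try exact: isdisk_varr; try by bd.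
  - exact: m_arrA.
  - rewrite h; exact: m_arrA.
- modif_boundary m; modif_boundary n; move=> M /=.
  have := @comp_cell_nat D (vpro (ml m) M) (mob m (rob M)) (mob n (rob M))
    (vpro (mr m) M) (mob m (lob M)) (mob n (lob M)) (vpro (mr n) M)
    (hpro (mt m) M) (hpro (mt n) M) (hpro (mb m) M) (hpro (mb n) M).
  rewrite ?bdE2 (m_tl m) (m_tr m) (m_bl m) (m_br m) (m_tr n) (m_br n) => P.
  apply/esym/P; try exact: hpro_sq; rewrite ?h //.
  + by rewrite ht; exact: hpro_sq.
  + by rewrite hb; exact: hpro_sq.
  + by rewrite -h m_pro.
  + by rewrite m_pro.
Defined.
End Modifications.

(** * The hom double categories *)

Lemma functor_eq (O M O' M' : Type) (C : cat O M) (D : cat O' M') (F G : functor C D) :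
  fob F =1 fob G -> fmor F =1 fmor G -> F = G.
Proof.
case: F => f1 f2 f3 f4 f5 f6; case: G => g1 g2 g3 g4 g5 g6 /= /funext e1 /funext e2.
by subst; congr Functor; exact: Prop_irrelevance.
Qed.

Lemma sfun_eq (C D : dblcat) (F G : sfun C D) :
  sfo F =1 sfo G -> sfa F =1 sfa G -> sfp F =1 sfp G -> sfs F =1 sfs G -> F = G.
Proof.
case: F => f1 f2 ? ? ? ? ? ? ? ? ? ? ?; case: G => g1 g2 ? ? ? ? ? ? ? ? ? ? ?.
move=> e1 e2 e3 e4.
have {e2}e1 : f1 = g1 by exact: functor_eq.
have {e3 e4} e2 : f2 = g2 by exact: functor_eq.
by subst; congr SFun; exact: Prop_irrelevance.
Qed.

Section Extensionality.
Variables (C D : dblcat).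

Lemma vtrans_eq (a b : vtrans C D) : vsrc a = vsrc b -> vtgt a = vtgt b ->
  vob a =1 vob b -> vpro a =1 vpro b -> varr a =1 varr b -> a = b.
Proof.
case: a => ? ? ? ? ? ? ? ? ? ? ? ? ?; case: b => ? ? ? ? ? ? ? ? ? ? ? ? ? /= e1 e2.
move=> /funext e3 /funext e4 /funext e5.
by subst; congr VTrans; exact: Prop_irrelevance.
Qed.

Lemma htrans_eq (a b : htrans C D) : hsrc a = hsrc b -> htgt a = htgt b ->
  hob a =1 hob b -> harr a =1 harr b -> hpro a =1 hpro b -> a = b.
Proof.
case: a => ? ? ? ? ? ? ? ? ? ? ? ? ?; case: b => ? ? ? ? ? ? ? ? ? ? ? ? ? /= e1 e2.
move=> /funext e3 /funext e4 /funext e5.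
by subst; congr HTrans; exact: Prop_irrelevance.
Qed.

Lemma modif_eq (m n : modif C D) : ml m = ml n -> mr m = mr n -> mt m = mt n ->
  mb m = mb n -> mob m =1 mob n -> m = n.
Proof.
case: m => ? ? ? ? ? ? ? ? ? ? ? ?; case: n => ? ? ? ? ? ? ? ? ? ? ? ? /= e1 e2 e3 e4.
move=> /funext e5.
by subst; f_equal; exact: Prop_irrelevance.
Qed.

Lemma vtrans_comp_eq (a a' b b' : vtrans C D) (h : vtgt a = vsrc b) (h' : vtgt a' = vsrc b') :
  a = a' -> b = b' -> vtrans_comp h = vtrans_comp h'.
Proof. by move=> e1 e2; subst; rewrite (Prop_irrelevance h h'). Qed.

Lemma htrans_comp_eq (a a' b b' : htrans C D) (h : htgt a = hsrc b) (h' : htgt a' = hsrc b') :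
  a = a' -> b = b' -> htrans_comp h = htrans_comp h'.
Proof. by move=> e1 e2; subst; rewrite (Prop_irrelevance h h'). Qed.

Lemma vtrans_comp_idl F (a : vtrans C D) (h : vtgt (vtrans_id F) = vsrc a) :
  vtrans_comp h = a.
Proof.
have /= e := h; apply: vtrans_eq => //= [A|M|f].
- by bd; rewrite -e.
- by rids.
- rewrite e Ua_ida -Ua_acomp; [|bd]. rids.
  by have := Ua_disk (isdisk_varr a f); rewrite ?bdE2.
Qed.

Lemma vtrans_comp_idr F (a : vtrans C D) (h : vtgt a = vsrc (vtrans_id F)) :
  vtrans_comp h = a.
Proof.
have /= e := h; apply: vtrans_eq => //= [A|M|f].
- by bd; rewrite -e.
- by rewrite -e; rids.
- rewrite -e Ua_ida -Ua_acomp; [|bd]. rids.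
  by have := disk_Ua (isdisk_varr a f); rewrite ?bdE2.
Qed.

Lemma vtrans_compA (a b c : vtrans C D) (h1 : vtgt a = vsrc b) (h2 : vtgt (vtrans_comp h1) = vsrc c)
  (h3 : vtgt b = vsrc c) (h4 : vtgt a = vsrc (vtrans_comp h3)) :
  vtrans_comp h2 = vtrans_comp h4.
Proof.
apply: vtrans_eq => //= [A|M|f].
- by bd.
- by ra.
- rewrite disk_whr; [|dsk|dsk|bd|bd].
  rewrite disk_whl; [|dsk|dsk|bd|bd].
  rewrite disk_hcompsA; [|dsk|dsk|dsk|bd|bd].
  rewrite !Ua_acomp; [|bd..]. by ra.
Qed.

Definition vtrans_cat : cat (sfun C D) (vtrans C D).
Proof.
exists (@vsrc C D) (@vtgt C D) (@vtrans_id C D) (@vtrans_comp C D) => //.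
- by move=> a h; rewrite vtrans_comp_idl.
- by move=> a h; rewrite vtrans_comp_idr.
- by move=> *; exact: vtrans_compA.
Defined.

Lemma mb_mt_l (m n : modif C D) : mb m = mt n -> vtgt (ml m) = vsrc (ml n).
Proof. by move=> h; rewrite m_bl m_tl h. Qed.
Lemma mb_mt_r (m n : modif C D) : mb m = mt n -> vtgt (mr m) = vsrc (mr n).
Proof. by move=> h; rewrite m_br m_tr h. Qed.
Lemma mr_ml_t (m n : modif C D) : mr m = ml n -> htgt (mt m) = hsrc (mt n).
Proof. by move=> h; rewrite -m_tr -m_tl h. Qed.
Lemma mr_ml_b (m n : modif C D) : mr m = ml n -> htgt (mb m) = hsrc (mb n).
Proof. by move=> h; rewrite -m_br -m_bl h. Qed.

Definition modif_vcomp (m n : modif C D) (h : mb m = mt n) : modif C D :=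
  modif_comp h (mb_mt_l h) (mb_mt_r h).

Definition modif_cat : cat (htrans C D) (modif C D).
Proof.
exists (@mt C D) (@mb C D) (@modif_id C D) modif_vcomp => //.
- move=> m h. apply: modif_eq => //=.
  + by rewrite vtrans_comp_idl. + by rewrite vtrans_comp_idl.
  + by move=> A; rids.
- move=> m h. apply: modif_eq => //=.
  + by rewrite vtrans_comp_idr. + by rewrite vtrans_comp_idr.
  + by move=> A; rids.
- move=> m n p h1 h2 h3 h4; apply: modif_eq => //=.
  + exact: vtrans_compA. + exact: vtrans_compA.
  + by move=> A; ra.
Defined.

Definition modif_L : functor modif_cat vtrans_cat.
Proof.
exists (@hsrc C D) (@ml C D) => //=; [exact: m_tl|exact: m_bl|].
by move=> m n h h'; exact: vtrans_comp_eq.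
Defined.

Definition modif_R : functor modif_cat vtrans_cat.
Proof.
exists (@htgt C D) (@mr C D) => //=; [exact: m_tr|exact: m_br|].
by move=> m n h h'; exact: vtrans_comp_eq.
Defined.

Definition modif_Ufun : functor vtrans_cat modif_cat.
Proof.
exists (@htrans_id C D) (@modif_U C D) => //=.
- by move=> F; apply: modif_eq => //= A; rewrite Ua_ida.
- move=> a b h h'; apply: modif_eq => //=; try exact: vtrans_comp_eq.
  by move=> A; rewrite Ua_acomp //; bd.
Defined.

(** The source and target of [htrans_comp] compute to those of its outer factors, so [h'] and [h]
    themselves serve as the composability proofs of the two iterated composites. *)
Definition hom_str : dbl_str (sfun C D) (vtrans C D) (htrans C D) (modif C D) :=
  @DblStr _ _ _ _ vtrans_cat modif_cat modif_L modif_R modif_Ufun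
    (@htrans_comp C D)
    (fun m n h => modif_hcomp h (mr_ml_t h) (mr_ml_b h))
    (fun c => modif_lam (c := c) erefl) (fun c => modif_lamV (c := c) erefl)
    (fun c => modif_rho (c := c) erefl) (fun c => modif_rhoV (c := c) erefl)
    (fun c d e h h' => @modif_kap C D c d e h h' h' h)
    (fun c d e h h' => @modif_kapV C D c d e h h' h' h).

Lemma is_hom_str_hom : is_hom_str hom_str.
Proof. by constructor. Qed.

End Extensionality.

Section HomLaws.
Variables (C D : dblcat).
Let H := DblData (hom_str C D).
Implicit Types (F : ob H) (a b : arr H) (c d e : pro H) (m n p : sq H).

Lemma hom_lam_sq c : is_proarrow_disk (lam c) (Uo (lob c) ⊙0 c) c.
Proof.
rewrite (@hcompE H (Uo (lob c)) c erefl); split; exact: erefl.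
Qed.

Lemma hom_lamV_sq c : is_proarrow_disk (lamV c) c (Uo (lob c) ⊙0 c).
Proof.
rewrite (@hcompE H (Uo (lob c)) c erefl); split; exact: erefl.
Qed.

Lemma hom_rho_sq c : is_proarrow_disk (rho c) (c ⊙0 Uo (rob c)) c.
Proof.
rewrite (@hcompE H c (Uo (rob c)) erefl); split; exact: erefl.
Qed.

Lemma hom_rhoV_sq c : is_proarrow_disk (rhoV c) c (c ⊙0 Uo (rob c)).
Proof.
rewrite (@hcompE H c (Uo (rob c)) erefl); split; exact: erefl.
Qed.

Lemma hom_kap_sq c d e : rob c = lob d -> rob d = lob e ->
  is_proarrow_disk (kap c d e) ((c ⊙0 d) ⊙0 e) (c ⊙0 (d ⊙0 e)).
Proof.
move=> h h'; rewrite (kapE h h') (hcompE h) (hcompE h').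
rewrite (@hcompE H (htrans_comp h) e h') (@hcompE H c (htrans_comp h') h).
by split; exact: erefl.
Qed.

Lemma hom_kapV_sq c d e : rob c = lob d -> rob d = lob e ->
  is_proarrow_disk (kapV c d e) (c ⊙0 (d ⊙0 e)) ((c ⊙0 d) ⊙0 e).
Proof.
move=> h h'; rewrite (kapVE h h') (hcompE h) (hcompE h').
rewrite (@hcompE H (htrans_comp h) e h') (@hcompE H c (htrans_comp h') h).
split.
- exact: (erefl (vtrans_id (hsrc c))).
- exact: (erefl (vtrans_id (htgt e))).
- exact: (erefl (@htrans_comp _ _ c (htrans_comp h') h)).
- exact: (erefl (@htrans_comp _ _ (htrans_comp h) e h')).
Qed.

Lemma hom_interchange m m' n n' :
  rarr m = larr n -> rarr m' = larr n' -> bot m = top m' -> bot n = top n' ->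
  (m · m') ⊙ (n · n') = (m ⊙ n) · (m' ⊙ n').
Proof.
move=> h1 h2 h3 h4; rewrite (vcompE h3) (vcompE h4) (hcompsE h1) (hcompsE h2).
have e1 : rarr (modif_vcomp h3 : sq H) = larr (modif_vcomp h4 : sq H).
  exact: vtrans_comp_eq.
rewrite (@hcompsE H _ _ e1).
have e2 : bot (modif_hcomp h1 (mr_ml_t h1) (mr_ml_b h1) : sq H) =
          top (modif_hcomp h2 (mr_ml_t h2) (mr_ml_b h2) : sq H).
  exact: htrans_comp_eq.
rewrite (@vcompE H _ _ e2).
apply: modif_eq.
- exact: vtrans_comp_eq.
- exact: vtrans_comp_eq.
- exact: htrans_comp_eq.
- exact: htrans_comp_eq.
- move=> A. apply: exchange;
  first [exact: etrans (rarr_mob _ _) (etrans (congr1 (fun z => vob z A) h1) (esym (larr_mob _ _)))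
  |exact: etrans (rarr_mob _ _) (etrans (congr1 (fun z => vob z A) h2) (esym (larr_mob _ _)))
  |exact: etrans (bot_mob _ _) (etrans (congr1 (fun z => hob z A) h3) (esym (top_mob _ _)))
  |exact: etrans (bot_mob _ _) (etrans (congr1 (fun z => hob z A) h4) (esym (top_mob _ _)))].
Qed.

Lemma hom_hcomps_ids c d : rob c = lob d -> ids c ⊙ ids d = ids (c ⊙0 d).
Proof.
move=> h; rewrite (hcompE h) (@hcompsE H (modif_id c) (modif_id d) (congr1 (@vtrans_id C D) h)).
apply: modif_eq.
- exact: (erefl (vtrans_id (hsrc c))).
- exact: (erefl (vtrans_id (htgt d))).
- exact: htrans_comp_eq.
- exact: htrans_comp_eq.
- move=> A; apply: ids_hcomps; rewrite rob_hob lob_hob. exact: (congr1 (fun z => sfo z A) h).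
Qed.

(** Used for all the invertibility laws of coherators: their sides are identity transformations,
    which compose to identities, and only the components remain. *)
Lemma hom_inv (m n : sq H) (e : bot m = top n) :
  ml m = vtrans_id (hsrc (mt m)) -> mr m = vtrans_id (htgt (mt m)) ->
  ml n = vtrans_id (hsrc (mt m)) -> mr n = vtrans_id (htgt (mt m)) -> mt m = mb n ->
  (forall A, mob m A · mob n A = ids (hob (mt m) A)) -> m · n = ids (top m).
Proof.
move=> e1 e2 e3 e4 e5 e6; rewrite (vcompE e); apply: modif_eq => //.
- by rewrite -[RHS]/(vtrans_id (hsrc (mt m))) -[LHS]/(vtrans_comp (mb_mt_l e)) -[RHS]e3;
    move: (mb_mt_l e); rewrite e1 => h; rewrite vtrans_comp_idl.
- by rewrite -[RHS]/(vtrans_id (htgt (mt m))) -[LHS]/(vtrans_comp (mb_mt_r e)) -[RHS]e4;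
    move: (mb_mt_r e); rewrite e2 => h; rewrite vtrans_comp_idl.
Qed.

Lemma hom_lamK c : lam c · lamV c = ids (Uo (lob c) ⊙0 c).
Proof.
rewrite (@hcompE H (Uo (lob c)) c erefl).
apply: (@hom_inv (lam c) (lamV c)); try exact: erefl.
by move=> A; rewrite /= lamK' lob_hob.
Qed.

Lemma hom_lamVK c : lamV c · lam c = ids c.
Proof.
apply: (@hom_inv (lamV c) (lam c)); try exact: erefl.
by move=> A; rewrite /= lamVK'.
Qed.

Lemma hom_rhoK c : rho c · rhoV c = ids (c ⊙0 Uo (rob c)).
Proof.
rewrite (@hcompE H c (Uo (rob c)) erefl).
apply: (@hom_inv (rho c) (rhoV c)); try exact: erefl.
by move=> A; rewrite /= rhoK' rob_hob.
Qed.

Lemma hom_rhoVK c : rhoV c · rho c = ids c.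
Proof.
apply: (@hom_inv (rhoV c) (rho c)); try exact: erefl.
by move=> A; rewrite /= rhoVK'.
Qed.

Section Kap.
Variables (c d e : pro H) (h : rob c = lob d) (h' : rob d = lob e).

Lemma hom_rl A : rob (hob c A) = lob (hob d A) /\ rob (hob d A) = lob (hob e A).
Proof.
rewrite !rob_hob !lob_hob; split.
- exact: (congr1 (fun z => sfo z A) h).
- exact: (congr1 (fun z => sfo z A) h').
Qed.

Lemma hom_kapK : kap c d e · kapV c d e = ids ((c ⊙0 d) ⊙0 e).
Proof.
rewrite (kapE h h') (kapVE h h') (hcompE h) (@hcompE H (htrans_comp h) e h').
apply: (@hom_inv (@modif_kap C D c d e h h' h' h)
  (@modif_kapV C D c d e h h' h' h)); try exact: erefl.
by move=> A; rewrite /= kapK'; case: (hom_rl A).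
Qed.

Lemma hom_kapVK : kapV c d e · kap c d e = ids (c ⊙0 (d ⊙0 e)).
Proof.
rewrite (kapE h h') (kapVE h h') (hcompE h') (@hcompE H c (htrans_comp h') h).
apply: (@hom_inv (@modif_kapV C D c d e h h' h' h)
  (@modif_kap C D c d e h h' h' h)); try exact: erefl.
by move=> A; rewrite /= kapVK'; case: (hom_rl A).
Qed.
End Kap.

Lemma hom_lam_nat m : (Ua (larr m) ⊙ m) · lam (bot m) = lam (top m) · m.
Proof.
rewrite (@hcompsE H (Ua (larr m)) m erefl).
have e1 : bot (@Dhcs _ _ _ _ (hom_str C D) (Ua (larr m)) m erefl : sq H) = top (lam (bot m)).
  by apply: htrans_comp_eq => //; congr htrans_id; exact: m_bl.
have e2 : bot (lam (top m)) = top m by [].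
rewrite (@vcompE H _ _ e1) (@vcompE H _ _ e2); apply: modif_eq.
- exact: etrans (vtrans_comp_idr _) (esym (vtrans_comp_idl _)).
- exact: etrans (vtrans_comp_idr _) (esym (vtrans_comp_idl _)).
- by apply: htrans_comp_eq => //; congr htrans_id; exact: m_tl.
- by [].
- by move=> A; rewrite /= -larr_mob -bot_mob -top_mob lamN.
Qed.

Lemma hom_rho_nat m : (m ⊙ Ua (rarr m)) · rho (bot m) = rho (top m) · m.
Proof.
rewrite (@hcompsE H m (Ua (rarr m)) erefl).
have e1 : bot (@Dhcs _ _ _ _ (hom_str C D) m (Ua (rarr m)) erefl : sq H) = top (rho (bot m)).
  by apply: htrans_comp_eq => //; congr htrans_id; exact: m_br.
have e2 : bot (rho (top m)) = top m by [].
rewrite (@vcompE H _ _ e1) (@vcompE H _ _ e2); apply: modif_eq.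
- exact: etrans (vtrans_comp_idr _) (esym (vtrans_comp_idl _)).
- exact: etrans (vtrans_comp_idr _) (esym (vtrans_comp_idl _)).
- by apply: htrans_comp_eq => //; congr htrans_id; exact: m_tr.
- by [].
- by move=> A; rewrite /= -rarr_mob -bot_mob -top_mob rhoN.
Qed.

Lemma hom_mrl m n : rarr m = larr n -> forall A, rarr (mob m A) = larr (mob n A).
Proof.
by move=> h A; rewrite rarr_mob larr_mob; exact: (congr1 (fun z => vob z A) h).
Qed.

Lemma hom_kap_nat m n p : rarr m = larr n -> rarr n = larr p ->
  ((m ⊙ n) ⊙ p) · kap (bot m) (bot n) (bot p) =
  kap (top m) (top n) (top p) · (m ⊙ (n ⊙ p)).
Proof.
move=> h1 h2; rewrite (@kapE H (bot m) (bot n) (bot p) (mr_ml_b h1) (mr_ml_b h2))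
  (@kapE H (top m) (top n) (top p) (mr_ml_t h1) (mr_ml_t h2)).
rewrite (hcompsE h1) (hcompsE h2).
rewrite (@hcompsE H (modif_hcomp h1 (mr_ml_t h1) (mr_ml_b h1)) p h2).
rewrite (@hcompsE H m (modif_hcomp h2 (mr_ml_t h2) (mr_ml_b h2)) h1).
set x := Dhcs _; set y := Dkap _ _.
have e1 : bot (x : sq H) = top (y : sq H).
  by apply: htrans_comp_eq => //; exact: htrans_comp_eq.
set z := Dkap _ _; set w := Dhcs _.
have e2 : bot (z : sq H) = top (w : sq H).
  by apply: htrans_comp_eq => //; exact: htrans_comp_eq.
rewrite (@vcompE H _ _ e1) (@vcompE H _ _ e2); apply: modif_eq.
- exact: etrans (vtrans_comp_idr _) (esym (vtrans_comp_idl _)).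
- exact: etrans (vtrans_comp_idr _) (esym (vtrans_comp_idl _)).
- by apply: htrans_comp_eq => //; exact: htrans_comp_eq.
- by apply: htrans_comp_eq => //; exact: htrans_comp_eq.
- move=> A; rewrite /= -!bot_mob -!top_mob; apply: kapN; exact: hom_mrl.
Qed.

(** On objects and arrows the composite collapses by preunitarity of [D]. For the proarrow
    components, [comp_cell_lam] is applied to the identity transformation itself, where [lam] of a
    unit is an identity. *)
Lemma hom_preunit_htrans (F : sfun C D) :
  @htrans_comp _ _ (htrans_id F) (htrans_id F) erefl = htrans_id F.
Proof.
apply: htrans_eq => //=.
- by move=> A; rewrite Uo_hcomp.
- by move=> f; rewrite Ua_hcomps.
- move=> M.
  have := @comp_cell_lam D (sfp F M) (Uo (sfo F (lob M))) (Uo (sfo F (rob M))) (sfp F M)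
    (rho (sfp F M) · lamV (sfp F M)).
  rewrite !lamU !ids_hcomps ?lob_sfp ?rob_sfp ?lobUo ?robUo // => P.
  move: (P erefl erefl); rewrite vcomp_ids ?ids_vcomp; [|bd..|rewrite /comp_cell; bd].
  by apply; split; bd.
Qed.

Lemma hom_preunit_hcomp F : Uo F ⊙0 Uo F = Uo F.
Proof.
rewrite (@hcompE H (Uo F) (Uo F) erefl); exact: hom_preunit_htrans.
Qed.

Lemma hom_preunit_lam F : lam (Uo F) = ids (Uo F).
Proof.
have e := hom_preunit_htrans F.
apply: modif_eq.
- exact: (erefl (vtrans_id F)).
- exact: (erefl (vtrans_id F)).
- change (@htrans_comp _ _ (htrans_id F) (htrans_id F) erefl = htrans_id F); exact: e.
- exact: (erefl (htrans_id F)).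
- by move=> A; rewrite /= lamU.
Qed.

Lemma hom_preunit_rho F : rho (Uo F) = ids (Uo F).
Proof.
have e := hom_preunit_htrans F.
apply: modif_eq.
- exact: (erefl (vtrans_id F)).
- exact: (erefl (vtrans_id F)).
- change (@htrans_comp _ _ (htrans_id F) (htrans_id F) erefl = htrans_id F); exact: e.
- exact: (erefl (htrans_id F)).
- by move=> A; rewrite /= rhoU.
Qed.

Lemma hom_triangle c d : rob c = lob d ->
    kap c (Uo (rob c)) d · (ids c ⊙ lam d) = rho c ⊙ ids d.
Proof.
move=> h; have e : rarr (ids c) = larr (lam d) := congr1 (@vtrans_id C D) h.
have e' : rarr (rho c) = larr (ids d) := congr1 (@vtrans_id C D) h.
rewrite (@kapE H c (Uo (rob c)) d erefl h) (hcompsE e) (hcompsE e').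
set x := Dkap _ _; set y := Dhcs _.
have e1 : bot (x : sq H) = top (y : sq H).
  by apply: htrans_comp_eq => //; apply: htrans_comp_eq => //; congr htrans_id.
rewrite (@vcompE H _ _ e1); apply: modif_eq.
- exact: vtrans_comp_idl.
- by apply: etrans (vtrans_comp_idl _) _; congr vtrans_id.
- by apply: htrans_comp_eq => //; exact: htrans_comp_eq.
- exact: htrans_comp_eq.
- move=> A /=; rewrite -triangle_kap; last first.
    by rewrite rob_hob lob_hob; exact: (congr1 (fun z => sfo z A) h).
  by rewrite rob_hob.
Qed.

(** Globular modifications are closed under both compositions and determined by top, bottom and
    components. This spares the pentagon a comparison of iterated composites of identity side
    transformations. *)
Definition glob (m : modif C D) : Prop :=
  ml m = vtrans_id (hsrc (mt m)) /\ mr m = vtrans_id (htgt (mt m)).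

Lemma glob_eq (m n : modif C D) : glob m -> glob n -> mt m = mt n -> mb m = mb n ->
  mob m =1 mob n -> m = n.
Proof.
move=> [e1 e2] [e3 e4] e5 e6; apply: modif_eq => //.
- by rewrite e1 e3 e5.
- by rewrite e2 e4 e5.
Qed.

Lemma glob_vcomp (m n : modif C D) (e : mb m = mt n) : glob m -> glob n ->
  glob (modif_vcomp e).
Proof.
move=> [e1 e2] [e3 e4]; split; rewrite /=.
- move: (mb_mt_l e); rewrite e1 => h; rewrite vtrans_comp_idl e3; move: h; rewrite e3 /= => ->.
  done.
- move: (mb_mt_r e); rewrite e2 => h; rewrite vtrans_comp_idl e4; move: h; rewrite e4 /= => ->.
  done.
Qed.

Lemma glob_hcomp (m n : modif C D) (e : mr m = ml n) h h' : glob m -> glob n ->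
  glob (@modif_hcomp _ _ m n e h h').
Proof. by move=> [e1 e2] [e3 e4]; split; rewrite /= ?e1 ?e4. Qed.

Lemma glob_kap (c d e : htrans C D) (h1 : htgt c = hsrc d) (h2 : htgt d = hsrc e)
  (h3 : htgt (htrans_comp h1) = hsrc e) (h4 : htgt c = hsrc (htrans_comp h2)) :
  glob (modif_kap h3 h4).
Proof. by split; rewrite /=. Qed.

Lemma glob_id (c : htrans C D) : glob (modif_id c).
Proof. by split; rewrite /=. Qed.

Lemma hom_pentagon c d e f : rob c = lob d -> rob d = lob e -> rob e = lob f ->
    kap (c ⊙0 d) e f · kap c d (e ⊙0 f) =
    (kap c d e ⊙ ids f) · kap c (d ⊙0 e) f · (ids c ⊙ kap d e f).
Proof.
move=> h1 h2 h3.
rewrite (hcompE h1) (hcompE h2) (hcompE h3) (kapE h1 h2) (kapE h2 h3).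
rewrite (@kapE H (htrans_comp h1) e f h2 h3) (@kapE H c d (htrans_comp h3) h1 h2).
rewrite (@kapE H c (htrans_comp h2) f h1 h3).
set x := @Dkap _ _ _ _ _ (htrans_comp h1) _ _ _ _.
set y := @Dkap _ _ _ _ _ c d (htrans_comp h3) _ _.
have e1 : bot (x : sq H) = top (y : sq H) by apply: htrans_comp_eq => //; exact: htrans_comp_eq.
set u := @Dkap _ _ _ _ _ c d e _ _.
set v := @Dkap _ _ _ _ _ d e f _ _.
set w := @Dkap _ _ _ _ _ c (htrans_comp h2) f _ _.
have e2 : rarr (u : sq H) = larr (ids f : sq H) := congr1 (@vtrans_id C D) h3.
have e3 : rarr (ids c : sq H) = larr (v : sq H) := congr1 (@vtrans_id C D) h1.
rewrite (@vcompE H _ _ e1) (@hcompsE H _ _ e2) (@hcompsE H _ _ e3).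
set p := Dhcs _; set q := Dhcs _.
have e4 : bot (p : sq H) = top (w : sq H) by apply: htrans_comp_eq => //; exact: htrans_comp_eq.
rewrite (@vcompE H _ _ e4).
have e5 : bot (modif_vcomp e4 : sq H) = top (q : sq H).
  by apply: htrans_comp_eq => //; exact: htrans_comp_eq.
rewrite (@vcompE H _ _ e5).
have gx : glob x := glob_kap _ _.
have gy : glob y := glob_kap _ _.
have gu : glob u := glob_kap _ _.
have gv : glob v := glob_kap _ _.
have gw : glob w := glob_kap _ _.
have gc : glob (ids c : sq H) := glob_id c.
have gf : glob (ids f : sq H) := glob_id f.
have gp : glob p := @glob_hcomp u (ids f) e2 (mr_ml_t e2) (mr_ml_b e2) gu gf.
have gq : glob q := @glob_hcomp (ids c) v e3 (mr_ml_t e3) (mr_ml_b e3) gc gv.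
have g1 := @glob_vcomp x y e1 gx gy.
have g4 := @glob_vcomp p w e4 gp gw.
have g5 := @glob_vcomp (modif_vcomp e4) q e5 g4 gq.
apply: (glob_eq g1 g5).
- by apply: htrans_comp_eq => //; exact: htrans_comp_eq.
- by apply: htrans_comp_eq => //; exact: htrans_comp_eq.
- move=> A /=; apply: (pentagon (dblcatP D)); rewrite rob_hob lob_hob.
  + exact: (congr1 (fun z => sfo z A) h1).
  + exact: (congr1 (fun z => sfo z A) h2).
  + exact: (congr1 (fun z => sfo z A) h3).
Qed.

Lemma hom_laws : dbl_laws H.
Proof.
constructor.
- by [].
- by [].
- by [].
- by [].
- by move=> c d h; rewrite (hcompE h).
- by move=> c d h; rewrite (hcompE h).
- by move=> m n h; rewrite (hcompsE h).
- by move=> m n h; rewrite (hcompsE h).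
- by move=> m n h; rewrite (hcompsE h) (@hcompE H (top m) (top n) (mr_ml_t h)).
- by move=> m n h; rewrite (hcompsE h) (@hcompE H (bot m) (bot n) (mr_ml_b h)).
- exact: hom_hcomps_ids.
- exact: hom_interchange.
- exact: hom_lam_sq.
- exact: hom_lamV_sq.
- exact: hom_lamK.
- exact: hom_lamVK.
- exact: hom_lam_nat.
- exact: hom_rho_sq.
- exact: hom_rhoV_sq.
- exact: hom_rhoK.
- exact: hom_rhoVK.
- exact: hom_rho_nat.
- exact: hom_kap_sq.
- exact: hom_kapV_sq.
- exact: hom_kapK.
- exact: hom_kapVK.
- exact: hom_kap_nat.
- exact: hom_pentagon.
- exact: hom_triangle.
- exact: hom_preunit_hcomp.
- exact: hom_preunit_lam.
- exact: hom_preunit_rho.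
Qed.

End HomLaws.

Definition hom (C D : dblcat) : dblcat := DblCat (hom_laws C D).

(** * Whiskering *)

Section LeftWhisker.
Variables (A' A B : dblcat) (a : sfun A' A).

(** Left whiskering evaluates [x] at the images of cells under [a], so each axiom is an instance of
    the axiom of [x]. Right whiskering, further on, instead applies a strict functor to the
    components and axioms of [x]. *)
Definition vtrans_precomp (x : vtrans A B) : vtrans A' B.
Proof.
exists (sfun_comp a (vsrc x)) (sfun_comp a (vtgt x)) (fun X => vob x (sfo a X))
  (fun M => vpro x (sfp a M)) (fun f => varr x (sfa a f)).
- by move=> X; exact: vob_arr.
- by move=> M; have := vpro_sq x (sfp a M); rewrite lob_sfp rob_sfp.
- by move=> f; have := varr_sq x (sfa a f); rewrite src_sfa tgt_sfa.
- by move=> X; rewrite sfp_Uo vpro_U.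
- by move=> M N h; rewrite sfp_hcomp // vpro_hcomp //; bd.
- by move=> X; rewrite sfa_ida varr_id.
- by move=> f f' h; rewrite sfa_acomp // varr_comp //; bd.
- by move=> y; have := v_nat x (sfs a y); rewrite top_sfs bot_sfs larr_sfs rarr_sfs.
Defined.

Definition htrans_precomp (x : htrans A B) : htrans A' B.
Proof.
exists (sfun_comp a (hsrc x)) (sfun_comp a (htgt x)) (fun X => hob x (sfo a X))
  (fun f => harr x (sfa a f)) (fun M => hpro x (sfp a M)).
- by move=> X; exact: hob_pro.
- by move=> f; have := harr_sq x (sfa a f); rewrite src_sfa tgt_sfa.
- by move=> M; have := hpro_sq x (sfp a M); rewrite lob_sfp rob_sfp.
- by move=> X; rewrite sfa_ida harr_id.
- by move=> f f' h; rewrite sfa_acomp // harr_comp //; bd.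
- by move=> X; rewrite sfp_Uo hpro_U.
- by move=> M N h; rewrite sfp_hcomp // hpro_hcomp; [rewrite !lob_sfp !rob_sfp|bd].
- by move=> y; have := h_nat x (sfs a y); rewrite top_sfs bot_sfs larr_sfs rarr_sfs.
Defined.

Definition modif_precomp (x : modif A B) : modif A' B.
Proof.
exists (vtrans_precomp (ml x)) (vtrans_precomp (mr x))
  (htrans_precomp (mt x)) (htrans_precomp (mb x))
  (fun X => mob x (sfo a X)).
- exact: congr1 (m_tl x).
- exact: congr1 (m_tr x).
- exact: congr1 (m_bl x).
- exact: congr1 (m_br x).
- by move=> X; exact: mob_sq.
- by move=> f; have := m_arr x (sfa a f); rewrite src_sfa tgt_sfa.
- by move=> M; have := m_pro x (sfp a M); rewrite lob_sfp rob_sfp.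
Defined.

Lemma vtrans_precomp_comp x y h h' : vtrans_precomp (@vtrans_comp _ _ x y h) =
  @vtrans_comp _ _ (vtrans_precomp x) (vtrans_precomp y) h'.
Proof. by apply: vtrans_eq => //= f; rewrite src_sfa tgt_sfa. Qed.

Lemma vtrans_precomp_id F : vtrans_precomp (vtrans_id F) = vtrans_id (sfun_comp a F).
Proof. exact: vtrans_eq. Qed.

Lemma htrans_precomp_comp x y h h' : htrans_precomp (@htrans_comp _ _ x y h) =
  @htrans_comp _ _ (htrans_precomp x) (htrans_precomp y) h'.
Proof. by apply: htrans_eq => //= M; rewrite lob_sfp rob_sfp. Qed.

(** The whiskered factors enter through equations because a whiskered identity is an identity
    transformation only up to a proved equality. *)
Lemma htrans_precomp_comp_eq x y h p q (h' : htgt p = hsrc q) : htrans_precomp x = p ->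
  htrans_precomp y = q -> htrans_precomp (@htrans_comp _ _ x y h) = htrans_comp h'.
Proof. by move=> e1 e2; subst; exact: htrans_precomp_comp. Qed.

Lemma htrans_precomp_id F : htrans_precomp (htrans_id F) = htrans_id (sfun_comp a F).
Proof. exact: htrans_eq. Qed.

Definition precomp0 : functor (vtrans_cat A B) (vtrans_cat A' B).
Proof.
exists (fun F => sfun_comp a F) vtrans_precomp => //=.
- exact: vtrans_precomp_id.
- move=> x y h h'; exact: vtrans_precomp_comp.
Defined.

Definition precomp1 : functor (modif_cat A B) (modif_cat A' B).
Proof.
exists htrans_precomp modif_precomp => //=.
- move=> c; apply: modif_eq => //=; exact: vtrans_precomp_id.
- move=> x y h h'; apply: modif_eq => //=; exact: vtrans_precomp_comp.
Defined.

Definition precomp : sfun (hom A B) (hom A' B).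
Proof.
exists precomp0 precomp1.
- by [].
- by [].
- by [].
- by [].
- exact: htrans_precomp_id.
- move=> x; apply: modif_eq => //=; exact: htrans_precomp_id.
- move=> x y h; rewrite (hcompE h)
    (@hcompE (hom A' B) (htrans_precomp x) (htrans_precomp y) (congr1 (sfun_comp a) h)).
  exact: htrans_precomp_comp.
- move=> x y h.
  rewrite (hcompsE h) (@hcompsE (hom A' B) (modif_precomp x) (modif_precomp y)
    (congr1 vtrans_precomp h)).
  apply: modif_eq => //=; exact: htrans_precomp_comp.
- move=> c; apply: modif_eq.
  + exact: vtrans_precomp_id.
  + exact: vtrans_precomp_id.
  + by apply: htrans_precomp_comp_eq => //; exact: htrans_precomp_id.
  + exact: erefl.
  + by move=> X; exact: erefl.
- move=> c; apply: modif_eq.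
  + exact: vtrans_precomp_id.
  + exact: vtrans_precomp_id.
  + by apply: htrans_precomp_comp_eq => //; exact: htrans_precomp_id.
  + exact: erefl.
  + by move=> X; exact: erefl.
- move=> c d e h h'.
  rewrite (kapE h h') (@kapE (hom A' B) (htrans_precomp c) (htrans_precomp d) (htrans_precomp e)
    (congr1 (sfun_comp a) h) (congr1 (sfun_comp a) h')).
  apply: modif_eq.
  + exact: vtrans_precomp_id.
  + exact: vtrans_precomp_id.
  + by apply: htrans_precomp_comp_eq => //; exact: htrans_precomp_comp.
  + by apply: htrans_precomp_comp_eq => //; exact: htrans_precomp_comp.
  + by move=> X; exact: erefl.
Defined.
End LeftWhisker.

Section RightWhisker.
Variables (A B B' : dblcat) (b : sfun B B').

Lemma is_sq_sfs (x : sq B) f g M N : is_sq x f g M N ->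
  is_sq (sfs b x) (sfa b f) (sfa b g) (sfp b M) (sfp b N).
Proof. by move=> [<- <- <- <-]; split; bd. Qed.

Definition vtrans_postcomp (x : vtrans A B) : vtrans A B'.
Proof.
exists (sfun_comp (vsrc x) b) (sfun_comp (vtgt x) b) (fun X => sfa b (vob x X))
  (fun M => sfs b (vpro x M)) (fun f => sfs b (varr x f)).
- by move=> X; split; bd.
- by move=> M; apply: is_sq_sfs; exact: vpro_sq.
- by move=> f; split; bd.
- by move=> X; rewrite vpro_U sfs_Ua.
- by move=> M N h; rewrite vpro_hcomp // sfs_hcomps //; bd.
- by move=> X; rewrite varr_id sfs_Ua.
- by move=> f f' h; rewrite varr_comp // sfs_hcomps ?sfs_vcomp ?sfs_Ua //; bd.
- move=> y; rewrite congE; [|bd..].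
  (* Strict functors preserve the actions of disks, so [b] carries naturality in action form to
     naturality of the image. *)
  have := congr1 (sfs b) (v_natA x y).
  rewrite sfs_ract ?sfs_lact ?sfs_vcomp //; try exact: isdisk_varr; bd.
Defined.

Definition htrans_postcomp (x : htrans A B) : htrans A B'.
Proof.
exists (sfun_comp (hsrc x) b) (sfun_comp (htgt x) b) (fun X => sfp b (hob x X))
  (fun f => sfs b (harr x f)) (fun M => sfs b (hpro x M)).
- by move=> X; split; bd.
- by move=> f; apply: is_sq_sfs; exact: harr_sq.
- by move=> M; split; bd.
- by move=> X; rewrite harr_id sfs_ids.
- by move=> f f' h; rewrite harr_comp // sfs_vcomp //; bd.
- by move=> X; rewrite hpro_U sfs_vcomp ?sfs_lam ?sfs_rhoV //; bd.
- move=> M N h; rewrite hpro_hcomp //.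
  do !(rewrite sfs_vcomp; [|solve[bd]]).
  do !(rewrite sfs_hcomps; [|solve[bd]]).
  rewrite !sfs_ids.
  do !(rewrite sfs_kap; [|solve[bd]|solve[bd]]).
  by rewrite sfs_kapV; bd.
- move=> y; have := congr1 (sfs b) (h_nat x y).
  by rewrite !sfs_vcomp ?sfs_hcomps; bd.
Defined.

Definition modif_postcomp (x : modif A B) : modif A B'.
Proof.
exists (vtrans_postcomp (ml x)) (vtrans_postcomp (mr x))
  (htrans_postcomp (mt x)) (htrans_postcomp (mb x))
  (fun X => sfs b (mob x X)).
- by rewrite /= (m_tl x).
- by rewrite /= (m_tr x).
- by rewrite /= (m_bl x).
- by rewrite /= (m_br x).
- by move=> X; apply: is_sq_sfs; exact: mob_sq.
- move=> f; modif_boundary x; rewrite congE; [|rewrite /=; bd..].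
  have := congr1 (sfs b) (m_arrA x f).
  by rewrite sfs_ract ?sfs_lact ?sfs_vcomp //; try exact: isdisk_varr; bd.
- move=> M; modif_boundary x; have := congr1 (sfs b) (m_pro x M).
  by rewrite !sfs_vcomp ?sfs_hcomps; bd.
Defined.

Lemma vtrans_postcomp_comp x y h h' : vtrans_postcomp (@vtrans_comp _ _ x y h) =
  @vtrans_comp _ _ (vtrans_postcomp x) (vtrans_postcomp y) h'.
Proof.
apply: vtrans_eq => //= [X|M|f].
- by rewrite sfa_acomp //; bd.
- by rewrite sfs_vcomp //; bd.
- by rewrite sfs_hcomps ?sfs_vcomp ?sfs_Ua //; bd.
Qed.

Lemma vtrans_postcomp_id F : vtrans_postcomp (vtrans_id F) = vtrans_id (sfun_comp F b).
Proof.
apply: vtrans_eq => //= [X|M|f]; [exact: sfa_ida|exact: sfs_ids|exact: sfs_Ua].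
Qed.

Lemma htrans_postcomp_comp_eq x y h p q (h' : htgt p = hsrc q) : htrans_postcomp x = p ->
  htrans_postcomp y = q -> htrans_postcomp (@htrans_comp _ _ x y h) = htrans_comp h'.
Proof.
move=> e1 e2; subst; apply: htrans_eq => //= [X|f|M].
- by rewrite sfp_hcomp; bd.
- by rewrite sfs_hcomps; bd.
- rewrite /comp_cell.
  do !(rewrite sfs_vcomp; [|solve[bd]]).
  do !(rewrite sfs_hcomps; [|solve[bd]]).
  rewrite !sfs_ids.
  do !(rewrite sfs_kapV; [|solve[bd]|solve[bd]]).
  by rewrite sfs_kap; bd.
Qed.

Lemma htrans_postcomp_id F : htrans_postcomp (htrans_id F) = htrans_id (sfun_comp F b).
Proof.
apply: htrans_eq => //= [X|f|M]; [exact: sfp_Uo|exact: sfs_Ua|].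
by rewrite sfs_vcomp ?sfs_rho ?sfs_lamV; bd.
Qed.

Definition postcomp0 : functor (vtrans_cat A B) (vtrans_cat A B').
Proof.
exists (fun F => sfun_comp F b) vtrans_postcomp => //=.
- exact: vtrans_postcomp_id.
- move=> x y h h'; exact: vtrans_postcomp_comp.
Defined.

Definition postcomp1 : functor (modif_cat A B) (modif_cat A B').
Proof.
exists htrans_postcomp modif_postcomp => //=.
- move=> c; apply: modif_eq => //=; try exact: vtrans_postcomp_id; move=> X; exact: sfs_ids.
- move=> x y h h'; apply: modif_eq => //=; try exact: vtrans_postcomp_comp.
  by move=> X; rewrite sfs_vcomp; bd.
Defined.

Definition postcomp : sfun (hom A B) (hom A B').
Proof.
exists postcomp0 postcomp1.
- by [].
- by [].
- by [].
- by [].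
- exact: htrans_postcomp_id.
- move=> x; apply: modif_eq => //=; try exact: htrans_postcomp_id; move=> X; exact: sfs_Ua.
- move=> x y h; rewrite (hcompE h)
    (@hcompE (hom A B') (htrans_postcomp x) (htrans_postcomp y)
      (congr1 (fun F => sfun_comp F b) h)).
  exact: htrans_postcomp_comp_eq.
- move=> x y h.
  rewrite (hcompsE h) (@hcompsE (hom A B') (modif_postcomp x) (modif_postcomp y)
    (congr1 vtrans_postcomp h)).
  apply: modif_eq => //=; try exact: htrans_postcomp_comp_eq.
  move=> X; rewrite sfs_hcomps; bd; exact: (congr1 (fun z => vob z X) h).
- move=> c; apply: modif_eq.
  + exact: vtrans_postcomp_id.
  + exact: vtrans_postcomp_id.
  + by apply: htrans_postcomp_comp_eq => //; exact: htrans_postcomp_id.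
  + exact: erefl.
  + by move=> X; exact: sfs_lam.
- move=> c; apply: modif_eq.
  + exact: vtrans_postcomp_id.
  + exact: vtrans_postcomp_id.
  + by apply: htrans_postcomp_comp_eq => //; exact: htrans_postcomp_id.
  + exact: erefl.
  + by move=> X; exact: sfs_rho.
- move=> c d e h h'.
  rewrite (kapE h h') (@kapE (hom A B') (htrans_postcomp c) (htrans_postcomp d) (htrans_postcomp e)
    (congr1 (fun F => sfun_comp F b) h)
    (congr1 (fun F => sfun_comp F b) h')).
  apply: modif_eq.
  + exact: vtrans_postcomp_id.
  + exact: vtrans_postcomp_id.
  + by apply: htrans_postcomp_comp_eq => //; exact: htrans_postcomp_comp_eq.
  + by apply: htrans_postcomp_comp_eq => //; exact: htrans_postcomp_comp_eq.
  + move=> X; have [? ?] := hom_rl h h' X; exact: sfs_kap.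
Defined.
End RightWhisker.

(** * Interchangers as modifications *)

Ltac dsk ::= solve [repeat first [assumption | apply: isdisk_Ua | apply: isdisk_varr
  | apply: isdisk_sfs | apply: isdisk_h; [| |solve[bd]] | apply: isdisk_v; [| |solve[bd]]]].

(** An identity proarrow-dimension transformation has components [rho M · lamV M]; against these, an
    equation of actions becomes the second modification axiom. Naturality at [vpro a M] enters χ(α,
    β) in this way. *)
Lemma unit_disk_nat (D : dblcat) (M N : pro D) (x y d e : sq D) :
  isdisk d -> isdisk e -> x ◃ d = e ▹ y -> rarr x = larr d -> rarr e = larr y ->
  top x = M -> bot x = N -> top y = M -> bot y = N ->
  (rho M · lamV M) · (e ⊙ y) = (x ⊙ d) · (rho N · lamV N).
Proof.
move=> Hd He E h1 h2 t1 b1 t2 b2; obs.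
have R := rho_ract Hd h1; have L := lam_lact He h2; rewrite t1 b1 t2 b2 in R L.
rewrite -[RHS]vcompA; [|bd..]. rewrite -R E lactE t2 b2. ra.
by rewrite lamK'; rids; bd.
Qed.

Section Interchangers.
Variables (A B C : dblcat).

(** At a unit proarrow [hpro d] is [lam · rhoV]. Composing naturality at the disk [x] with [lamV]
    and [rho] therefore gives an equation of actions, the form needed for the first axiom of χ(α,
    δ). *)
Lemma h_nat_disk (d : htrans B C) (x : sq B) : isdisk x ->
  harr d (larr x) ◃ sfs (htgt d) x = sfs (hsrc d) x ▹ harr d (rarr x).
Proof.
move=> Hx; have Hs := isdisk_sfs (hsrc d) Hx; have Ht := isdisk_sfs (htgt d) Hx.
have [X [Y [eX eY [? ?] [? ?]]]] := isdiskP Hx.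
have E := h_nat d x; rewrite eX eY !hpro_U in E.
have [? ?] : src (larr x) = X /\ tgt (larr x) = Y by bd.
have [? ?] : src (rarr x) = X /\ tgt (rarr x) = Y by bd.
rewrite ractE lactE.
have [-> ->] : top (harr d (larr x)) = hob d X /\ bot (harr d (larr x)) = hob d Y by split; bd.
have [-> ->] : top (harr d (rarr x)) = hob d X /\ bot (harr d (rarr x)) = hob d Y by split; bd.
have {E}: lamV (hob d X) · (((sfs (hsrc d) x ⊙ harr d (rarr x)) ·
    (lam (hob d Y) · rhoV (hob d Y))) · rho (hob d Y)) =
  lamV (hob d X) · ((lam (hob d X) · rhoV (hob d X) ·
    (harr d (larr x) ⊙ sfs (htgt d) x)) · rho (hob d Y)) by rewrite E.
ra; rewrite rhoVK' (vcancel (lamVK' (hob d X))); [|bd..].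
by rids.
Qed.

Definition modif_chi_vh (a : vtrans A B) (d : htrans B C) : modif A C.
Proof.
exists (vtrans_postcomp (hsrc d) a) (vtrans_postcomp (htgt d) a) (htrans_precomp (vsrc a) d)
  (htrans_precomp (vtgt a) d) (fun X => harr d (vob a X)) => //.
- by move=> X; split; rewrite /=; bd.
- move=> f; rewrite congE; [|rewrite /=; bd..].
  have := h_nat_disk d (isdisk_varr a f); rewrite larr_varr rarr_varr.
  by rewrite !harr_comp; bd.
- by move=> M; have := h_nat d (vpro a M); rewrite larr_vpro rarr_vpro top_vpro bot_vpro.
Defined.

Definition modif_chi_hv (c : htrans A B) (b : vtrans B C) : modif A C.
Proof.
exists (vtrans_precomp (hsrc c) b) (vtrans_precomp (htgt c) b) (htrans_postcomp (vsrc b) c)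
  (htrans_postcomp (vtgt b) c) (fun X => vpro b (hob c X)) => //.
- by move=> X; split; rewrite /=; bd.
- move=> f; rewrite congE; [|rewrite /=; bd..].
  by have := v_natA b (harr c f); rewrite larr_harr rarr_harr top_harr bot_harr.
(* The sides of [hpro c M] are identity arrows, so by [varr_id] the disks in this naturality are
   unit squares and act trivially. *)
- move=> M /=; have := v_natA b (hpro c M).
  rewrite larr_hpro rarr_hpro top_hpro bot_hpro !varr_id ractU ?lactU ?vpro_hcomp //; bd.
Defined.

Definition modif_chi_vv (a : vtrans A B) (b : vtrans B C) : modif A C.
Proof.
exists (@vtrans_comp _ _ (vtrans_postcomp (vsrc b) a) (vtrans_precomp (vtgt a) b) erefl)
       (@vtrans_comp _ _ (vtrans_precomp (vsrc a) b) (vtrans_postcomp (vtgt b) a) erefl)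
       (htrans_id (sfun_comp (vsrc a) (vsrc b))) (htrans_id (sfun_comp (vtgt a) (vtgt b)))
       (fun X => varr b (vob a X)) => //.
- by move=> X; split; rewrite /=; bd.
- move=> f /=; rewrite congE; [|rewrite /=; bd..].
  (* The sides of [varr a f] are composites, on which [varr b] splits into two disks. All cells are
     then disks, and the naturality and the goal differ only by the bracketing of three factors and
     by orientation. *)
  have := v_natA b (varr a f); rewrite larr_varr rarr_varr top_varr bot_varr.
  rewrite !varr_comp; [|bd..]. rewrite !vpro_U.
  rewrite ract_disk; [|dsk|dsk|bd].
  rewrite lact_disk; [|dsk|dsk|bd].
  rewrite ract_disk; [|dsk|dsk|bd].
  rewrite lact_disk; [|dsk|dsk|bd].
  rewrite disk_hcompsA; [|dsk|dsk|dsk|bd|bd].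
  rewrite -disk_hcompsA; [|dsk|dsk|dsk|bd|bd].
  rewrite disk_hcompsA; [|dsk|dsk|dsk|bd|bd].
  by move=> E; exact: esym E.
- move=> M /=; have := v_natA b (vpro a M).
  rewrite larr_vpro rarr_vpro top_vpro bot_vpro ?sfp_comp.
  by move=> E; apply: (unit_disk_nat _ _ E); [dsk|dsk|bd|bd|bd|bd|bd|bd].
Defined.

Definition modif_chi_hh (c : htrans A B) (d : htrans B C) : modif A C.
Proof.
apply: (@modif_glob _ _
   (@htrans_comp _ _ (htrans_postcomp (hsrc d) c) (htrans_precomp (htgt c) d) erefl)
   (@htrans_comp _ _ (htrans_precomp (hsrc c) d) (htrans_postcomp (htgt d) c) erefl)
   (fun X => hpro d (hob c X)) erefl erefl).
- by move=> X; split; rewrite /=; bd.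
- by move=> f; have := h_nat d (harr c f); rewrite larr_harr rarr_harr top_harr bot_harr.
- move=> M /=; have := h_nat d (hpro c M).
  rewrite larr_hpro rarr_hpro top_hpro bot_hpro !harr_id !hpro_hcomp; [|bd..].
  rewrite ?bdE2 => E.
  (* Naturality of [d] at [hpro c M] expands [hpro d] on composites, which begins and ends with κ,
     whereas components of composite transformations begin and end with its inverse. Composing the
     goal with κ on the right and the naturality with the inverse on the left matches the two. *)
  apply: (vcancel_r (a := kap (hob d (sfo (hsrc c) (lob M)))
      (sfp (htgt d) (hob c (lob M))) (sfp (htgt d) (sfp (htgt c) M)))
    (b := kapV (hob d (sfo (hsrc c) (lob M)))
      (sfp (htgt d) (hob c (lob M))) (sfp (htgt d) (sfp (htgt c) M)))).
  + rewrite kapK'; rewrite /comp_cell; bd.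
  + bd.
  + rewrite /comp_cell; bd.
  + rewrite /comp_cell; bd.
  + rewrite /comp_cell; move: E => /(congr1 (vcomp (kapV (sfp (hsrc d) (sfp (hsrc c) M))
      (sfp (hsrc d) (hob c (rob M))) (hob d (sfo (htgt c) (rob M)))))).
    ra; rewrite kapVK'; [|bd..]. rids => ->.
    by rewrite (@vcancel _ _ _ _ ((sfp (hsrc d) (sfp (hsrc c) M) ⊙0
      (sfp (hsrc d) (hob c (rob M)) ⊙0 (hob d (sfo (htgt c) (rob M))))))) ?kapVK'; bd.
Defined.

End Interchangers.

(* Conversion tests between cells of the hom double categories can diverge in
   practice, so boundaries are only compared syntactically from here on. *)
Ltac bd_close ::= try (lazymatch goal with |- ?a = ?a => exact: erefl | _ => congruence end).

(** * Boundaries and components in the hom double categories *)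

Section HomComponents.
Variables (C D : dblcat).
Implicit Types (a b : arr (hom C D)) (c d e : pro (hom C D)) (x y : sq (hom C D)).

Lemma hom_eq x y : larr x = larr y -> rarr x = rarr y -> top x = top y ->
  bot x = bot y -> mob x =1 mob y -> x = y.
Proof. exact: modif_eq. Qed.

Lemma vob_acomp a b X : tgt a = src b -> vob (a ·0 b) X = vob a X ·0 vob b X.
Proof. by move=> h; rewrite (acompE h). Qed.
Lemma hob_hcomp c d X : rob c = lob d -> hob (c ⊙0 d) X = hob c X ⊙0 hob d X.
Proof. by move=> h; rewrite (hcompE h). Qed.
Lemma mob_vcomp x y X : bot x = top y -> mob (x · y) X = mob x X · mob y X.
Proof. by move=> h; rewrite (vcompE h). Qed.
Lemma mob_hcomps x y X : rarr x = larr y -> mob (x ⊙ y) X = mob x X ⊙ mob y X.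
Proof. by move=> h; rewrite (hcompsE h). Qed.
Lemma mob_kap c d e X : rob c = lob d -> rob d = lob e ->
  mob (kap c d e) X = kap (hob c X) (hob d X) (hob e X).
Proof. by move=> h h'; rewrite (kapE h h'). Qed.
Lemma mob_kapV c d e X : rob c = lob d -> rob d = lob e ->
  mob (kapV c d e) X = kapV (hob c X) (hob d X) (hob e X).
Proof. by move=> h h'; rewrite (kapVE h h'). Qed.
End HomComponents.

Section WhiskerComponents.
Variables (A B C : dblcat).
Implicit Types (f : ob (hom A B)) (g : ob (hom B C)).
Implicit Types (a : arr (hom A B)) (b : arr (hom B C)).
Implicit Types (c : pro (hom A B)) (d : pro (hom B C)).

Lemma sfo_precomp f g : sfo (precomp C f) g = sfun_comp f g :> ob (hom A C). Proof. by []. Qed.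
Lemma sfo_postcomp f g : sfo (postcomp A g) f = sfun_comp f g :> ob (hom A C). Proof. by []. Qed.

(** The ascription places interchangers in the hom double category, where their boundaries are
    computed by the rewriting rules that follow. *)
Definition ichg_vh a d : sq (hom A C) := modif_chi_vh a d.
Definition ichg_hv c b : sq (hom A C) := modif_chi_hv c b.
Definition ichg_vv a b : sq (hom A C) := modif_chi_vv a b.
Definition ichg_hh c d : sq (hom A C) := modif_chi_hh c d.

Lemma larr_ichg_vh a d : larr (ichg_vh a d) = sfa (postcomp A (lob d)) a. Proof. by []. Qed.
Lemma rarr_ichg_vh a d : rarr (ichg_vh a d) = sfa (postcomp A (rob d)) a. Proof. by []. Qed.
Lemma top_ichg_vh a d : top (ichg_vh a d) = sfp (precomp C (src a)) d. Proof. by []. Qed.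
Lemma bot_ichg_vh a d : bot (ichg_vh a d) = sfp (precomp C (tgt a)) d. Proof. by []. Qed.
Lemma larr_ichg_hv c b : larr (ichg_hv c b) = sfa (precomp C (lob c)) b. Proof. by []. Qed.
Lemma rarr_ichg_hv c b : rarr (ichg_hv c b) = sfa (precomp C (rob c)) b. Proof. by []. Qed.
Lemma top_ichg_hv c b : top (ichg_hv c b) = sfp (postcomp A (src b)) c. Proof. by []. Qed.
Lemma bot_ichg_hv c b : bot (ichg_hv c b) = sfp (postcomp A (tgt b)) c. Proof. by []. Qed.
Lemma larr_ichg_vv a b :
  larr (ichg_vv a b) = sfa (postcomp A (src b)) a ·0 sfa (precomp C (tgt a)) b.
Proof.
by rewrite (@acompE (hom A C) (vtrans_postcomp (vsrc b) a) (vtrans_precomp (vtgt a) b) erefl). Qed.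
Lemma rarr_ichg_vv a b :
  rarr (ichg_vv a b) = sfa (precomp C (src a)) b ·0 sfa (postcomp A (tgt b)) a.
Proof.
by rewrite (@acompE (hom A C) (vtrans_precomp (vsrc a) b) (vtrans_postcomp (vtgt b) a) erefl). Qed.
Lemma top_ichg_vv a b : top (ichg_vv a b) = Uo (sfun_comp (src a) (src b) : ob (hom A C)).
Proof. by []. Qed.
Lemma bot_ichg_vv a b : bot (ichg_vv a b) = Uo (sfun_comp (tgt a) (tgt b) : ob (hom A C)).
Proof. by []. Qed.
Lemma top_ichg_hh c d :
  top (ichg_hh c d) = sfp (postcomp A (lob d)) c ⊙0 sfp (precomp C (rob c)) d.
Proof.
by rewrite (@hcompE (hom A C) (htrans_postcomp (hsrc d) c) (htrans_precomp (htgt c) d) erefl). Qed.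
Lemma bot_ichg_hh c d :
  bot (ichg_hh c d) = sfp (precomp C (lob c)) d ⊙0 sfp (postcomp A (rob d)) c.
Proof.
by rewrite (@hcompE (hom A C) (htrans_precomp (hsrc c) d) (htrans_postcomp (htgt d) c) erefl). Qed.
Lemma larr_ichg_hh c d : larr (ichg_hh c d) = ida (sfun_comp (lob c) (lob d) : ob (hom A C)).
Proof. by []. Qed.
Lemma rarr_ichg_hh c d : rarr (ichg_hh c d) = ida (sfun_comp (rob c) (rob d) : ob (hom A C)).
Proof. by []. Qed.
End WhiskerComponents.

Definition bdE3 := (bdE2, sfo_precomp, sfo_postcomp,
  (larr_ichg_vh, rarr_ichg_vh, top_ichg_vh, bot_ichg_vh),
  (larr_ichg_hv, rarr_ichg_hv, top_ichg_hv, bot_ichg_hv),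
  (larr_ichg_vv, rarr_ichg_vv, top_ichg_vv, bot_ichg_vv),
  (larr_ichg_hh, rarr_ichg_hh, top_ichg_hh, bot_ichg_hh)).
Ltac bd_rw ::= rewrite ?bdE3.

Lemma ichg_vh_sq A B C (a : arr (hom A B)) (d : pro (hom B C)) :
    is_sq (ichg_vh a d) (sfa (postcomp A (lob d)) a) (sfa (postcomp A (rob d)) a)
     (sfp (precomp C (src a)) d) (sfp (precomp C (tgt a)) d).
Proof. by split; bd. Qed.

Lemma ichg_hv_sq A B C (c : pro (hom A B)) (b : arr (hom B C)) :
    is_sq (ichg_hv c b) (sfa (precomp C (lob c)) b) (sfa (precomp C (rob c)) b)
     (sfp (postcomp A (src b)) c) (sfp (postcomp A (tgt b)) c).
Proof. by split; bd. Qed.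

Lemma ichg_hh_sq A B C (c : pro (hom A B)) (d : pro (hom B C)) :
    is_proarrow_disk (ichg_hh c d) (sfp (postcomp A (lob d)) c ⊙0 sfp (precomp C (rob c)) d)
     (sfp (precomp C (lob c)) d ⊙0 sfp (postcomp A (rob d)) c).
Proof. by split; bd. Qed.

Lemma ichg_vv_sq A B C (a : arr (hom A B)) (b : arr (hom B C)) :
    is_arrow_disk (ichg_vv a b) (sfa (postcomp A (src b)) a ·0 sfa (precomp C (tgt a)) b)
                            (sfa (precomp C (src a)) b ·0 sfa (postcomp A (tgt b)) a).
Proof. by split; bd. Qed.

(** * Whiskering laws *)

Lemma sfun_comp_idl (C D : dblcat) (F : sfun C D) : sfun_comp (sfun_id C) F = F.
Proof. exact: sfun_eq. Qed.
Lemma sfun_comp_idr (C D : dblcat) (F : sfun C D) : sfun_comp F (sfun_id D) = F.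
Proof. exact: sfun_eq. Qed.
(** Both sides have the same data by computation and differ only in their proof fields. Boundaries
    of iterated whiskerings are compared through such equations. *)
Lemma sfun_compA (C D E E' : dblcat) (F : sfun C D) (G : sfun D E) (K : sfun E E') :
  sfun_comp (sfun_comp F G) K = sfun_comp F (sfun_comp G K).
Proof. exact: sfun_eq. Qed.

Section WhiskerLaws.
Variables (A B : dblcat).

Lemma precomp_id : precomp B (sfun_id A) = sfun_id (hom A B).
Proof.
have V x : vtrans_precomp (sfun_id A) x = x :> vtrans A B.
  by apply: vtrans_eq => //; exact: sfun_comp_idl.
have K x : htrans_precomp (sfun_id A) x = x :> htrans A B.
  by apply: htrans_eq => //; exact: sfun_comp_idl.
apply: sfun_eq => x; [exact: sfun_comp_idl|exact: V|exact: K|].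
by apply: modif_eq; [exact: V|exact: V|exact: K|exact: K|].
Qed.

Lemma postcomp_id : postcomp A (sfun_id B) = sfun_id (hom A B).
Proof.
have V x : vtrans_postcomp (sfun_id B) x = x :> vtrans A B.
  by apply: vtrans_eq => //; exact: sfun_comp_idr.
have K x : htrans_postcomp (sfun_id B) x = x :> htrans A B.
  by apply: htrans_eq => //; exact: sfun_comp_idr.
apply: sfun_eq => x; [exact: sfun_comp_idr|exact: V|exact: K|].
by apply: modif_eq; [exact: V|exact: V|exact: K|exact: K|].
Qed.

Lemma precomp_comp A2 A1 (a' : sfun A2 A1) (a : sfun A1 A) :
  precomp B (sfun_comp a' a) = sfun_comp (precomp B a) (precomp B a').
Proof.
have V x : vtrans_precomp (sfun_comp a' a) x =
    vtrans_precomp a' (vtrans_precomp a x) :> vtrans A2 B.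
  by apply: vtrans_eq => //; exact: sfun_compA.
have K x : htrans_precomp (sfun_comp a' a) x =
    htrans_precomp a' (htrans_precomp a x) :> htrans A2 B.
  by apply: htrans_eq => //; exact: sfun_compA.
apply: sfun_eq => x; [exact: sfun_compA|exact: V|exact: K|].
by apply: modif_eq; [exact: V|exact: V|exact: K|exact: K|].
Qed.

Lemma postcomp_comp B1 B2 (b : sfun B B1) (b' : sfun B1 B2) :
  postcomp A (sfun_comp b b') = sfun_comp (postcomp A b) (postcomp A b').
Proof.
have V x : vtrans_postcomp (sfun_comp b b') x =
    vtrans_postcomp b' (vtrans_postcomp b x) :> vtrans A B2.
  by apply: vtrans_eq => //; exact/esym/sfun_compA.
have K x : htrans_postcomp (sfun_comp b b') x =
    htrans_postcomp b' (htrans_postcomp b x) :> htrans A B2.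
  by apply: htrans_eq => //; exact/esym/sfun_compA.
apply: sfun_eq => x; [exact/esym/sfun_compA|exact: V|exact: K|].
by apply: modif_eq; [exact: V|exact: V|exact: K|exact: K|].
Qed.

Lemma precomp_postcomp A' B' (a : sfun A' A) (b : sfun B B') :
  sfun_comp (precomp B a) (postcomp A' b) = sfun_comp (postcomp A b) (precomp B' a).
Proof.
have V x : vtrans_postcomp b (vtrans_precomp a x) = vtrans_precomp a (vtrans_postcomp b x).
  by apply: vtrans_eq => //; exact: sfun_compA.
have K x : htrans_postcomp b (htrans_precomp a x) = htrans_precomp a (htrans_postcomp b x).
  by apply: htrans_eq => //; exact: sfun_compA.
apply: sfun_eq => x; [exact: sfun_compA|exact: V|exact: K|].
by apply: modif_eq; [exact: V|exact: V|exact: K|exact: K|].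
Qed.
End WhiskerLaws.

Lemma vtrans_precomp_comp_eq (A' A B : dblcat) (a : sfun A' A) (x y : vtrans A B) h p q
  (h' : vtgt p = vsrc q) : vtrans_precomp a x = p -> vtrans_precomp a y = q ->
  vtrans_precomp a (@vtrans_comp _ _ x y h) = vtrans_comp h'.
Proof. by move=> e1 e2; subst; exact: vtrans_precomp_comp. Qed.
Lemma vtrans_postcomp_comp_eq (A B B' : dblcat) (b : sfun B B') (x y : vtrans A B) h p q
  (h' : vtgt p = vsrc q) : vtrans_postcomp b x = p -> vtrans_postcomp b y = q ->
  vtrans_postcomp b (@vtrans_comp _ _ x y h) = vtrans_comp h'.
Proof. by move=> e1 e2; subst; exact: vtrans_postcomp_comp. Qed.

Ltac sfun_assoc := solve [apply: vtrans_eq => //; exact: sfun_compA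
  | apply: vtrans_eq => //; exact/esym/sfun_compA
  | apply: htrans_eq => //; exact: sfun_compA
  | apply: htrans_eq => //; exact/esym/sfun_compA].

Section WhiskerLeft.
Variables (A' A B C : dblcat) (a : sfun A' A).

Lemma ichg_vh_precomp (x : arr (hom A B)) (y : pro (hom B C)) :
  ichg_vh (sfa (precomp B a) x) y = sfs (precomp C a) (ichg_vh x y).
Proof. by apply: modif_eq; [sfun_assoc|sfun_assoc|sfun_assoc|sfun_assoc|]. Qed.
Lemma ichg_hv_precomp (x : pro (hom A B)) (y : arr (hom B C)) :
  ichg_hv (sfp (precomp B a) x) y = sfs (precomp C a) (ichg_hv x y).
Proof. by apply: modif_eq; [sfun_assoc|sfun_assoc|sfun_assoc|sfun_assoc|]. Qed.
Lemma ichg_vv_precomp (x : arr (hom A B)) (y : arr (hom B C)) :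
  ichg_vv (sfa (precomp B a) x) y = sfs (precomp C a) (ichg_vv x y).
Proof.
apply: modif_eq.
- by apply/esym; apply: vtrans_precomp_comp_eq; sfun_assoc.
- by apply/esym; apply: vtrans_precomp_comp_eq; sfun_assoc.
- by apply: htrans_eq => //; exact: sfun_compA.
- by apply: htrans_eq => //; exact: sfun_compA.
- by [].
Qed.

Lemma ichg_hh_precomp (x : pro (hom A B)) (y : pro (hom B C)) :
  ichg_hh (sfp (precomp B a) x) y = sfs (precomp C a) (ichg_hh x y).
Proof.
apply: modif_eq.
- apply: etrans (esym (vtrans_precomp_id _ _)); apply: vtrans_eq => //; exact: sfun_compA.
- apply: etrans (esym (vtrans_precomp_id _ _)); apply: vtrans_eq => //; exact: sfun_compA.
- by apply/esym; apply: htrans_precomp_comp_eq; sfun_assoc.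
- by apply/esym; apply: htrans_precomp_comp_eq; sfun_assoc.
- by [].
Qed.
End WhiskerLeft.

Section WhiskerRight.
Variables (A B C C' : dblcat) (c : sfun C C').
Lemma ichg_vh_postcomp (x : arr (hom A B)) (y : pro (hom B C)) :
  ichg_vh x (sfp (postcomp B c) y) = sfs (postcomp A c) (ichg_vh x y).
Proof. by apply: modif_eq; [sfun_assoc|sfun_assoc|sfun_assoc|sfun_assoc|]. Qed.
Lemma ichg_hv_postcomp (x : pro (hom A B)) (y : arr (hom B C)) :
  ichg_hv x (sfa (postcomp B c) y) = sfs (postcomp A c) (ichg_hv x y).
Proof. by apply: modif_eq; [sfun_assoc|sfun_assoc|sfun_assoc|sfun_assoc|]. Qed.
Lemma ichg_vv_postcomp (x : arr (hom A B)) (y : arr (hom B C)) :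
  ichg_vv x (sfa (postcomp B c) y) = sfs (postcomp A c) (ichg_vv x y).
Proof.
apply: modif_eq.
- by apply/esym; apply: vtrans_postcomp_comp_eq; sfun_assoc.
- by apply/esym; apply: vtrans_postcomp_comp_eq; sfun_assoc.
- by apply: etrans (esym (htrans_postcomp_id _ _)); sfun_assoc.
- by apply: etrans (esym (htrans_postcomp_id _ _)); sfun_assoc.
- by [].
Qed.

Lemma ichg_hh_postcomp (x : pro (hom A B)) (y : pro (hom B C)) :
  ichg_hh x (sfp (postcomp B c) y) = sfs (postcomp A c) (ichg_hh x y).
Proof.
apply: modif_eq.
- by apply: etrans (esym (vtrans_postcomp_id _ _)); sfun_assoc.
- by apply: etrans (esym (vtrans_postcomp_id _ _)); sfun_assoc.
- by apply/esym; apply: htrans_postcomp_comp_eq; sfun_assoc.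
- by apply/esym; apply: htrans_postcomp_comp_eq; sfun_assoc.
- by [].
Qed.
End WhiskerRight.

Section WhiskerMiddle.
Variables (A B B' C : dblcat) (b : sfun B B').
Lemma ichg_vh_mid (x : arr (hom A B)) (y : pro (hom B' C)) :
  ichg_vh (sfa (postcomp A b) x) y = ichg_vh x (sfp (precomp C b) y).
Proof. by apply: modif_eq; [sfun_assoc|sfun_assoc|sfun_assoc|sfun_assoc|]. Qed.
Lemma ichg_hv_mid (x : pro (hom A B)) (y : arr (hom B' C)) :
  ichg_hv (sfp (postcomp A b) x) y = ichg_hv x (sfa (precomp C b) y).
Proof. by apply: modif_eq; [sfun_assoc|sfun_assoc|sfun_assoc|sfun_assoc|]. Qed.
Lemma ichg_vv_mid (x : arr (hom A B)) (y : arr (hom B' C)) :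
  ichg_vv (sfa (postcomp A b) x) y = ichg_vv x (sfa (precomp C b) y).
Proof.
apply: modif_eq.
- by apply: vtrans_comp_eq; sfun_assoc.
- by apply: vtrans_comp_eq; sfun_assoc.
- by apply: htrans_eq => //; exact: sfun_compA.
- by apply: htrans_eq => //; exact: sfun_compA.
- by [].
Qed.

Lemma ichg_hh_mid (x : pro (hom A B)) (y : pro (hom B' C)) :
  ichg_hh (sfp (postcomp A b) x) y = ichg_hh x (sfp (precomp C b) y).
Proof.
apply: modif_eq.
- exact: (congr1 (@vtrans_id A C) (sfun_compA (hsrc x) b (hsrc y))).
- exact: (congr1 (@vtrans_id A C) (sfun_compA (htgt x) b (htgt y))).
- by apply: htrans_comp_eq; sfun_assoc.
- by apply: htrans_comp_eq; sfun_assoc.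
- by [].
Qed.
End WhiskerMiddle.

(** * Interchanger laws *)

Section ChiLaws.
Variables (A B C : dblcat).
Implicit Types (f : ob (hom A B)) (g : ob (hom B C)).
Implicit Types (a : arr (hom A B)) (b : arr (hom B C)).
Implicit Types (c : pro (hom A B)) (d : pro (hom B C)).

Lemma ichg_vh_ida f d : ichg_vh (ida f) d = ids (sfp (precomp C f) d).
Proof. by apply: hom_eq; [bd|bd|bd|bd|move=> X; exact: harr_id]. Qed.

Lemma ichg_vh_acomp a a' d : tgt a = src a' -> ichg_vh (a ·0 a') d = ichg_vh a d · ichg_vh a' d.
Proof.
move=> h; apply: hom_eq; [bd|bd|bd|bd|move=> X].
rewrite mob_vcomp; [|bd].
rewrite [LHS]/= vob_acomp //; apply: harr_comp; rewrite tgt_vob src_vob.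
exact: (congr1 (fun z => sfo z X) h).
Qed.

Lemma ichg_vh_Uo a g : ichg_vh a (Uo g) = Ua (sfa (postcomp A g) a).
Proof. by apply: hom_eq; [bd|bd|bd|bd|]. Qed.

Lemma ichg_vh_hcomp a d d' : rob d = lob d' -> ichg_vh a (d ⊙0 d') = ichg_vh a d ⊙ ichg_vh a d'.
Proof.
move=> h; apply: hom_eq; [bd|bd|bd|bd|move=> X].
by rewrite mob_hcomps; [rewrite (hcompE h)|bd].
Qed.

Lemma ichg_hv_Uo f b : ichg_hv (Uo f) b = Ua (sfa (precomp C f) b).
Proof. by apply: hom_eq; [bd|bd|bd|bd|move=> X; exact: vpro_U]. Qed.

Lemma ichg_hv_hcomp c c' b : rob c = lob c' -> ichg_hv (c ⊙0 c') b = ichg_hv c b ⊙ ichg_hv c' b.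
Proof.
move=> h; apply: hom_eq; [bd|bd|bd|bd|move=> X].
rewrite mob_hcomps; [|bd].
rewrite [LHS]/= hob_hcomp //; apply: vpro_hcomp; rewrite rob_hob lob_hob.
exact: (congr1 (fun z => sfo z X) h).
Qed.

Lemma ichg_hv_ida c g : ichg_hv c (ida g) = ids (sfp (postcomp A g) c).
Proof. by apply: hom_eq; [bd|bd|bd|bd|]. Qed.

Lemma ichg_hv_acomp c b b' : tgt b = src b' -> ichg_hv c (b ·0 b') = ichg_hv c b · ichg_hv c b'.
Proof.
move=> h; apply: hom_eq; [bd|bd|bd|bd|move=> X].
by rewrite mob_vcomp; [rewrite (acompE h)|bd].
Qed.

Lemma ichg_vv_ida_l f b : ichg_vv (ida f) b = Ua (sfa (precomp C f) b).
Proof. by apply: hom_eq; [bd|bd|bd|bd|move=> X; exact: varr_id]. Qed.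

Lemma ichg_vv_ida_r a g : ichg_vv a (ida g) = Ua (sfa (postcomp A g) a).
Proof. by apply: hom_eq; [bd|bd|bd|bd|]. Qed.

Lemma tgt_src_vob D D' (x y : arr (hom D D')) : tgt x = src y ->
  forall X, tgt (vob x X) = src (vob y X).
Proof. by move=> h X; rewrite tgt_vob src_vob; exact: (congr1 (fun z => sfo z X) h). Qed.

Lemma ichg_vv_acomp_l a a' b : tgt a = src a' ->
    ichg_vv (a ·0 a') b =
    (Ua (sfa (postcomp A (src b)) a) · ichg_vv a' b)
      ⊙ (ichg_vv a b · Ua (sfa (postcomp A (tgt b)) a')).
Proof.
move=> h; apply: hom_eq; [bd|bd|bd|bd|move=> X].
rewrite mob_hcomps; [|bd]. rewrite mob_vcomp; [|bd]. rewrite mob_vcomp; [|bd].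
rewrite [LHS]/= vob_acomp //; apply: varr_comp; exact: tgt_src_vob.
Qed.

Lemma ichg_vv_acomp_r a b b' : tgt b = src b' ->
    ichg_vv a (b ·0 b') =
    (ichg_vv a b · Ua (sfa (precomp C (tgt a)) b'))
      ⊙ (Ua (sfa (precomp C (src a)) b) · ichg_vv a b').
Proof.
move=> h; apply: hom_eq; [bd|bd|bd|bd|move=> X].
rewrite mob_hcomps; [|bd]. rewrite mob_vcomp; [|bd]. rewrite mob_vcomp; [|bd].
by rewrite (acompE h) /= tgt_vob src_vob.
Qed.

Lemma ichg_hh_Uo_l f d :
  ichg_hh (Uo f) d = lam (sfp (precomp C f) d) · rhoV (sfp (precomp C f) d).
Proof.
apply: hom_eq; [bd|bd|bd|bd|move=> X].
rewrite mob_vcomp; [|bd]. exact: hpro_U.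
Qed.

Lemma ichg_hh_Uo_r c g :
  ichg_hh c (Uo g) = rho (sfp (postcomp A g) c) · lamV (sfp (postcomp A g) c).
Proof.
apply: hom_eq; [bd|bd|bd|bd|move=> X].
by rewrite mob_vcomp; [|bd].
Qed.

Lemma rob_lob_hob D D' (x y : pro (hom D D')) : rob x = lob y ->
  forall X, rob (hob x X) = lob (hob y X).
Proof. by move=> h X; rewrite rob_hob lob_hob; exact: (congr1 (fun z => sfo z X) h). Qed.

Lemma ichg_hh_hcomp_l c c' d : rob c = lob c' ->
    ichg_hh (c ⊙0 c') d =
      kap (sfp (postcomp A (lob d)) c) (sfp (postcomp A (lob d)) c') (sfp (precomp C (rob c')) d)
      · (ids (sfp (postcomp A (lob d)) c) ⊙ ichg_hh c' d)
      · kapV (sfp (postcomp A (lob d)) c) (sfp (precomp C (rob c)) d) (sfp (postcomp A (rob d)) c')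
      · (ichg_hh c d ⊙ ids (sfp (postcomp A (rob d)) c'))
      · kap (sfp (precomp C (lob c)) d) (sfp (postcomp A (rob d)) c) (sfp (postcomp A (rob d)) c').
Proof.
move=> h; apply: hom_eq; [bd|bd|bd|bd|move=> X].
do !(rewrite mob_vcomp; [|solve[bd]]). do !(rewrite mob_hcomps; [|solve[bd]]).
do !(rewrite mob_kap; [|solve[bd]|solve[bd]]). rewrite mob_kapV; [|bd..].
rewrite [LHS]/= hob_hcomp // hpro_hcomp; last exact: rob_lob_hob.
by rewrite ?bdE2.
Qed.

Lemma ichg_hh_hcomp_r c d d' : rob d = lob d' ->
    ichg_hh c (d ⊙0 d') =
      kapV (sfp (postcomp A (lob d)) c) (sfp (precomp C (rob c)) d) (sfp (precomp C (rob c)) d')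
      · (ichg_hh c d ⊙ ids (sfp (precomp C (rob c)) d'))
      · kap (sfp (precomp C (lob c)) d) (sfp (postcomp A (rob d)) c) (sfp (precomp C (rob c)) d')
      · (ids (sfp (precomp C (lob c)) d) ⊙ ichg_hh c d')
      · kapV (sfp (precomp C (lob c)) d) (sfp (precomp C (lob c)) d') (sfp (postcomp A (rob d')) c).
Proof.
move=> h; apply: hom_eq; [bd|bd|bd|bd|move=> X].
do !(rewrite mob_vcomp; [|solve[bd]]). do !(rewrite mob_hcomps; [|solve[bd]]).
do !(rewrite mob_kapV; [|solve[bd]|solve[bd]]). rewrite mob_kap; [|bd..].
by rewrite (hcompE h) /= /comp_cell rob_hob lob_hob.
Qed.

(** At an object [X], naturality in the first index is naturality of the second transformation at
    the square [mob x X]. *)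
Lemma ichg_natl_h (x : sq (hom A B)) d :
    (sfs (postcomp A (lob d)) x ⊙ ichg_vh (rarr x) d) · ichg_hh (bot x) d =
    ichg_hh (top x) d · (ichg_vh (larr x) d ⊙ sfs (postcomp A (rob d)) x).
Proof.
apply: hom_eq; [bd|bd|bd|bd|move=> X].
do !(rewrite mob_vcomp; [|solve[bd]]). do !(rewrite mob_hcomps; [|solve[bd]]).
have := h_nat d (mob x X); rewrite larr_mob rarr_mob top_mob bot_mob; exact: id.
Qed.

(** At an object [X], naturality in the last index is a modification axiom of [y]: the second one at
    [hob c X] here, the first one at [vob a X] in the arrow dimension. *)
Lemma ichg_natr_h c (y : sq (hom B C)) :
    ichg_hh c (top y) · (sfs (precomp C (lob c)) y ⊙ ichg_hv c (rarr y)) =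
    (ichg_hv c (larr y) ⊙ sfs (precomp C (rob c)) y) · ichg_hh c (bot y).
Proof.
apply: hom_eq; [bd|bd|bd|bd|move=> X].
do !(rewrite mob_vcomp; [|solve[bd]]). do !(rewrite mob_hcomps; [|solve[bd]]).
have := m_pro y (hob c X); rewrite rob_hob lob_hob; exact: id.
Qed.

Lemma ichg_natl_v (x : sq (hom A B)) b :
    cong (sfp (postcomp A (src b)) (top x)) (sfp (postcomp A (tgt b)) (bot x))
      ((sfs (postcomp A (src b)) x · ichg_hv (bot x) b) ⊙ ichg_vv (rarr x) b)
      (ichg_vv (larr x) b ⊙ (ichg_hv (top x) b · sfs (postcomp A (tgt b)) x)).
Proof.
rewrite /cong; apply: hom_eq; [bd|bd|bd|bd|move=> X].
do !(rewrite mob_vcomp; [|solve[bd]]). do !(rewrite mob_hcomps; [|solve[bd]]).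
do !(rewrite mob_vcomp; [|solve[bd]]).
have := v_nat b (mob x X); rewrite larr_mob rarr_mob top_mob bot_mob; exact: id.
Qed.

Lemma ichg_natr_v a (y : sq (hom B C)) :
    cong (sfp (precomp C (src a)) (top y)) (sfp (precomp C (tgt a)) (bot y))
      ((ichg_vh a (top y) · sfs (precomp C (tgt a)) y) ⊙ ichg_vv a (rarr y))
      (ichg_vv a (larr y) ⊙ (sfs (precomp C (src a)) y · ichg_vh a (bot y))).
Proof.
rewrite /cong; apply: hom_eq; [bd|bd|bd|bd|move=> X].
do !(rewrite mob_vcomp; [|solve[bd]]). do !(rewrite mob_hcomps; [|solve[bd]]).
do !(rewrite mob_vcomp; [|solve[bd]]).
have := m_arr y (vob a X); rewrite src_vob tgt_vob; exact: id.
Qed.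
End ChiLaws.

(** * The locally cubical Gray category of double categories *)

Definition DblCatG : gray_str (fun C D : dblcat => DblCat (hom_laws C D)) :=
  @GrayStr dblcat (fun C D : dblcat => DblCat (hom_laws C D))
    sfun_id (fun C D E F K => sfun_comp F K)
    (fun A' A B a => precomp B a) (fun A B B' b => postcomp A b)
    ichg_vh ichg_hv ichg_vv ichg_hh.

Lemma DblCatG_laws : gray_laws DblCatG.
Proof.
constructor.
- by [].
- by [].
- exact: ichg_vh_sq.
- exact: ichg_hv_sq.
- exact: ichg_vv_sq.
- exact: ichg_hh_sq.
- exact: precomp_id.
- exact: postcomp_id.
- by move=> A2 A1 A B a' a; exact: (@precomp_comp A B A2 A1 a' a).
- by move=> A B B1 B2 b b'; exact: (@postcomp_comp A B B1 B2 b b').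
- by move=> A' A B B' a b; exact: (@precomp_postcomp A B A' B' a b).
- exact: ichg_vh_precomp.
- exact: ichg_hv_precomp.
- exact: ichg_vv_precomp.
- exact: ichg_hh_precomp.
- by move=> *; exact: ichg_vh_postcomp.
- by move=> *; exact: ichg_hv_postcomp.
- by move=> *; exact: ichg_vv_postcomp.
- by move=> *; exact: ichg_hh_postcomp.
- by move=> *; exact: ichg_vh_mid.
- by move=> *; exact: ichg_hv_mid.
- by move=> *; exact: ichg_vv_mid.
- by move=> *; exact: ichg_hh_mid.
- exact: ichg_vh_ida.
- exact: ichg_vh_acomp.
- exact: ichg_vh_Uo.
- exact: ichg_vh_hcomp.
- exact: ichg_hv_Uo.
- exact: ichg_hv_hcomp.
- exact: ichg_hv_ida.
- exact: ichg_hv_acomp.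
- exact: ichg_vv_ida_l.
- exact: ichg_vv_ida_r.
- exact: ichg_vv_acomp_l.
- exact: ichg_vv_acomp_r.
- exact: ichg_hh_Uo_l.
- exact: ichg_hh_Uo_r.
- exact: ichg_hh_hcomp_l.
- exact: ichg_hh_hcomp_r.
- exact: ichg_natl_h.
- exact: ichg_natl_v.
- exact: ichg_natr_h.
- exact: ichg_natr_v.
Qed.

Theorem proposition3p7 :
  exists (S : forall C D : dblcat,
            dbl_str (sfun C D) (vtrans C D) (htrans C D) (modif C D))
         (HS : forall C D : dblcat, dbl_laws (DblData (S C D)))
         (G : gray_str (fun C D : dblcat => DblCat (HS C D))),
    (forall C D : dblcat, is_hom_str (S C D)) /\
    (forall C : dblcat, Id1 G C = sfun_id C) /\
    (forall (C D E : dblcat) (F : sfun C D) (K : sfun D E),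
       @comp1 _ _ G C D E F K = sfun_comp F K) /\
    gray_laws G.
Proof.
exists hom_str, hom_laws, DblCatG; split; first exact: is_hom_str_hom.
by split; [|split; [|exact: DblCatG_laws]].
Qed.
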